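(* There exist absolute constants $c_2,c_3,c_4>0$ such that for every $n\geq 1$ and every symmetric convex body $K$ in $\mathbb{R}^n$ there exists a convex body $T$ in $\mathbb{R}^n$ such that (i) $c_2K\subseteq T-T\subseteq c_3K$, and (ii) $L_T\leq \dfrac{c_4}{\sqrt{n\,s(K)^{1/n}}}$.
   Context: $\mathbb{R}^n$ carries the standard inner product $\langle\cdot,\cdot\rangle$ and Euclidean norm $\|\cdot\|_2$; $|\cdot|$ denotes volume. A convex body is a compact convex subset of $\mathbb{R}^n$ with non-empty interior; it is symmetric if $x\in K$ implies $-x\in K$. If $0$ is in the interior of $K$, the polar body is $K^{\circ}=\{y\in\mathbb{R}^n:\langle z,y\rangle\leq 1 \text{ for all } z\in K\}$ and the volume product is $s(K)=|K|\,|K^{\circ}|$. $T-T=\{x-y:x,y\in T\}$ is the difference body. Isotropic constant: for a convex body $T$ let $\mathrm{bar}(T)$ be its barycenter and $\tilde T=T-\mathrm{bar}(T)$. Then $$L_T=\frac{1}{\sqrt n}\inf_A\left(\frac{1}{|A(\tilde T)|^{1+2/n}}\int_{A(\tilde T)}\|x\|_2^2\,dx\right)^{1/2},$$ where the infimum is over all invertible linear maps $A:\mathbb{R}^n\to\mathbb{R}^n$. An absolute constant does not depend on the dimension $n$ or on the bodies involved. *)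

(* Defs.v *)
From HB Require Import structures.
From mathcomp Require Import all_boot all_order all_algebra.
From mathcomp Require Import all_classical all_reals all_analysis.
Import Order.TTheory GRing.Theory Num.Theory.
Import numFieldNormedType.Exports.

Set Implicit Arguments.
Unset Strict Implicit.
Unset Printing Implicit Defensive.

Local Open Scope classical_set_scope.
Local Open Scope ring_scope.

(* Vectors of R^n are row vectors 'rV[R]_n.  Their sigma-algebra is generated
   by the coordinate maps, as the library does for n.-tuple; on R^n this is the
   Borel sigma-algebra. *)

Definition measure_rV_display : measure_display -> measure_display.
Proof. exact. Qed.

Section measurable_rV.
Context {d} {T : measurableType d}.
Variable n : nat.

Let coors : 'I_n -> 'rV[T]_n -> T := fun i v => v ord0 i.

Let rV_set0 : g_sigma_preimage coors set0.
Proof. exact: sigma_algebra0. Qed.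

Let rV_setC A : g_sigma_preimage coors A -> g_sigma_preimage coors (~` A).
Proof. exact: sigma_algebraC. Qed.

Let rV_bigcup (F : (set 'rV[T]_n)^nat) :
  (forall i, g_sigma_preimage coors (F i)) ->
  g_sigma_preimage coors (\bigcup_i (F i)).
Proof. exact: sigma_algebra_bigcup. Qed.

HB.instance Definition _ := @isMeasurable.Build (measure_rV_display d)
  'rV[T]_n (g_sigma_preimage coors) rV_set0 rV_setC rV_bigcup.

End measurable_rV.

Section measurable_rV_theory.
Context d d' (U : measurableType d) (T : measurableType d').

Lemma measurable_coord n (i : 'I_n) :
  measurable_fun [set: 'rV[T]_n] (fun v => v ord0 i).
Proof.
move=> _ A mA; rewrite setTI; apply: sub_sigma_algebra.
case: n i => [[]//|n i].
rewrite -bigcup_mkord_ord; exists i; first exact: ltn_ord.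
by exists A => //; rewrite inord_val setTI.
Qed.

Lemma measurable_fun_rVP n (f : U -> 'rV[T]_n) :
  measurable_fun [set: U] f <->
  forall i, measurable_fun [set: U] (fun u => f u ord0 i).
Proof.
split=> [mf i|mf]; first exact: (measurableT_comp (measurable_coord i) mf).
move=> _ A; rewrite setTI => mA; move: A mA.
have : @measurable _ 'rV[T]_n `<=` [set A | measurable (f @^-1` A)]; last exact.
apply: smallest_sub.
  split => [|A|F].
  - by rewrite /= preimage_set0.
  - by move=> /= mA; rewrite setTD preimage_setC; exact: measurableC.
  - by move=> mF /=; rewrite preimage_bigcup; apply: bigcup_measurable => i _; exact: mF.
case: n f mf => [|n] f mf; first by rewrite big_ord0.
rewrite -bigcup_mkord_ord; apply: bigcup_sub => i _ _ [B mB <-] /=.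
rewrite setTI -comp_preimage -[X in measurable X]setTI.
exact: (mf (inord i) measurableT B mB).
Qed.

End measurable_rV_theory.

(* Lebesgue measure on R^n: the point mass on R^0, and at each further dimension
   the image of the product of the library's Lebesgue measure on R with the
   measure on R^n under the bijection R * R^n -> R^(n + 1).  The measure of a
   box is computed in lebesgue_rV_box. *)

Section lebesgue_rV.
Context {R : realType}.

Definition cons_rV n (p : measurableTypeR R * 'rV[R]_n) : 'rV[R]_n.+1 :=
  row_mx (\row_(_ < 1) p.1) p.2.

Definition uncons_rV n (v : 'rV[R]_n.+1) : measurableTypeR R * 'rV[R]_n :=
  (v ord0 ord0, \row_i v ord0 (lift ord0 i)).

Lemma cons_rV0 n p : @cons_rV n p ord0 ord0 = p.1.
Proof.
rewrite /cons_rV mxE; case: splitP => [j _|j]; last by [].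
by rewrite mxE.
Qed.

Lemma cons_rVS n p i : @cons_rV n p ord0 (lift ord0 i) = p.2 ord0 i.
Proof.
rewrite /cons_rV mxE; case: splitP => [j|j]; rewrite lift0 => ij.
  by have := ltn_ord j; rewrite -ij.
by congr (p.2 _ _); apply/val_inj; case: ij.
Qed.

Lemma cons_rVK n : cancel (@cons_rV n) (@uncons_rV n).
Proof.
move=> [x v]; rewrite /uncons_rV cons_rV0; congr pair.
by apply/rowP => i; rewrite mxE cons_rVS.
Qed.

Lemma measurable_cons_rV n : measurable_fun setT (@cons_rV n).
Proof.
apply/measurable_fun_rVP => i; case: (unliftP ord0 i) => [j ->|->].
  under eq_fun do rewrite cons_rVS.
  exact: (measurableT_comp (measurable_coord j) measurable_snd).
under eq_fun do rewrite cons_rV0.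
exact: measurable_fst.
Qed.

Lemma measurable_uncons_rV n : measurable_fun setT (@uncons_rV n).
Proof.
apply/measurable_fun_pairP; split; first exact: measurable_coord.
apply/measurable_fun_rVP => i; rewrite /comp/=.
under eq_fun do rewrite mxE.
exact: measurable_coord.
Qed.

Section step.
Variables (n : nat) (mu : {sigma_finite_measure set 'rV[R]_n -> \bar R}).

Definition lebesgue_rV_step : set 'rV[R]_n.+1 -> \bar R :=
  pushforward (@lebesgue_measure R \x mu)%E (@cons_rV n).

Let lebesgue_rV_step0 : lebesgue_rV_step set0 = 0%E.
Proof. by rewrite /lebesgue_rV_step /pushforward preimage_set0 measure0. Qed.

Let lebesgue_rV_step_ge0 A : (0 <= lebesgue_rV_step A)%E.
Proof. by rewrite /lebesgue_rV_step /pushforward measure_ge0. Qed.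

Let lebesgue_rV_step_sigma_additive : semi_sigma_additive lebesgue_rV_step.
Proof.
move=> F mF tF mUF; rewrite /lebesgue_rV_step /pushforward preimage_bigcup.
have mcons A : measurable A -> measurable (@cons_rV n @^-1` A).
  by rewrite -[X in _ -> measurable X]setTI; exact: measurable_cons_rV.
apply: measure_semi_sigma_additive.
- by move=> k; exact: mcons.
- apply/trivIsetP => /= i j _ _ ij; rewrite -preimage_setI.
  by move/trivIsetP : tF => /(_ _ _ _ _ ij) ->//; rewrite preimage_set0.
- by rewrite -preimage_bigcup; exact: mcons.
Qed.

HB.instance Definition _ := isMeasure.Build _ _ _ lebesgue_rV_step
  lebesgue_rV_step0 lebesgue_rV_step_ge0 lebesgue_rV_step_sigma_additive.

Let lebesgue_rV_step_sigma_finite : sigma_finite setT lebesgue_rV_step.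
Proof.
have /sigma_finiteP[F [FT ndF Foo]] := sigma_finiteT (@lebesgue_measure R).
have /sigma_finiteP[G [GT ndG Goo]] := sigma_finiteT mu.
exists (fun k => @uncons_rV n @^-1` (F k `*` G k)).
  rewrite -preimage_bigcup (_ : \bigcup_k _ = setT) ?preimage_setT//.
  rewrite -setXTT FT GT predeqE => -[x y]; split.
    by move=> [k _ []/= ? ?]; split; exists k.
  move=> [/= [k _ Fkx] [l _ Gly]]; exists (maxn k l) => //; split.
  - by move: x Fkx; exact/subsetPset/ndF/leq_maxl.
  - by move: y Gly; exact/subsetPset/ndG/leq_maxr.
move=> k; have [mF Fk] := Foo k; have [mG Gk] := Goo k.
have mFG : measurable (F k `*` G k) by exact: measurableX.
split.
  by rewrite -[X in measurable X]setTI; exact: measurable_uncons_rV.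
rewrite /lebesgue_rV_step /pushforward -comp_preimage.
rewrite (_ : _ \o _ = id); last by apply/funext => p /=; rewrite cons_rVK.
by rewrite preimage_id product_measure1E// lte_mul_pinfty// ge0_fin_numE.
Qed.

HB.instance Definition _ := Measure_isSigmaFinite.Build _ _ _ lebesgue_rV_step
  lebesgue_rV_step_sigma_finite.

End step.

Fixpoint lebesgue_rV n : {sigma_finite_measure set 'rV[R]_n -> \bar R} :=
  if n is k.+1 then lebesgue_rV_step (lebesgue_rV k)
  else \d_(0 : 'rV[R]_0).

Lemma lebesgue_rV_box n (a b : 'I_n -> R) : (forall i, a i <= b i) ->
  lebesgue_rV n [set x | forall i, a i <= x ord0 i <= b i] =
  (\prod_(i < n) (b i - a i))%:E.
Proof.
elim: n a b => [|n IHn] a b ab /=.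
  by rewrite big_ord0 diracE mem_set// => -[].
rewrite /lebesgue_rV_step /pushforward.
pose a' i := a (lift ord0 i); pose b' i := b (lift ord0 i).
pose B : set 'rV[R]_n := [set x | forall i, a' i <= x ord0 i <= b' i].
rewrite (_ : _ @^-1` _ = `[a ord0, b ord0]%classic `*` B); last first.
  apply/seteqP; split => [p /= pab|p /= [p0 pB] i].
    split; first by rewrite /= in_itv /= -[p.1]cons_rV0; exact: pab.
    by move=> i; have := pab (lift ord0 i); rewrite cons_rVS.
  case: (unliftP ord0 i) => [j ->|->]; first by rewrite cons_rVS; exact: pB.
  by rewrite cons_rV0; move: p0; rewrite in_itv.
have mB : measurable B.
  rewrite (_ : B = \bigcap_(i in [set` 'I_n])
      (fun x : 'rV[R]_n => x ord0 i) @^-1` `[a' i, b' i]%classic); last first.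
    apply/seteqP; split => x /= xB i; first by rewrite /= in_itv /= => _; exact: xB.
    by have := xB i isT; rewrite /= in_itv.
  apply: fin_bigcap_measurable => // i _.
  by rewrite -[X in measurable X]setTI; exact: measurable_coord.
transitivity (lebesgue_measure (`[a ord0, b ord0]%classic : set R) *
    lebesgue_rV n B)%E; first exact: product_measure1E.
rewrite lebesgue_measure_itv/= lte_fin.
rewrite IHn => [|i]; last exact: ab.
rewrite big_ord_recl EFinM; congr (_ * _)%E.
case: ltP => //= ba; congr EFin; apply/esym/eqP.
by rewrite subr_eq0 eq_le ba ab.
Qed.

End lebesgue_rV.

Section convex_geometry.
Context {R : realType} {n : nat}.
Implicit Types (x y : 'rV[R]_n) (K T : set 'rV[R]_n) (A : 'M[R]_n).

Definition dotp x y : R := \sum_(i < n) x ord0 i * y ord0 i.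

Definition norm2 x : R := Num.sqrt (dotp x x).

Definition convex_body K : Prop :=
  [/\ compact K, convex_set (K : set (convex_lmodType 'rV[R]_n))
    & interior K !=set0].

Definition symmetric_set K : Prop := forall x, K x -> K (- x).

(* Every volume below is that of a bounded Borel set, so that fine only
   removes the injection into the extended reals. *)
Definition vol K : R := fine (lebesgue_rV n K).

Definition polar K : set 'rV[R]_n := [set y | forall z, K z -> dotp z y <= 1].

Definition volume_product K : R := vol K * vol (polar K).

Definition difference_body T : set 'rV[R]_n := [set x - y | x in T & y in T].

Definition dilate (c : R) K : set 'rV[R]_n := [set c *: x | x in K].

Definition barycenter T : 'rV[R]_n :=
  \row_i ((vol T)^-1 * \int[lebesgue_rV n]_(x in T) x ord0 i).

Definition centered T : set 'rV[R]_n := [set x - barycenter T | x in T].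

(* Matrices act on row vectors on the right. *)
Definition linear_image A T : set 'rV[R]_n := [set x *m A | x in T].

Definition isotropic_functional T : R :=
  (vol T `^ (1 + 2 / n%:R))^-1 * \int[lebesgue_rV n]_(x in T) (norm2 x ^+ 2).

Definition isotropic_constant T : R :=
  (Num.sqrt n%:R)^-1 *
  inf [set Num.sqrt (isotropic_functional (linear_image A (centered T)))
      | A in [set A | A \in unitmx]].

End convex_geometry.

(* Main.v *)
(* Let [j] be the norm with unit ball [K].  For [u] in [polar K / 2], the body
   [T_u = {x | j x - <x, u> <= 1}] (the polar of the shifted body [polar K - u])
   is within a factor 2 of [K].  As [j - <., u>] is homogeneous, the moments of
   [T_u] are, up to factorials, those of the density [exp (<x, u> - j x)], an
   exponential family in [u] with mean map [mean] and covariance [covmx u], the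
   differential of [mean].  The map [mean] is injective and sends [polar K / 2]
   into [2 (n + 1) K]; comparing volumes, [\det (covmx u)] is at most
   [C ^ n n ^ n |K| / |polar K|] for some [u], and [T = T_u] is the required
   body.  The comparison of volumes avoids a change of variables formula:
   near each [c] the image of [mean] contains a parallelepiped of volume
   [\det (covmx c) d ^ n], and a finite Vitali family of cubes suffices since
   factors [C ^ n] are harmless. *)
Require Import Defs.
From HB Require Import structures.
From mathcomp Require Import all_boot all_order all_algebra.
From mathcomp Require Import all_classical all_reals all_analysis.
From mathcomp Require Import measurable_realfun.
From mathcomp Require Import ring lra.
Import Order.TTheory GRing.Theory Num.Theory.
Import numFieldNormedType.Exports.
Set Implicit Arguments.
Unset Strict Implicit.
Unset Printing Implicit Defensive.
Local Open Scope classical_set_scope.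
Local Open Scope ring_scope.

(** * Lebesgue measure on R^n *)

(** The tilts [u] stay in half of the polar body because there every weight lies between
    [expR (- (2 * j x))] and [expR (- (2^-1 * j x))]; integrability, Lipschitz bounds in [u] and
    lower bounds on the variance are then uniform in [u]. The centres [c] of the cubes lie in a
    quarter of the polar body, so that a small cube around each of them stays in the half. The sizes
    of these cubes are not controlled, but they cancel in the comparison of volumes. Only the
    determinant of the covariance matters in the end: a matrix that turns the covariance into the
    identity is a competitor in the infimum defining the isotropic constant, and its value there is
    bounded by means of that determinant and the volume of [T]. The constants:
    [2^-1 * j <= j - <., u> <= 3 / 2 * j] puts [T] between [2 / 3 K] and [2 K]. In the comparison of
    volumes 48 is 4 (the quarter) times 6 (cubes enlarged three times against images of half cubes)
    times 2 (from [2 (n + 1) K]), and 108 is [48 * (3 / 2) ^ 2]. *)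

Section lebesgue_affine.
Context {R : realType}.
Local Notation leb := (@lebesgue_measure R).
Local Notation RR := (measurableTypeR R).

Definition affine_fun (a b : R) (x : RR) : RR := a * x + b.

Lemma measurable_affine_fun a b : measurable_fun setT (affine_fun a b).
Proof. by apply: measurable_funD => //; exact: measurable_funM. Qed.

HB.instance Definition _ (a b : R) := isMeasurableFun.Build _ _ RR RR
  (affine_fun a b) (measurable_affine_fun a b).

(** Uniqueness of Lebesgue measure reduces the identity to half-open intervals, whose preimages are
    half-open on the same side because [a] is positive. *)
Lemma lebesgue_measure_affine (a b : R) (A : set RR) : 0 < a -> measurable A ->
  leb A = (a%:E * pushforward leb (affine_fun a b) A)%E.
Proof.
move=> a0 mA; have [a' a'E] : exists a' : {nonneg R}, a = a'%:num.
  by exists (NngNum (ltW a0)).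
rewrite a'E; rewrite a'E in a0.
apply: (@lebesgue_measure_unique R
  (mscale a' (pushforward leb (affine_fun a'%:num b)))) => //.
move=> _ [[c d]] _ <-; rewrite /= /mscale /= /pushforward.
rewrite (_ : _ @^-1` _ = `](c - b) / a'%:num, (d - b) / a'%:num]%classic); last first.
  apply/seteqP; split => x /=; rewrite !in_itv/= ltr_pdivrMr// ler_pdivlMr//;
    by rewrite ltrBlDr lerBrDr mulrC.
rewrite !lebesgue_measure_itv /= !lte_fin ltr_pM2r ?invr_gt0// ltrD2r.
case: ifPn => cd; rewrite ?mule0// -!EFinB -EFinM; congr EFin.
by field; rewrite gt_eqF.
Qed.

Lemma ge0_integral_oppr (f : RR -> \bar R) :
  measurable_fun setT f -> (forall x, 0 <= f x)%E ->
  (\int[leb]_x f (- x)%R = \int[leb]_x f x)%E.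
Proof.
move=> mf f0; rewrite -[LHS](@ge0_integral_pushforward _ _ _ _ R (-%R : RR -> RR) (@oppr_measurable R setT) leb setT f)//.
by apply: eq_measure_integral => A mA _; exact: lebesgue_measureN.
Qed.

Lemma ge0_integral_affine (a b : R) (f : RR -> \bar R) : a != 0 ->
  measurable_fun setT f -> (forall x, 0 <= f x)%E ->
  (`|a|%:E * \int[leb]_x f (a * x + b)%R = \int[leb]_x f x)%E.
Proof.
move=> a0 mf f0.
wlog ap : a a0 / 0 < a => [H|].
  have [ap|] := ltP 0 a; first exact: H.
  rewrite le_eqVlt (negbTE a0)/= => an.
  rewrite -normrN -(H (- a)) ?oppr_eq0 ?oppr_gt0//; congr (_ * _)%E.
  rewrite -[RHS]ge0_integral_oppr//.
    by apply: eq_integral => x _; rewrite mulrNN.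
  exact: (measurableT_comp mf (measurable_affine_fun (- a) b)).
rewrite gtr0_norm//.
rewrite -[in LHS](@ge0_integral_pushforward _ _ _ _ _ (affine_fun a b)
  (measurable_affine_fun a b) leb setT f)//.
rewrite -[a in LHS]/((NngNum (ltW ap))%:num) -ge0_integral_mscale//.
apply: eq_measure_integral => A mA _.
exact/esym/lebesgue_measure_affine.
Qed.

End lebesgue_affine.

(** * Borel sets and continuous functions on R^n *)

Section rV_measurable.
Context {R : realType} {n : nat}.
Local Notation V := 'rV[R]_n.

Lemma continuous_coord (i : 'I_n) : continuous (fun x : V => x ord0 i).
Proof. by move=> x; exact: coord_continuous. Qed.

Lemma normrV_ltP (x : V) (e : R) : 0 < e ->
  `|x| < e <-> forall i, `|x ord0 i| < e.
Proof.
move=> e0; rewrite /Num.norm/= mx_normrE; split.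
  by move=> /bigmax_ltP[_ h] i; exact: (h (ord0, i)).
by move=> h; apply/bigmax_ltP; split=> [//|[j i] _]; rewrite ord1; exact: h.
Qed.

Lemma normrV_leP (x : V) (e : R) : 0 <= e ->
  `|x| <= e <-> forall i, `|x ord0 i| <= e.
Proof.
move=> e0; rewrite /Num.norm/= mx_normrE; split.
  by move=> /bigmax_leP[_ h] i; exact: (h (ord0, i)).
by move=> h; apply/bigmax_leP; split=> [//|[j i] _]; rewrite ord1; exact: h.
Qed.

Lemma measurable_ball_rV (x : V) (e : R) : measurable (ball x e).
Proof.
have [e0|e0] := ltP 0 e; last first.
  rewrite (_ : ball x e = set0)//; apply/seteqP; split => // y.
  by rewrite -ball_normE/= => /(le_lt_trans (normr_ge0 _))/lt_le_trans/(_ e0); rewrite ltxx.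
rewrite (_ : ball x e = \bigcap_(i in [set` 'I_n])
   (fun y : V => y ord0 i) @^-1` (ball (x ord0 i) e)); last first.
  apply/seteqP; split => y.
    rewrite -ball_normE/= => /(normrV_ltP _ e0) h i _ /=.
    by have := h i; rewrite !mxE -ball_normE.
  move=> h; rewrite -ball_normE/=; apply/(normrV_ltP _ e0) => i.
  by have := h i isT; rewrite !mxE -ball_normE.
apply: fin_bigcap_measurable => // i _.
rewrite -[X in measurable X]setTI; apply: measurable_coord => //.
exact: measurable_ball.
Qed.

(** The sigma-algebra is generated by coordinates, in which a sup-norm ball is a finite intersection
    of strips; an open set is the union of the countably many rational balls that it contains. *)
Lemma open_measurable_rV (A : set V) : open A -> measurable A.
Proof.
move=> oA.
pose qv (q : 'rV[rat]_n) : V := map_mx ratr q.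
pose B (p : 'rV[rat]_n * rat) : set V := ball (qv p.1) (ratr p.2).
(* The default [(0, 0)] for codes of nothing is harmless: an index counts only if its ball lies in
   [A]. *)
pose dec (k : nat) : 'rV[rat]_n * rat := odflt (0, 0) (unpickle k).
rewrite (_ : A = \bigcup_(k in [set k | B (dec k) `<=` A]) B (dec k)).
  by apply: bigcup_measurable => k _; exact: measurable_ball_rV.
apply/seteqP; split => [x Ax|x [k /= kA /kA//]].
have /nbhs_ballP[e /= e0 eA] : nbhs x A by move: oA; rewrite openE => /(_ _ Ax).
  have [r r0 re] : exists2 r : rat, (0 < ratr r :> R) & (ratr r < e / 2).
    have [r] := @rat_in_itvoo R 0 (e / 2) (divr_gt0 e0 (ltr0n _ 2)).
    by rewrite in_itv/= => /andP[? ?]; exists r.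
  have hq i : exists q : rat, `|ratr q - x ord0 i| < ratr r.
    have [q] := @rat_in_itvoo R (x ord0 i - ratr r) (x ord0 i + ratr r) (ltac:(lra)).
    by rewrite in_itv/= => /andP[? ?]; exists q; rewrite ltr_distl; apply/andP.
  pose q := \row_i sval (cid (hq i)).
  have xq : `|qv q - x| < ratr r.
    apply/normrV_ltP => // i; rewrite !mxE; exact: svalP (cid (hq i)).
exists (pickle (q, r)); rewrite /= /dec pickleK /= /B/=; last by rewrite -ball_normE.
apply: subset_trans eA => y; rewrite -!ball_normE/= => yq.
  rewrite (_ : x - y = - (qv q - x) + (qv q - y)); last by rewrite opprB addrA subrK.
  rewrite (le_lt_trans (ler_normD _ _))// normrN; lra.
Qed.

Lemma closed_measurable_rV (A : set V) : closed A -> measurable A.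
Proof.
by move=> cA; rewrite -(setCK A); apply: measurableC; apply: open_measurable_rV; exact: closed_openC.
Qed.

Lemma compact_measurable_rV (A : set V) : compact A -> measurable A.
Proof. by move=> /(compact_closed (@norm_hausdorff _ _)); exact: closed_measurable_rV. Qed.

Lemma continuous_measurable_rV (f : V -> R) : continuous f -> measurable_fun setT f.
Proof.
move=> cf; apply: (measurability _ (RGenOpens.measurableE R)) => //.
move=> _ [_ [a [b ->] <-]]; rewrite setTI; apply: open_measurable_rV.
by apply: open_comp; [move=> + _; exact: cf | exact: interval_open].
Qed.

End rV_measurable.

Lemma lipschitz_continuous (R : realType) n (f : 'rV[R]_n -> R) (C : R) :
  0 < C -> (forall x y, `|f x - f y| <= C * `|x - y|) -> continuous f.
Proof.
move=> C0 h x.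
apply/(@cvgrPdist_lt _ R^o _ (nbhs x) (nbhs_filter x)) => e e0.
apply/nbhs_ballP; exists (C^-1 * e); first by rewrite /= mulr_gt0// invr_gt0.
move=> y; rewrite -ball_normE/= => xy; apply: (le_lt_trans (h x y)).
by rewrite -ltr_pdivlMl.
Qed.

Section integral_rV.
Context {R : realType}.
Local Notation leb := (@lebesgue_measure R).
Local Notation RR := (measurableTypeR R).
Local Notation lam n := (@lebesgue_rV R n).

Lemma ge0_integral_rVS_pair n (f : 'rV[R]_n.+1 -> \bar R) :
  measurable_fun setT f -> (forall x, 0 <= f x)%E ->
  (\int[lam n.+1]_v f v = \int[leb \x lam n]_p f (cons_rV p))%E.
Proof.
move=> mf f0.
have := (@ge0_integral_pushforward _ _ _ _ R (@cons_rV R n)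
  (@measurable_cons_rV R n) (leb \x lam n)%E setT f
  measurableT mf (fun x _ => f0 x)).
rewrite preimage_setT => <-. reflexivity.
Qed.

Lemma ge0_integral_rVS n (f : 'rV[R]_n.+1 -> \bar R) :
  measurable_fun setT f -> (forall x, 0 <= f x)%E ->
  (\int[lam n.+1]_v f v = \int[leb]_x \int[lam n]_v f (cons_rV (x, v)))%E.
Proof.
move=> mf f0; rewrite ge0_integral_rVS_pair//.
rewrite (fubini_tonelli1 (fun p => f (cons_rV p)))//.
exact: (measurableT_comp mf (@measurable_cons_rV R n)).
Qed.

Lemma ge0_integral_rVS_swap n (f : 'rV[R]_n.+1 -> \bar R) :
  measurable_fun setT f -> (forall x, 0 <= f x)%E ->
  (\int[lam n.+1]_v f v = \int[lam n]_v \int[leb]_x f (cons_rV (x, v)))%E.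
Proof.
move=> mf f0; rewrite ge0_integral_rVS_pair//.
rewrite (fubini_tonelli2 (fun p => f (cons_rV p)))//.
exact: (measurableT_comp mf (@measurable_cons_rV R n)).
Qed.

Lemma measurable_shift_rV n (b : 'rV[R]_n) :
  measurable_fun setT (fun v : 'rV[R]_n => v + b).
Proof.
apply/measurable_fun_rVP => i.
under eq_fun do rewrite mxE.
by apply: measurable_funD => //; exact: measurable_coord.
Qed.

Lemma measurable_mulmx_rV n m (A : 'M[R]_(n, m)) :
  measurable_fun setT (fun v : 'rV[R]_n => v *m A).
Proof.
apply/measurable_fun_rVP => i.
under eq_fun do rewrite mxE.
apply: measurable_sum => j; apply: measurable_funM => //; exact: measurable_coord.
Qed.

Lemma measurable_cons_rV_r n (x : R) : measurable_fun setT (fun v : 'rV[R]_n => cons_rV (x : RR, v)).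
Proof.
apply: (measurableT_comp (@measurable_cons_rV R n)).
apply/measurable_fun_pairP; split; [exact: measurable_cst|exact: measurable_id].
Qed.

Lemma measurable_cons_rV_l n (v : 'rV[R]_n) : measurable_fun setT (fun x : RR => cons_rV (x, v)).
Proof.
apply: (measurableT_comp (@measurable_cons_rV R n)).
apply/measurable_fun_pairP; split; [exact: measurable_id|exact: measurable_cst].
Qed.

Lemma cons_rVD n (x y : R) (u v : 'rV[R]_n) :
  cons_rV (x + y : RR, u + v) = cons_rV (x : RR, u) + cons_rV (y : RR, v).
Proof.
apply/rowP => i; rewrite [RHS]mxE; case: (unliftP ord0 i) => [j ->|->].
  by rewrite !cons_rVS mxE.
by rewrite !cons_rV0.
Qed.

Lemma uncons_rVK n : cancel (@uncons_rV R n) (@cons_rV R n).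
Proof.
move=> v; apply/rowP => i; case: (unliftP ord0 i) => [j ->|->].
  by rewrite cons_rVS mxE.
by rewrite cons_rV0.
Qed.

(** Induction on the dimension: Fubini isolates the first coordinate, where the one-dimensional
    formula applies with slope 1. *)
Lemma ge0_integral_shift n (b : 'rV[R]_n) (f : 'rV[R]_n -> \bar R) :
  measurable_fun setT f -> (forall x, 0 <= f x)%E ->
  (\int[lam n]_x f (x + b)%R = \int[lam n]_x f x)%E.
Proof.
elim: n b f => [|n IH] b f mf f0.
  by apply: eq_integral => x _; rewrite [x + b]thinmx0 [x]thinmx0.
have mfb : measurable_fun setT (fun x : 'rV[R]_n.+1 => f (x + b)).
  exact: (measurableT_comp mf (measurable_shift_rV b)).
rewrite !ge0_integral_rVS//.
rewrite -[b]uncons_rVK; case: (uncons_rV b) => b0 b1.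
transitivity (\int[leb]_x (fun x => \int[lam n]_v f (cons_rV (x, v))) (1 * x + b0)%R)%E.
  apply: eq_integral => x _ /=.
  rewrite -[RHS](IH b1).
  - by apply: eq_integral => v _; rewrite -cons_rVD mul1r.
  - exact: (measurableT_comp mf (measurable_cons_rV_r _)).
  - by [].
have := @ge0_integral_affine R 1 b0 (fun x => \int[lam n]_v f (cons_rV (x, v)))%E.
rewrite normr1 mul1e; apply.
- exact: oner_neq0.
- apply: (@measurable_fun_fubini_tonelli_F _ _ _ _ _ (lam n) (fun p => f (cons_rV p))) => //.
  exact: (measurableT_comp mf (@measurable_cons_rV R n)).
- by move=> x; exact: integral_ge0.
Qed.

End integral_rV.

(** * Linear change of variables *)

Section integral_linear.
Context {R : realType}.
Local Notation leb := (@lebesgue_measure R).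
Local Notation RR := (measurableTypeR R).
Local Notation lam n := (@lebesgue_rV R n).

(** As a predicate on matrices the formula is stable under products, so that it only has to be
    checked on shears and block diagonal matrices. *)
Let scales n (A : 'M[R]_n) := forall f : 'rV[R]_n -> \bar R,
  measurable_fun setT f -> (forall x, 0 <= f x)%E ->
  (`|\det A|%:E * \int[lam n]_x f (x *m A) = \int[lam n]_x f x)%E.

Let scalesM n (A B : 'M[R]_n) : scales A -> scales B -> scales (A *m B).
Proof.
move=> sA sB f mf f0.
rewrite -(sB f)// -(sA (fun x => f (x *m B)))//; last first.
  exact: (measurableT_comp mf (measurable_mulmx_rV B)).
rewrite det_mulmx normrM mulrC EFinM muleA; congr (_ * _)%E.
by apply: eq_integral => x _; rewrite mulmxA.
Qed.

Let cons_rV_block n (x : R) (v : 'rV[R]_n) (a : R) b c (D : 'M[R]_n) :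
  cons_rV (x : RR, v) *m (block_mx a%:M b c D : 'M[R]_(1 + n)) =
  cons_rV (a * x + (v *m c) ord0 ord0 : RR, x *: b + v *m D).
Proof.
have cE (y : R) (w : 'rV[R]_n) : cons_rV (y : RR, w) = row_mx (y%:M : 'M[R]_1) w.
  rewrite /cons_rV/=; apply: (congr1 (fun z : 'M[R]_1 => row_mx z w)).
  by apply/rowP => i; rewrite !mxE ord1 eqxx mulr1n.
rewrite [LHS](_ : _ = row_mx (x%:M : 'M[R]_1) v *m block_mx a%:M b c D); last by rewrite -cE.
rewrite mul_row_block !mul_scalar_mx cE; congr row_mx.
rewrite scale_scalar_mx mulrC raddfD/=; congr (_ + _).
by apply/rowP => i; rewrite [RHS]mxE !ord1 eqxx mulr1n.
Qed.

Let mcons n (f : 'rV[R]_n.+1 -> \bar R) : measurable_fun setT f ->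
  measurable_fun setT (fun p : RR * 'rV[R]_n => f (cons_rV p)).
Proof. by move=> mf; exact: (measurableT_comp mf (@measurable_cons_rV R n)). Qed.

Let mmul n (f : 'rV[R]_n -> \bar R) (A : 'M[R]_n) : measurable_fun setT f ->
  measurable_fun setT (fun x : 'rV[R]_n => f (x *m A)).
Proof. by move=> mf; exact: (measurableT_comp mf (measurable_mulmx_rV A)). Qed.

Let scales_ushear n (b : 'rV[R]_n) :
  scales (block_mx 1%:M b 0 1%:M : 'M[R]_(1 + n)).
Proof.
move=> f mf f0; rewrite det_ublock !det1 mulr1 normr1 mul1e.
rewrite !ge0_integral_rVS//; last exact: mmul.
apply: eq_integral => x _.
rewrite -[RHS](ge0_integral_shift (x *: b))//.
  apply: eq_integral => v _; rewrite cons_rV_block mul1r mulmx0 mxE addr0 mulmx1.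
  by rewrite addrC.
exact: (measurableT_comp mf (measurable_cons_rV_r _)).
Qed.

(** The first coordinate is translated by an amount that depends on the others, so it is integrated
    first; for the upper shear it is the other way round. *)
Let scales_lshear n (c : 'cV[R]_n) :
  scales (block_mx 1%:M 0 c 1%:M : 'M[R]_(1 + n)).
Proof.
move=> f mf f0; rewrite det_lblock !det1 mulr1 normr1 mul1e.
rewrite !ge0_integral_rVS_swap//; last exact: mmul.
apply: eq_integral => v _.
rewrite -[RHS](@ge0_integral_affine R 1 ((v *m c) ord0 ord0))//; last first.
  exact: (measurableT_comp mf (measurable_cons_rV_l _)).
rewrite normr1 mul1e; apply: eq_integral => x _.
by rewrite cons_rV_block scaler0 add0r mulmx1.
Qed.

Let scales_diag n (a : R) (D : 'M[R]_n) : a != 0 -> scales D ->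
  scales (block_mx a%:M 0 0 D : 'M[R]_(1 + n)).
Proof.
move=> a0 sD f mf f0; rewrite det_ublock det_scalar1 normrM.
rewrite !ge0_integral_rVS//; last exact: mmul.
pose g (x : RR) := (\int[lam n]_v f (cons_rV (x, v)))%E.
have g0 x : (0 <= g x)%E by exact: integral_ge0.
have mg : measurable_fun setT g.
  by apply: (@measurable_fun_fubini_tonelli_F _ _ _ _ _ (lam n) (fun p => f (cons_rV p))) => //; exact: mcons.
rewrite -[RHS](@ge0_integral_affine R a 0 g)//.
rewrite EFinM -muleA; congr (_ * _)%E.
rewrite -ge0_integralZl_EFin//; first last.
- have -> : (fun x : RR => \int[lam n]_v f (cons_rV (x, v) *m (block_mx a%:M 0 0 D : 'M[R]_(1 + n))))%E =
     fubini_F (lam n) (fun p => f (cons_rV p *m (block_mx a%:M 0 0 D : 'M[R]_(1 + n)))) by [].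
  apply: measurable_fun_fubini_tonelli_F => //.
  apply: (@mcons n (fun v => f (v *m _))); exact: mmul.
- by move=> x _; exact: integral_ge0.
apply: eq_integral => x _; rewrite /g -(sD (fun v => f (cons_rV (a * x + 0 : RR, v))))//.
  congr (_ * _)%E; apply: eq_integral => v _.
  by rewrite cons_rV_block mulmx0 mxE scaler0 add0r.
exact: (measurableT_comp mf (measurable_cons_rV_r _)).
Qed.

(* Block elimination; a zero pivot is first removed by a shear. *)
Let scales_unit n (A : 'M[R]_n) : A \in unitmx -> scales A.
Proof.
elim: n A => [|n IH] A Au.
  move=> f mf f0; rewrite det_mx00 normr1 mul1e; apply: eq_integral => x _.
  by rewrite [x *m A]thinmx0 [x]thinmx0.
suff H (B : 'M[R]_(1 + n)) : B ord0 ord0 != 0 -> B \in unitmx -> scales B.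
  have [A0|] := eqVneq (A ord0 ord0) 0; last by move=> A0; exact: (H A).
  have [i Ai] : exists i : 'I_n, A (lift ord0 i) ord0 != 0.
    apply/existsP; apply: contraT; rewrite negb_exists => /forallP h.
    move: Au; rewrite unitmxE (expand_det_col _ ord0) big1 ?unitr0// => i _.
    case: (unliftP ord0 i) => [j ->|->]; last by rewrite A0 mul0r.
    by have := h j; rewrite negbK => /eqP ->; rewrite mul0r.
  pose U (b : 'rV[R]_n) : 'M[R]_(1 + n) := block_mx 1%:M b 0 1%:M.
  have UU b : U (- b) *m U b = 1%:M.
    by rewrite /U mulmx_block !mulmx0 !mul0mx !mulmx1 !mul1mx !addr0 add0r subrr -scalar_mx_block.
  have Uu b : U b \in unitmx by rewrite unitmxE det_ublock !det1 mulr1 unitr1.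
  have -> : A = U (- delta_mx 0 i) *m (U (delta_mx 0 i) *m A) by rewrite mulmxA UU mul1mx.
  apply: scalesM; first exact: scales_ushear.
  apply: H; last by rewrite unitmx_mul Uu.
  rewrite mxE big_ord_recl A0 mulr0 add0r (bigD1 i)//= big1 => [|k ki]; last first.
    have -> : lift ord0 k = rshift 1 k by exact/val_inj.
    have -> : ord0 = lshift n ord0 :> 'I_(1 + n) by exact/val_inj.
    by rewrite block_mxEur mxE (negbTE ki) andbF mul0r.
  have -> : U (delta_mx 0 i) ord0 (lift ord0 i) = 1.
    have -> : lift ord0 i = rshift 1 i by exact/val_inj.
    have -> : ord0 = lshift n ord0 :> 'I_(1 + n) by exact/val_inj.
    by rewrite block_mxEur mxE !eqxx.
  by rewrite mul1r addr0.
move=> B0 Bu.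
set a := B ord0 ord0 in B0.
have BE : B = block_mx a%:M (ursubmx B) (dlsubmx B) (drsubmx B).
  rewrite -[LHS]submxK; congr block_mx; rewrite [LHS]mx11_scalar; congr _%:M.
  by rewrite !mxE; congr (B _ _); exact/val_inj.
(* The Schur complement of the pivot [a]: [B] is a lower shear times a block diagonal matrix times
   an upper shear. *)
pose S := drsubmx B - dlsubmx B *m (a^-1 *: ursubmx B).
have {}BE : B = block_mx 1%:M 0 (a^-1 *: dlsubmx B) 1%:M *m
    (block_mx a%:M 0 0 S *m block_mx 1%:M (a^-1 *: ursubmx B) 0 1%:M).
  rewrite !mulmx_block !mulmx0 !mul0mx !mulmx1 !mul1mx !addr0 !add0r mul_scalar_mx.
  rewrite scalerA mulfV// scale1r mul_mx_scalar scalerA mulfV// scale1r.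
  by rewrite -scalemxAl /S -scalemxAr addrC subrK.
have Su : S \in unitmx.
  move: Bu; rewrite {1}BE !unitmxE !det_mulmx det_lblock !det_ublock !det1 !mulr1 mul1r.
  by rewrite det_scalar1 unitrM => /andP[].
rewrite BE; apply: scalesM; first exact: scales_lshear.
apply: scalesM; last exact: scales_ushear.
by apply: scales_diag => //; exact: IH.
Qed.

Lemma ge0_integral_mulmx n (A : 'M[R]_n) (f : 'rV[R]_n -> \bar R) :
  A \in unitmx -> measurable_fun setT f -> (forall x, 0 <= f x)%E ->
  (`|\det A|%:E * \int[lam n]_x f (x *m A) = \int[lam n]_x f x)%E.
Proof. by move=> Au; exact: scales_unit. Qed.

End integral_linear.

(** * Integrals of homogeneous functions *)

Section gamma.
Context {R : realType}.
Local Notation leb := (@lebesgue_measure R).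

(** The antiderivative of [t ^+ m * expR (- t)] that vanishes at infinity; the recursion is
    integration by parts. *)
Fixpoint gamma_primitive (m : nat) (t : R) : R :=
  if m is k.+1 then k.+1%:R * gamma_primitive k t - t ^+ k.+1 * expR (- t)
  else - expR (- t).

Lemma gamma_primitive0 m : gamma_primitive m 0 = - (m`!)%:R.
Proof.
elim: m => [|m IH] /=; first by rewrite oppr0 expR0.
by rewrite IH expr0n mul0r subr0 factS natrM mulrN.
Qed.

Lemma is_derive_gamma_primitive m (t : R) :
  is_derive t 1 (gamma_primitive m) (t ^+ m * expR (- t)).
Proof.
have dexp : is_derive t 1 (fun t : R => expR (- t)) (- expR (- t)).
  by apply: is_derive_eq; rewrite /GRing.scale/= mulrN1.
elim: m => [|m IH].
  by apply: is_derive_eq; rewrite expr0 mul1r opprK.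
rewrite /gamma_primitive -/gamma_primitive.
have dX : is_derive t 1 (fun t : R => t ^+ m.+1) (m.+1%:R * t ^+ m).
  have := @is_deriveX _ _ id m.+1 t 1 1 (is_derive_id t 1).
  rewrite (_ : id ^+ m.+1 = (fun t : R => t ^+ m.+1)); last by apply/funext => x; rewrite exprfctE.
  by rewrite /GRing.scale/= mulr1.
have := is_deriveB (is_deriveZ m.+1%:R IH) (is_deriveM dX dexp).
rewrite (_ : _ - _ = t ^+ m.+1 * expR (- t)) //.
by rewrite /GRing.scale/=; ring.
Qed.

Lemma cvg_pow_expR m : t ^+ m * expR (- t) @[t --> +oo] --> (0 : R).
Proof.
have fact_gt0 : 0 < (m.+1`!)%:R :> R by rewrite ltr0n fact_gt0.
apply: (@squeeze_cvgr _ _ _ _ (cst 0) (fun t => (m.+1`!)%:R / t)).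
- near=> t.
  have t0 : 0 < t by near: t; exact: nbhs_pinfty_gt.
  rewrite mulr_ge0 ?exprn_ge0 ?expR_ge0 ?(ltW t0)//=.
  rewrite expRN ler_pdivrMr ?expR_gt0// mulrAC ler_pdivlMr// -exprSr -ler_pdivrMl// mulrC.
  by apply: le_trans (expR_ge1Dxn m (ltW t0)); rewrite lerDr.
- exact: cvg_cst.
- rewrite -(mulr0 (m.+1`!)%:R); apply: cvgM; first exact: cvg_cst.
  apply/(gtr0_cvgV0 (f := id)); last exact: cvg_id.
  exact: nbhs_pinfty_gt.
Unshelve. all: by end_near. Qed.

Lemma cvg_gamma_primitive m : gamma_primitive m t @[t --> +oo] --> (0 : R).
Proof.
elim: m => [|m IH] /=.
  by rewrite -oppr0; apply: cvgN; exact: cvgr_expR.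
rewrite -[X in _ --> X](subr0 0); apply: cvgB; last exact: cvg_pow_expR.
by rewrite -(mulr0 m.+1%:R); apply: cvgM => //; exact: cvg_cst.
Qed.

Lemma integral_pow_expR m :
  (\int[leb]_(t in `]0%R, +oo[) (t ^+ m * expR (- t))%:E = (m`!)%:R%:E :> \bar R)%E.
Proof.
have cf : continuous (fun t : R => t ^+ m * expR (- t)).
  move=> t; apply: cvgM; first exact: exprn_continuous.
  by apply: continuous_comp; [exact: opp_continuous|exact: continuous_expR].
rewrite integral_itv_obnd_cbnd; last first.
  by apply/measurable_EFinP; apply: measurable_funTS; exact: continuous_measurable_fun.
rewrite (@ge0_continuous_FTC2y R _ (gamma_primitive m) 0 0).
- by rewrite gamma_primitive0 EFinN oppeK add0e.
- by move=> t t0; rewrite mulr_ge0 ?exprn_ge0 ?expR_ge0.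
- by apply: continuous_subspaceT.
- exact: cvg_gamma_primitive.
- by move=> t _; apply: (@ex_derive _ _ _ _ _ _ _ (is_derive_gamma_primitive m t)).
- apply: cvg_at_right_filter; apply: differentiable_continuous.
  by apply/derivable1_diffP; apply: (@ex_derive _ _ _ _ _ _ _ (is_derive_gamma_primitive m 0)).
- by move=> t _; rewrite derive1E; apply: derive_val; exact: is_derive_gamma_primitive.
Qed.

Lemma integral_expR_tail (s : R) : 0 <= s ->
  (\int[leb]_(t in `[s, +oo[) (expR (- t))%:E = (expR (- s))%:E :> \bar R)%E.
Proof.
move=> s0.
have cf : continuous (fun t : R => expR (- t)).
  by move=> t; apply: continuous_comp; [exact: opp_continuous|exact: continuous_expR].
rewrite (@ge0_continuous_FTC2y R _ (gamma_primitive 0) s 0).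
- by rewrite -EFinB sub0r /= opprK.
- by move=> t t0; rewrite expR_ge0.
- by apply: continuous_subspaceT.
- exact: cvg_gamma_primitive.
- by move=> t _; apply: (@ex_derive _ _ _ _ _ _ _ (is_derive_gamma_primitive 0 t)).
- apply: cvg_at_right_filter; apply: differentiable_continuous.
  by apply/derivable1_diffP; apply: (@ex_derive _ _ _ _ _ _ _ (is_derive_gamma_primitive 0 s)).
- move=> t _; rewrite derive1E; have := is_derive_gamma_primitive 0 t.
  by rewrite expr0 mul1r => h; exact: derive_val.
Qed.

End gamma.

Section homogeneous.
Context {R : realType}.
Local Notation leb := (@lebesgue_measure R).
Local Notation RR := (measurableTypeR R).
Local Notation lam n := (@lebesgue_rV R n).

Lemma ge0_integral_scale n (t : R) (f : 'rV[R]_n -> \bar R) : 0 < t ->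
  measurable_fun setT f -> (forall x, 0 <= f x)%E ->
  (\int[lam n]_x f x = (t ^+ n)%:E * \int[lam n]_x f (t *: x))%E.
Proof.
move=> t0 mf f0.
have tu : (t%:M : 'M[R]_n) \in unitmx.
  by rewrite unitmxE det_scalar unitrX// unitfE gt_eqF.
rewrite -(ge0_integral_mulmx tu)// det_scalar ger0_norm ?exprn_ge0 ?(ltW t0)//.
by congr (_ * _)%E; apply: eq_integral => x _; rewrite mul_mx_scalar.
Qed.

Lemma measurable_sublevel_rV n (q : 'rV[R]_n -> R) (t : R) :
  measurable_fun setT q -> measurable [set x | q x <= t].
Proof.
move=> mq; rewrite (_ : mkset _ = q @^-1` `]-oo, t]%classic).
  by rewrite -[X in measurable X]setTI; apply: mq => //; exact: measurable_itv.
by apply/seteqP; split => x /=; rewrite in_itv.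
Qed.

(* The layer-cake formula [expR (- q x) = \int_(t >= q x) expR (- t)] and the
   scaling of the sublevel sets of [q]. *)
Lemma ge0_integral_homogeneous n k (q g : 'rV[R]_n -> R) :
  measurable_fun setT q -> measurable_fun setT g ->
  (forall x, 0 <= q x) -> (forall x, 0 <= g x) ->
  (forall t x, 0 < t -> q (t *: x) = t * q x) ->
  (forall t x, 0 < t -> g (t *: x) = t ^+ k * g x) ->
  (\int[lam n]_x (g x * expR (- q x))%R%:E =
   ((n + k)`!)%:R%:E * \int[lam n]_(x in [set x | q x <= 1]%R) (g x)%:E)%E.
Proof.
move=> mq mg q0 g0 qZ gZ.
(* Only positive levels [t] are kept, since the sublevel sets are scaled by [t]. Where [q x = 0]
   this drops the level 0 alone, a null set. *)
pose S := [set p : RR * 'rV[R]_n | 0 < p.1 /\ q p.2 <= p.1].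
have mS : measurable S.
  rewrite (_ : S = (fun p : RR * 'rV[R]_n => p.1) @^-1` `]0%R, +oo[%classic `&`
                   (fun p : RR * 'rV[R]_n => p.1 - q p.2) @^-1` `[0%R, +oo[%classic).
    apply: measurableI; rewrite -[X in measurable X]setTI.
      by apply: measurable_fst => //; exact: measurable_itv.
    have : measurable_fun setT (fun p : RR * 'rV[R]_n => p.1 - q p.2).
      apply: measurable_funB; first exact: measurable_fst.
      exact: (measurableT_comp mq measurable_snd).
    by apply => //; exact: measurable_itv.
  by apply/seteqP; split => p /=; rewrite /S !in_itv/= !andbT subr_ge0.
pose h (p : RR * 'rV[R]_n) := (g p.2 * expR (- p.1))%:E.
have mh : measurable_fun setT h.
  apply/measurable_EFinP; apply: measurable_funM.
    exact: (measurableT_comp mg measurable_snd).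
  apply: (measurableT_comp (@measurable_expR R)).
  by apply: measurable_funN; exact: measurable_fst.
have h0 p : (0 <= h p)%E by rewrite lee_fin mulr_ge0 ?expR_ge0.
pose f := h \_ S.
have mf : measurable_fun setT f by apply/(measurable_restrictT _ mS); exact: measurable_funTS.
have f0 p : (0 <= f p)%E by rewrite /f patchE; case: ifPn.
have mexp : measurable_fun setT (fun t : RR => expR (- t)).
  by apply: (measurableT_comp (@measurable_expR R)); exact: measurable_funN.
transitivity (\int[lam n]_x \int[leb]_t f (t, x))%E.
  apply: eq_integral => x _.
  transitivity (\int[leb]_(t in [set t | S (t, x)]) ((g x)%:E * (expR (- t)%R)%:E))%E; last first.
    by rewrite integral_mkcond; apply: eq_integral => t _; rewrite /f !patchE.
  have mSx : measurable [set t : RR | S (t, x)].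
    rewrite (_ : mkset _ = `]0%R, +oo[%classic `&` `[q x, +oo[%classic).
      by apply: measurableI; exact: measurable_itv.
    by apply/seteqP; split => t /=; rewrite /S /= !in_itv/= !andbT.
  rewrite ge0_integralZl_EFin//; last by apply/measurable_EFinP; exact: measurable_funTS.
  rewrite EFinM; congr (_ * _)%E.
  have [qx|] := ltP 0 (q x).
    rewrite -integral_expR_tail; last exact: ltW.
    congr (integral _ _ _); apply/seteqP; split => t /=; rewrite /S /= in_itv/= andbT.
      by move=> qt; split => //; exact: lt_le_trans qt.
    by case.
  rewrite le_eqVlt ltNge q0 orbF => /eqP qx.
  rewrite qx -integral_expR_tail// -integral_itv_obnd_cbnd; last first.
    by apply/measurable_EFinP; exact: measurable_funTS.
  congr (integral _ _ _); apply/seteqP; split => t /=; rewrite /S /= qx in_itv/= andbT.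
    by move=> qt; split => //; exact: ltW.
  by case.
rewrite -(fubini_tonelli (m1 := leb) f)//.
transitivity (\int[leb]_(t in `]0%R, +oo[) ((t ^+ (n + k) * expR (- t))%R%:E *
    \int[lam n]_(x in [set x | q x <= 1]%R) (g x)%:E))%E.
  rewrite [RHS]integral_mkcond; apply: eq_integral => t _; rewrite patchE.
  case: ifPn => [|t0]; last first.
    apply: integral0_eq => x _; rewrite /f patchE ifN//.
    apply: contra t0; rewrite !inE /S/= => -[t0 _].
    by rewrite in_itv/= t0.
  rewrite inE/= in_itv/= andbT => t0.
  rewrite (ge0_integral_scale t0); last 2 first.
  - apply: (measurableT_comp mf).
    by apply/measurable_fun_pairP; split; [exact: measurable_cst|exact: measurable_id].
  - by [].
  rewrite exprD -mulrA EFinM -muleA; congr (_ * _)%E.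
  have mT := measurable_sublevel_rV 1 mq.
  rewrite -ge0_integralZl_EFin//; first last.
  - by rewrite mulr_ge0 ?expR_ge0 ?exprn_ge0 ?(ltW t0).
  - by apply/measurable_EFinP; exact: measurable_funTS.
  - by move=> x _; rewrite lee_fin.
  rewrite [RHS]integral_mkcond; apply: eq_integral => x _.
  rewrite /f !patchE.
  have -> : ((t, t *: x) \in S) = (x \in [set x | q x <= 1]).
    have tq : (t * q x <= t) = (q x <= 1) by rewrite -[X in _ <= X]mulr1 ler_pM2l.
    by apply/idP/idP; rewrite !inE /S /= qZ// tq => // -[].
  by case: ifPn => // _; rewrite /h /= gZ// -EFinM; congr EFin; ring.
rewrite ge0_integralZr//; first by rewrite integral_pow_expR.
- by apply/measurable_EFinP; apply: measurable_funM => //; exact: measurable_funTS.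
- move=> t /=; rewrite in_itv/= andbT => t0.
  by rewrite lee_fin mulr_ge0 ?expR_ge0 ?exprn_ge0 ?(ltW t0).
- by apply: integral_ge0 => x _; rewrite lee_fin.
Qed.

End homogeneous.

(** * Polar bodies and separation *)

Section dot_product.
Context {R : realType} {n : nat}.
Implicit Types (x y z : 'rV[R]_n) (K : set 'rV[R]_n).

Lemma dotpC x y : dotp x y = dotp y x.
Proof. by apply: eq_bigr => i _; rewrite mulrC. Qed.

Lemma dotpDl x y z : dotp (x + y) z = dotp x z + dotp y z.
Proof. by rewrite -big_split; apply: eq_bigr => i _; rewrite mxE mulrDl. Qed.

Lemma dotpZl t x y : dotp (t *: x) y = t * dotp x y.
Proof. by rewrite mulr_sumr; apply: eq_bigr => i _; rewrite mxE mulrA. Qed.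

Lemma dotpDr x y z : dotp x (y + z) = dotp x y + dotp x z.
Proof. by rewrite !(dotpC x) dotpDl. Qed.

Lemma dotpZr t x y : dotp x (t *: y) = t * dotp x y.
Proof. by rewrite !(dotpC x) dotpZl. Qed.

Lemma dotpNl x y : dotp (- x) y = - dotp x y.
Proof. by rewrite -scaleN1r dotpZl mulN1r. Qed.

Lemma dotpNr x y : dotp x (- y) = - dotp x y.
Proof. by rewrite !(dotpC x) dotpNl. Qed.

Lemma dotpBl x y z : dotp (x - y) z = dotp x z - dotp y z.
Proof. by rewrite dotpDl dotpNl. Qed.

Lemma dotpBr x y z : dotp x (y - z) = dotp x y - dotp x z.
Proof. by rewrite dotpDr dotpNr. Qed.

Lemma dotp0l x : dotp 0 x = 0.
Proof. by rewrite -(scale0r 0) dotpZl mul0r. Qed.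

Lemma dotp0r x : dotp x 0 = 0.
Proof. by rewrite dotpC dotp0l. Qed.

Lemma dotp_delta x i : dotp x (delta_mx ord0 i) = x ord0 i.
Proof.
rewrite /dotp (bigD1 i)//= big1 ?addr0 ?mxE ?eqxx ?mulr1// => k ki.
by rewrite mxE (negbTE ki) andbF mulr0.
Qed.

Lemma coord_le_norm x i : `|x ord0 i| <= `|x|.
Proof. by have /normrV_leP := lexx `|x|; apply. Qed.

Lemma normr_dotp x y : `|dotp x y| <= n%:R * (`|x| * `|y|).
Proof.
apply: le_trans (ler_norm_sum _ _ _) _.
rewrite mulr_natl -[X in _ *+ X]card_ord -sumr_const ler_sum// => i _.
by rewrite normrM ler_pM// coord_le_norm.
Qed.

Lemma dotp_ge0 x : 0 <= dotp x x.
Proof. by rewrite sumr_ge0// => i _; rewrite -expr2 sqr_ge0. Qed.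

Lemma dotp_gt0 x : x != 0 -> 0 < dotp x x.
Proof.
move=> x0; rewrite lt_neqAle dotp_ge0 andbT eq_sym; apply: contra x0.
rewrite psumr_eq0 => [/allP h|i _]; last by rewrite -expr2 sqr_ge0.
apply/eqP/rowP => i; rewrite mxE; apply/eqP.
by have /(_ (mem_index_enum i)) := h i; rewrite mulf_eq0 orbb.
Qed.

Lemma continuous_sum I (r : seq I) (T : topologicalType) (f : I -> T -> R) :
  (forall i, continuous (f i)) -> continuous (fun u => \sum_(i <- r) f i u).
Proof.
move=> cf; elim: r => [|i r IH] u.
  by under eq_fun do rewrite big_nil; exact: cvg_cst.
rewrite (_ : (fun u => _) = (fun u => f i u + \sum_(k <- r) f k u)).
  by apply: cvgD; [exact: cf|exact: IH].
by apply/funext => v; rewrite big_cons.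
Qed.

Lemma continuous_dotpl y : continuous (dotp^~ y).
Proof.
apply: continuous_sum => i x.
exact: (cvgM (@continuous_coord R n i x) (cvg_cst _)).
Qed.

Lemma continuous_dotp_diag : continuous (fun x => dotp x x).
Proof.
apply: continuous_sum => i x.
exact: (cvgM (@continuous_coord R n i x) (@continuous_coord R n i x)).
Qed.

Lemma convex_setP K : convex_set (K : set (convex_lmodType 'rV[R]_n)) <->
  forall x y t, K x -> K y -> 0 <= t -> t <= 1 -> K (t *: x + (1 - t) *: y).
Proof.
split=> [cK x y t Kx Ky t0 t1|cK x y t].
  have := cK x y (Itv01 t0 t1); rewrite !inE => /(_ Kx Ky).
  by rewrite /conv/=.
by rewrite !inE => Kx Ky; apply: cK.
Qed.

End dot_product.

Section polar_body.
Context {R : realType} {n : nat}.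
Implicit Types (x y z : 'rV[R]_n) (K : set 'rV[R]_n).

Lemma bounded_set_normP K : bounded_set K -> exists2 M : R, 0 < M & forall x, K x -> `|x| <= M.
Proof.
move=> [M [_ h]]; exists (`|M| + 1) => [|x Kx].
  by rewrite ltr_wpDl.
by apply: h Kx; rewrite (le_lt_trans (ler_norm _))// ltrDl.
Qed.

Lemma compact_normP K : compact K -> exists2 M : R, 0 < M & forall x, K x -> `|x| <= M.
Proof. by move=> /compact_bounded/bounded_set_normP. Qed.

(** The normal is [p - z] for the point [z] of [K] nearest to [p]: a small move from [z] towards
    another point of [K] cannot shorten the distance, which fixes the sign of the first-order
    term. *)
Lemma separation K p : compact K -> K !=set0 ->
  convex_set (K : set (convex_lmodType 'rV[R]_n)) -> ~ K p ->
  exists w c, (forall z, K z -> dotp z w <= c) /\ c < dotp p w.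
Proof.
move=> cK K0 /convex_setP vK Kp.
have cd : continuous (fun x => dotp (p - x) (p - x)).
  move=> x; apply: (@continuous_comp _ _ _ (fun x => p - x) (fun x => dotp x x)).
    by apply: continuousB; [exact: cst_continuous|move=> ?].
  exact: continuous_dotp_diag.
have [z /set_mem Kz zmin] := compact_EVT_min K0 cK (continuous_subspaceT cd).
exists (p - z), (dotp z (p - z)); split; last first.
  rewrite -subr_gt0 -dotpBl; apply: dotp_gt0; rewrite subr_eq0.
  by apply: contraPneq Kz => <-.
move=> y Ky; rewrite -subr_le0 -dotpBl; apply/ler_addgt0Pr => e e0; rewrite add0r.
set D := dotp (y - z) (y - z).
have D0 : 0 <= D := dotp_ge0 _.
(* Small enough for the second-order term [t * D] to be at most [e]; [D + 1] avoids dividing by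
   zero. *)
pose t := Num.min 1 (e / (D + 1)).
have t0 : 0 < t by rewrite lt_min ltr01 divr_gt0// ltr_wpDl.
have t1 : t <= 1 by rewrite ge_min lexx.
have te : t * D <= e.
  apply: (@le_trans _ _ (e / (D + 1) * D)).
    by rewrite ler_wpM2r// ge_min lexx orbT.
  by rewrite mulrAC ler_pdivrMr ?ltr_wpDl// ler_pM2l// lerDl.
have := zmin _ (mem_set (vK _ _ t Ky Kz (ltW t0) t1)).
have -> : p - (t *: y + (1 - t) *: z) = (p - z) - t *: (y - z).
  by apply/rowP => i; rewrite !mxE; ring.
have expand u v : dotp (u - t *: v) (u - t *: v) = dotp u u - 2 * t * dotp v u + t ^+ 2 * dotp v v.
  by rewrite dotpBl !dotpBr !dotpZl !dotpZr (dotpC u v); ring.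
rewrite expand -/D => h.
suff : 0 <= t * (t * D - 2 * dotp (y - z) (p - z)).
  rewrite pmulr_rge0// subr_ge0; lra.
by move: h; rewrite -subr_ge0; congr (0 <= _); ring.
Qed.

(** For [P = polar K] this is the norm with unit ball [K]. *)
Definition support (P : set 'rV[R]_n) x : R := sup [set dotp x y | y in P].

(** The interface through which the norm is used from here on. The last two fields say that [j] is
    the support function of [polar K]. The comparison constants [a] and [b] depend on [K] but do not
    reach the final bounds. *)
Record is_gauge K (j : 'rV[R]_n -> R) (a b : R) : Prop := IsGauge {
  gauge_lo_gt0 : 0 < a;
  gauge_hi_gt0 : 0 < b;
  gauge_lo : forall x, a * `|x| <= j x;
  gauge_hi : forall x, j x <= b * `|x|;
  gaugeD : forall x y, j (x + y) <= j x + j y;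
  gaugeZ : forall t x, j (t *: x) = `|t| * j x;
  gaugeP : forall x, K x <-> j x <= 1;
  gauge_polar : forall x y, polar K y -> dotp x y <= j x;
  gauge_bipolar : forall x c, (forall y, polar K y -> dotp x y <= c) -> j x <= c }.

Variable K : set 'rV[R]_n.
Hypothesis Kbody : convex_body K.
Hypothesis Ksym : symmetric_set K.

(** If [x0] is interior, [x] is the midpoint of [x0 + x] and of the reflection of [x0 - x]. *)
Lemma body_ball : exists2 e : R, 0 < e & forall x, `|x| <= e -> K x.
Proof.
have [cK /convex_setP vK [x0 x0K]] := Kbody.
have /nbhs_ballP[e /= e0 eK] : nbhs x0 K by [].
exists (e / 2) => [|x xe]; first by rewrite divr_gt0.
have xe' : `|x| < e by rewrite (le_lt_trans xe)//; lra.
have K1 : K (x0 + x) by apply: eK; rewrite -ball_normE/= opprD addrA subrr sub0r normrN.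
have K2 : K (- (x0 - x)).
  by apply: Ksym; apply: eK; rewrite -ball_normE/= opprB addrC subrK.
have := vK _ _ (2^-1) K1 K2 ltac:(lra) ltac:(lra).
by congr K; apply/rowP => i; rewrite !mxE; field.
Qed.

Lemma polar_symmetric : symmetric_set (polar K).
Proof. by move=> y Py z Kz; rewrite dotpNr -dotpNl; exact/Py/Ksym. Qed.

Lemma polar_bounded : exists2 B : R, 0 < B & forall y, polar K y -> `|y| <= B.
Proof.
have [e e0 eK] := body_ball; exists e^-1 => [|y Py]; first by rewrite invr_gt0.
apply/normrV_leP => [|i]; first by rewrite invr_ge0 ltW.
have Ke s : `|s| <= 1 -> K (s *: (e *: delta_mx ord0 i)).
  move=> s1; apply: eK; rewrite scalerA; apply/normrV_leP => [|k]; first exact: ltW.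
  rewrite !mxE eqxx/= normrM normrM (gtr0_norm e0).
  case: (_ == _); rewrite ?normr0 ?mulr0 ?(ltW e0)// normr1 mulr1.
  by rewrite -[leRHS]mul1r ler_pM2r.
have h s : `|s| <= 1 -> s * (e * y ord0 i) <= 1.
  by move=> /Ke /Py; rewrite !dotpZl (dotpC (delta_mx _ _)) dotp_delta.
rewrite ler_norml -(ler_pM2l e0) -[X in _ && X](ler_pM2l e0) mulrN mulfV ?gt_eqF//.
have := h 1; have := h (-1); rewrite normrN normr1 lexx => /(_ isT) ? /(_ isT) ?.
by apply/andP; split; lra.
Qed.

Lemma polar_ball : exists2 e : R, 0 < e & forall y, `|y| <= e -> polar K y.
Proof.
have [cK _ _] := Kbody; have [M M0 KM] := compact_normP cK.
(* With [n.+1] in place of [n] the radius is positive in dimension 0 as well. *)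
exists (n.+1%:R * M)^-1 => [|y ye z Kz]; first by rewrite invr_gt0 mulr_gt0.
apply: (le_trans (ler_norm _)); apply: (le_trans (normr_dotp _ _)).
apply: (@le_trans _ _ (n.+1%:R * M * `|y|)).
  by rewrite mulrA ler_wpM2r// ler_pM ?ler0n// ?ler_nat// KM.
by rewrite -ler_pdivlMl ?mulr_gt0// mulr1.
Qed.

Lemma closed_polar : closed (polar K).
Proof.
rewrite (_ : polar K = \bigcap_(z in K) (dotp^~ z @^-1` [set t | t <= 1])).
  apply: closed_bigI => z _; apply: closed_comp; last exact: closed_le.
  by move=> x _; exact: continuous_dotpl.
by apply/seteqP; split => y h z Kz /=; rewrite dotpC; exact: h.
Qed.

Lemma compact_polar : compact (polar K).
Proof.
apply: bounded_closed_compact; last exact: closed_polar.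
have [B B0 h] := polar_bounded; exists B; split; first exact: gtr0_real.
by move=> M BM y /h yB; exact: ltW (le_lt_trans yB BM).
Qed.

Lemma polar0 : polar K 0.
Proof. by move=> z _; rewrite dotp0r. Qed.

Lemma body0 : K 0.
Proof. by have [e e0 h] := body_ball; apply: h; rewrite normr0 ltW. Qed.

(** A separating normal, divided by a level strictly between [c] and [dotp p w], lies in the polar
    body and contradicts the hypothesis on [p]. The midpoint serves as level, because [c] is only
    known to be nonnegative. *)
Lemma bipolar p : (forall y, polar K y -> dotp p y <= 1) -> K p.
Proof.
move=> h; apply: contrapT => Kp; have [cK vK _] := Kbody.
have [w [c [hc cp]]] := separation cK (ex_intro _ _ body0) vK Kp.
have c0 : 0 <= c by have := hc _ body0; rewrite dotp0l.
pose s := (c + dotp p w) / 2.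
have s0 : 0 < s by rewrite /s; lra.
have : polar K (s^-1 *: w).
  move=> z Kz; rewrite dotpZr mulrC ler_pdivrMr// mul1r.
  by apply: (le_trans (hc _ Kz)); rewrite /s; lra.
move=> /h; rewrite dotpZr mulrC ler_pdivrMr// mul1r /s; lra.
Qed.

Lemma support_is_gauge : exists a b, is_gauge K (support (polar K)) a b.
Proof.
set j := support _.
have [e e0 eP] := polar_ball; have [B B0 PB] := polar_bounded.
have ub x : has_ubound [set dotp x y | y in polar K].
  exists (n%:R * (`|x| * B)) => _ [y Py <-].
  by rewrite (le_trans (ler_norm _))// (le_trans (normr_dotp _ _))// ler_wpM2l// ler_wpM2l// PB.
have hs x : has_sup [set dotp x y | y in polar K] by split=> //; exists (dotp x 0), 0 => //; exact: polar0.
have le_j x y : polar K y -> dotp x y <= j x by move=> Py; apply: ub_le_sup => //; exists y.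
have j_le x c : (forall y, polar K y -> dotp x y <= c) -> j x <= c.
  by move=> h; apply: ge_sup; [exact: (hs x).1|move=> _ [y Py <-]; exact: h].
have jZp t x : 0 < t -> j (t *: x) <= t * j x.
  by move=> t0; apply: j_le => y Py; rewrite dotpZl ler_pM2l// le_j.
have jN x : j (- x) <= j x.
  by apply: j_le => y Py; rewrite dotpNl -dotpNr; exact/le_j/polar_symmetric.
have j0 : j 0 = 0.
  apply/eqP; rewrite eq_le; apply/andP; split.
    by apply: j_le => y _; rewrite dotp0l.
  by rewrite -[leLHS](dotp0l (0 : 'rV[R]_n)); exact/le_j/polar0.
have jZpE t x : 0 < t -> j (t *: x) = t * j x.
  move=> t0; apply/eqP; rewrite eq_le jZp//= -ler_pdivlMl// .
  rewrite -{1}[x]scale1r -(mulVf (lt0r_neq0 t0)) -scalerA; apply: jZp.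
  by rewrite invr_gt0.
(* The radii [e] and [B] are those of balls inside and around the polar body; [+ 1] keeps the
   constant positive in dimension 0. *)
exists e, (n%:R * B + 1); split => //.
- by rewrite ltr_wpDl// mulr_ge0// ltW.
- move=> x; rewrite mulrC -ler_pdivlMr//.
  apply/normrV_leP => [|i]; first by rewrite divr_ge0 ?(ltW e0)// -(dotp0r x); exact/le_j/polar0.
  rewrite ler_pdivlMr//.
  have -> : `|x ord0 i| * e = dotp x ((Num.sg (x ord0 i) * e) *: delta_mx ord0 i).
    by rewrite dotpZr dotp_delta normrEsg; ring.
  apply: le_j; apply: eP; apply/normrV_leP => [|k]; first exact: ltW.
  rewrite !mxE eqxx/= !normrM (gtr0_norm e0).
  case: (_ == _); rewrite ?normr0 ?mulr0 ?(ltW e0)// normr1 mulr1.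
  rewrite -[leRHS]mul1r ler_pM2r// normr_sg; by case: (_ != _).
- move=> x; apply: j_le => y Py; apply: (le_trans (ler_norm _)).
  apply: (le_trans (normr_dotp _ _)); rewrite mulrDl mul1r -mulrA.
  by rewrite ler_wpDr// ler_wpM2l// mulrC ler_wpM2r// PB.
- by move=> x y; apply: j_le => z Pz; rewrite dotpDl lerD// le_j.
- move=> t x; have [t0|t0|->] := ltgtP t 0.
  + rewrite -[t]opprK scaleNr normrN gtr0_norm ?oppr_gt0//.
    rewrite -jZpE ?oppr_gt0//; apply/eqP; rewrite eq_le jN/=.
    by rewrite -{1}[_ *: x]opprK jN.
  + by rewrite gtr0_norm// jZpE.
  + by rewrite scale0r normr0 mul0r.
- move=> x; split => [Kx|jx]; first by apply: j_le => y; exact.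
  by apply: bipolar => y Py; apply: le_trans jx; exact: le_j.
Qed.

End polar_body.

(** * The exponential family of a gauge *)

Section gauge_integrals.
Context {R : realType} {n : nat}.
Variables (K : set 'rV[R]_n) (j : 'rV[R]_n -> R) (a b : R).
Hypothesis Hj : is_gauge K j a b.
Local Notation V := 'rV[R]_n.
Local Notation lam := (@lebesgue_rV R n).
Implicit Types (x y h u v : V) (f g w : V -> R).

Let a0 : 0 < a := gauge_lo_gt0 Hj.
Let b0 : 0 < b := gauge_hi_gt0 Hj.

Lemma gauge_ge0 x : 0 <= j x.
Proof. by apply: le_trans (gauge_lo Hj x); rewrite mulr_ge0// ltW. Qed.

Lemma gaugeN x : j (- x) = j x.
Proof. by rewrite -scaleN1r (gaugeZ Hj) normrN1 mul1r. Qed.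

Lemma norm_le_gauge x : `|x| <= a^-1 * j x.
Proof. by rewrite mulrC ler_pdivlMr// mulrC (gauge_lo Hj). Qed.

Lemma gauge_lip x y : `|j x - j y| <= b * `|x - y|.
Proof.
have h x' y' : j x' - j y' <= b * `|x' - y'|.
  apply: le_trans (gauge_hi Hj _).
  by rewrite lerBlDr -{1}[x'](subrK y') (gaugeD Hj).
by rewrite ler_norml h andbT lerNl opprB distrC h.
Qed.

Lemma continuous_gauge : continuous j.
Proof. exact: (lipschitz_continuous b0 gauge_lip). Qed.

Lemma measurable_gauge : measurable_fun setT j.
Proof. exact: continuous_measurable_rV continuous_gauge. Qed.

Lemma measurable_dotpl y : measurable_fun setT (dotp^~ y : V -> R).
Proof. exact: continuous_measurable_rV (@continuous_dotpl R n y). Qed.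

Lemma dotp_le_gauge x h : `|dotp x h| <= n%:R * `|h| * a^-1 * j x.
Proof.
apply: (le_trans (normr_dotp _ _)); rewrite -!mulrA ler_wpM2l//.
by rewrite mulrC ler_wpM2l// norm_le_gauge.
Qed.

(** Growth slower than every exponential of the gauge. Sums and products stay in this class, and its
    members are integrable against [expR (- (e * j x))] for each [e > 0], which settles the
    integrability questions below. *)
Definition subexp f := measurable_fun setT f /\
  forall e, 0 < e -> exists C, forall x, `|f x| <= C * expR (e * j x).

Lemma subexp_cst (c : R) : subexp (cst c).
Proof.
split=> [|e e0]; first exact: measurable_cst.
exists `|c| => x; rewrite ler_peMr// -expR0 ler_expR mulr_ge0 ?gauge_ge0//; exact: ltW.
Qed.

Lemma subexpD f g : subexp f -> subexp g -> subexp (fun x => f x + g x).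
Proof.
move=> [mf hf] [mg hg]; split; first exact: measurable_funD.
move=> e e0; have [C hC] := hf _ e0; have [D hD] := hg _ e0; exists (C + D) => x.
by rewrite mulrDl (le_trans (ler_normD _ _))// lerD.
Qed.

Lemma subexpM f g : subexp f -> subexp g -> subexp (fun x => f x * g x).
Proof.
move=> [mf hf] [mg hg]; split; first exact: measurable_funM.
move=> e e0; have e20 : 0 < e / 2 by rewrite divr_gt0.
have [C hC] := hf _ e20; have [D hD] := hg _ e20; exists (C * D) => x.
rewrite normrM (_ : C * D * _ = (C * expR (e / 2 * j x)) * (D * expR (e / 2 * j x))).
  by rewrite ler_pM.
by rewrite mulrACA -expRD; congr (_ * expR _); field.
Qed.

Lemma subexp_gauge : subexp j.
Proof.
split; first exact: measurable_gauge.
move=> e e0; exists e^-1 => x; rewrite ger0_norm ?gauge_ge0//.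
rewrite ler_pdivlMl// (le_trans _ (expR_ge1Dx _))// lerDr//.
Qed.

Lemma subexp_dotp h : subexp (dotp^~ h).
Proof.
split; first exact: measurable_dotpl.
move=> e e0; have [_ /(_ _ e0)[C hC]] := subexp_gauge.
exists (n%:R * `|h| * a^-1 * C) => x; apply: (le_trans (dotp_le_gauge x h)).
rewrite -[leRHS]mulrA ler_wpM2l ?mulr_ge0// ?invr_ge0 ?(ltW a0)//.
by rewrite (le_trans (ler_norm _)).
Qed.

Lemma subexpZ (c : R) f : subexp f -> subexp (fun x => c * f x).
Proof. by move=> hf; apply: (subexpM (subexp_cst c)). Qed.

Lemma subexpB f g : subexp f -> subexp g -> subexp (fun x => f x - g x).
Proof.
move=> hf /(subexpZ (-1)) hg; have := subexpD hf hg.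
by under eq_fun do rewrite mulN1r.
Qed.

Lemma subexp_norm f : subexp f -> subexp (fun x => `|f x|).
Proof.
move=> [mf hf]; split; first exact: measurableT_comp.
by move=> e /hf[C hC]; exists C => x; rewrite normr_id.
Qed.

Lemma measurable_expR_gauge (e : R) : measurable_fun setT (fun x => expR (e * j x)).
Proof.
apply: (measurableT_comp (@measurable_expR R)).
by apply: measurable_funM => //; exact: measurable_gauge.
Qed.

Lemma measure_gauge_le (t : R) : (lam [set x | (j x <= t)%R] < +oo)%E.
Proof.
pose s := Num.max 0 (t / a).
have s0 : 0 <= s by rewrite le_max lexx.
apply: (@le_lt_trans _ _ (lam [set x | forall i, - s <= x ord0 i <= s])); last first.
  have -> : (fun x : V => forall i, - s <= x ord0 i <= s) =
     (fun x : V => forall i, (fun=> - s) i <= x ord0 i <= (fun=> s) i) by [].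
  rewrite lebesgue_rV_box ?ltry// => i.
  by rewrite (@le_trans _ _ 0)// oppr_le0.
apply: le_measure; rewrite ?inE.
- exact: measurable_sublevel_rV measurable_gauge.
- rewrite (_ : (fun _ => _) = [set x : V | `|x| <= s]).
    by apply: measurable_sublevel_rV; apply: continuous_measurable_rV; exact: norm_continuous.
  apply/seteqP; split=> x /= h.
    by apply/(normrV_leP _ s0) => i; rewrite ler_norml; exact: h.
  by move=> i; rewrite -ler_norml (le_trans (coord_le_norm x i)).
- move=> x /= jx i; rewrite -ler_norml (le_trans (coord_le_norm x i))//.
  rewrite le_max; apply/orP; right; rewrite ler_pdivlMr// mulrC.
  exact: le_trans (gauge_lo Hj x) jx.
Qed.

(** The homogeneous formula with [k = 0] turns the integral into a factorial times the volume of a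
    ball of the gauge. *)
Lemma integrable_expR_gauge (e : R) : 0 < e ->
  lam.-integrable setT (EFin \o (fun x => expR (- (e * j x)))).
Proof.
move=> e0; apply/integrableP; split.
  apply/measurable_EFinP; under eq_fun do rewrite -mulNr; exact: measurable_expR_gauge.
have mq : measurable_fun setT (fun x => e * j x).
  by apply: measurable_funM => //; exact: measurable_gauge.
under eq_integral => x _ do rewrite /= ger0_norm ?expR_ge0// -[expR _]mul1r.
rewrite (@ge0_integral_homogeneous R n 0 (fun x => e * j x) (cst 1) mq)//.
- have -> : (\int[lam]_(x in [set x | (e * j x <= 1)%R]) (cst 1 x : R)%:E =
             1 * lam [set x | (e * j x <= 1)%R])%E.
    exact: (integral_cst lam (measurable_sublevel_rV 1 mq) 1%E).
  rewrite mul1e lte_mul_pinfty// ?lee_fin//.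
  rewrite (_ : [set x | _] = [set x | (j x <= e^-1)%R]); first exact: measure_gauge_le.
  by apply/seteqP; split=> x /=; rewrite -ler_pdivlMl// mulr1.
- by move=> x; rewrite mulr_ge0 ?gauge_ge0// ltW.
- by move=> t x t0; rewrite (gaugeZ Hj) gtr0_norm//; ring.
- by move=> t x t0; rewrite expr0 mul1r.
Qed.

Lemma integrable_subexp f w (e : R) : 0 < e -> subexp f ->
  measurable_fun setT w -> (forall x, `|w x| <= expR (- (e * j x))) ->
  lam.-integrable setT (EFin \o (fun x => f x * w x)).
Proof.
move=> e0 [mf hf] mw hw; have e20 : 0 < e / 2 by rewrite divr_gt0.
have [C hC] := hf _ e20.
apply: (@le_integrable _ _ _ _ _ measurableT _ (EFin \o (fun x => C * expR (- (e / 2 * j x))))).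
- by apply/measurable_EFinP; exact: measurable_funM.
- move=> x _ /=; rewrite lee_fin normrM.
  rewrite (_ : expR (- (e / 2 * j x)) = expR (e / 2 * j x) * expR (- (e * j x))).
    rewrite mulrA (le_trans _ (ler_norm _))// ler_pM//.
  by rewrite -expRD; congr expR; field.
- exact: (integrableZl measurableT C (integrable_expR_gauge e20)).
Qed.

Lemma unit_box : exists D : set V,
  [/\ measurable D, lam D = 1%E & forall x, D x -> `|x| <= 2^-1].
Proof.
pose D : set V := [set x | forall i, (fun=> - 2^-1) i <= x ord0 i <= (fun=> 2^-1) i].
have lamD : lam D = 1%E.
  rewrite lebesgue_rV_box; last by move=> k; lra.
  by rewrite big1// => k _; lra.
have Dle x : D x -> `|x| <= 2^-1.
  by move=> Dx; apply/normrV_leP => [|k]; [lra|rewrite ler_norml; exact: Dx].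
have mD : measurable D.
  rewrite (_ : D = [set x : V | `|x| <= 2^-1]).
    by apply: measurable_sublevel_rV; apply: continuous_measurable_rV; exact: norm_continuous.
  apply/seteqP; split=> x /= h'; first exact: Dle.
  by move=> k; rewrite -ler_norml (le_trans (coord_le_norm x k)).
by exists D.
Qed.

(* Averaging over the translation by a unit vector [e_i] kills the constant
   [s]: [(p ^+ 2 + (p + h_i) ^+ 2) >= h_i ^+ 2 / 2]. *)
Lemma quadratic_lower_bound : exists2 k : R, 0 < k & forall h (s : R),
  ((k * `|h| ^+ 2)%:E <= \int[lam]_x ((dotp x h - s) ^+ 2 * expR (- (2 * j x)))%R%:E)%E.
Proof.
(* A lower bound of the weight on the sup-norm ball of radius 2, which contains the unit box and its
   translate by [e]. *)
pose m := expR (- (2 * (2 * b))); have m0 : 0 < m by rewrite expR_gt0.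
exists (m / 4) => [|h s]; first by rewrite divr_gt0.
pose phi (x : V) := (dotp x h - s) ^+ 2 * expR (- (2 * j x)).
have phi0 x : 0 <= phi x by rewrite mulr_ge0 ?expR_ge0 ?sqr_ge0.
have mphi : measurable_fun setT phi.
  apply: measurable_funM.
    by apply: measurable_funX; apply: measurable_funB => //; exact: measurable_dotpl.
  by under eq_fun do rewrite -mulNr; exact: measurable_expR_gauge.
have [h0|h0] := eqVneq h 0.
  by rewrite {1}h0 normr0 expr0n mulr0 integral_ge0// => x _; exact: phi0.
have [i hi] : exists i, `|h| = `|h ord0 i|.
  have [[k i] hi] := @mx_norm_neq0 R 1 n h ltac:(by rewrite -[mx_norm h]/(`|h|) normr_eq0).
  by exists i; rewrite -[LHS]/(mx_norm h) hi ord1.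
pose e : V := delta_mx ord0 i.
have phi2 : (\int[lam]_x (phi x + phi (x + e))%:E = \int[lam]_x (phi x)%:E + \int[lam]_x (phi x)%:E)%E.
  have mEphi : measurable_fun setT (EFin \o phi) by exact/measurable_EFinP.
  rewrite -[X in (_ + X)%E](ge0_integral_shift e mEphi); last by move=> x; exact: phi0.
  rewrite -ge0_integralD//.
  - by move=> x _; exact: phi0.
  - by move=> x _; exact: phi0.
  - apply/measurable_EFinP; exact: (measurableT_comp mphi (measurable_shift_rV e)).
have [D [mD lamD Dle]] := unit_box.
have low : ((m / 2 * `|h| ^+ 2)%:E <= \int[lam]_x (phi x + phi (x + e))%:E)%E.
  apply: (@le_trans _ _ (\int[lam]_(x in D) (m / 2 * `|h| ^+ 2)%:E)%E).
    by rewrite integral_cst// [X in (_ * X)%E]lamD mule1.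
  apply: (@le_trans _ _ (\int[lam]_(x in D) (phi x + phi (x + e))%:E)%E); last first.
    apply: ge0_subset_integral => //.
      apply/measurable_EFinP; apply: measurable_funD => //.
      exact: (measurableT_comp mphi (measurable_shift_rV e)).
    by move=> x _; rewrite lee_fin addr_ge0.
  apply: ge0_le_integral => //.
  - by move=> x _; rewrite lee_fin mulr_ge0 ?sqr_ge0// divr_ge0// ltW.
  - apply/measurable_EFinP; apply: measurable_funTS; apply: measurable_funD => //.
    exact: (measurableT_comp mphi (measurable_shift_rV e)).
  move=> x Dx; rewrite lee_fin.
  have xle := Dle x Dx.
  have ele : `|e| <= 1.
    apply/normrV_leP => // k; rewrite mxE eqxx/=.
    by case: (_ == _); rewrite ?normr1 ?normr0.
  have expm y : `|y| <= 2 -> m <= expR (- (2 * j y)).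
    move=> y2; rewrite ler_expR lerN2 ler_pM2l// (le_trans (gauge_hi Hj y))//.
    by rewrite mulrC ler_pM2r.
  have m1 := expm x ltac:(lra).
  have m2 : m <= expR (- (2 * j (x + e))).
    by apply: expm; apply: (le_trans (ler_normD _ _)); lra.
  rewrite /phi dotpDl (dotpC e) dotp_delta hi real_normK ?num_real//.
  set A := dotp x h - s; set B := h ord0 i.
  have -> : dotp x h + B - s = A + B by rewrite /A; ring.
  apply: (@le_trans _ _ (A ^+ 2 * m + (A + B) ^+ 2 * m)); last first.
    by rewrite lerD// ler_wpM2l ?sqr_ge0.
  rewrite -subr_ge0 (_ : _ - _ = m * ((2 * A + B) ^+ 2 / 2)); last by field.
  by rewrite mulr_ge0 ?(ltW m0)// divr_ge0 ?sqr_ge0.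
move: low; rewrite phi2.
have : (0 <= \int[lam]_x (phi x)%:E)%E by apply: integral_ge0 => x _; rewrite lee_fin; exact: phi0.
change (\int[lam]_x ((dotp x h - s) ^+ 2 * expR (- (2 * j x)))%R%:E)%E with (\int[lam]_x (phi x)%:E)%E.
case: (\int[lam]_x (phi x)%:E)%E => [r|_ _|//]; last by rewrite leey.
rewrite -EFinD !lee_fin => _; lra.
Qed.

End gauge_integrals.

Lemma expR_tangent (R : realType) (s t : R) : (1 + (s - t)) * expR t <= expR s.
Proof.
rewrite (_ : expR s = expR (s - t) * expR t); last by rewrite -expRD subrK.
by rewrite ler_pM2r ?expR_gt0// expR_ge1Dx.
Qed.

Lemma ler_norm_expRB (R : realType) (s t M : R) : s <= M -> t <= M ->
  `|expR s - expR t| <= `|s - t| * expR M.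
Proof.
wlog st : s t / t <= s => [H sM tM|sM _].
  have [ts|/ltW ts] := leP t s; first exact: H.
  by rewrite distrC (distrC s); exact: H.
rewrite !ger0_norm ?subr_ge0 ?ler_expR//.
apply: (@le_trans _ _ ((s - t) * expR s)).
  have := expR_tangent t s; lra.
by rewrite ler_wpM2l ?subr_ge0// ler_expR.
Qed.

Section exponential_family.
Context {R : realType} {n : nat}.
Variables (K : set 'rV[R]_n) (j : 'rV[R]_n -> R) (a b : R).
Hypothesis Hj : is_gauge K j a b.
Local Notation V := 'rV[R]_n.
Local Notation lam := (@lebesgue_rV R n).
Implicit Types (x y h u v c z : V) (f g : V -> R).

(** For [t > 0] this is membership in [t] times the polar body, see [polar_leP], written as the
    bound on the exponent that the estimates use. *)
Definition polar_le (t : R) u := forall x, dotp x u <= t * j x.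

Lemma polar_leN t u x : polar_le t u -> `|dotp x u| <= t * j x.
Proof.
move=> pu; rewrite ler_norml pu andbT lerNl -dotpNl -(gaugeN Hj); exact: pu.
Qed.

Lemma polar_leD s t u v : polar_le s u -> polar_le t v -> polar_le (s + t) (u + v).
Proof. by move=> pu pv x; rewrite dotpDr mulrDl lerD. Qed.

Definition wt u x : R := expR (dotp x u - j x).

Lemma measurable_wt u : measurable_fun setT (wt u).
Proof.
apply: (measurableT_comp (@measurable_expR R)).
by apply: measurable_funB; [exact: measurable_dotpl|exact: measurable_gauge Hj].
Qed.

Lemma wt_le u x : polar_le (2^-1) u -> `|wt u x| <= expR (- (2^-1 * j x)).
Proof.
move=> pu; rewrite ger0_norm ?expR_ge0// ler_expR; have := pu x; lra.
Qed.

Lemma wt_ge u x : polar_le (2^-1) u -> expR (- (2 * j x)) <= wt u x.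
Proof.
move=> pu; rewrite ler_expR; have := gauge_ge0 Hj x.
by have := polar_leN x pu; rewrite ler_norml => /andP[+ _]; lra.
Qed.

(** Left unnormalised: the expectation of [f] is this divided by the total mass. *)
Definition tilt u f : R := \int[lam]_x (f x * wt u x).

Lemma integrable_tilt u f : polar_le (2^-1) u -> subexp j f ->
  lam.-integrable setT (EFin \o (fun x => f x * wt u x)).
Proof.
move=> pu sf; apply: (integrable_subexp Hj (e := 2^-1)) => //.
  exact: measurable_wt.
by move=> x; exact: wt_le.
Qed.

Lemma EFin_tilt u f : polar_le (2^-1) u -> subexp j f ->
  (\int[lam]_x (f x * wt u x)%:E = (tilt u f)%:E)%E.
Proof.
move=> pu sf; rewrite /tilt /Rintegral fineK//.
exact: integrable_fin_num (integrable_tilt pu sf).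
Qed.

Lemma eq_tilt u f g : f =1 g -> tilt u f = tilt u g.
Proof. by move=> fg; apply: eq_Rintegral => x _; rewrite fg. Qed.

Lemma tiltD u f g : polar_le (2^-1) u -> subexp j f -> subexp j g ->
  tilt u (fun x => f x + g x) = tilt u f + tilt u g.
Proof.
move=> pu sf sg; rewrite /tilt -RintegralD//; try exact: integrable_tilt.
by apply: eq_Rintegral => x _; rewrite mulrDl.
Qed.

Lemma tiltZ u (t : R) f : polar_le (2^-1) u -> subexp j f ->
  tilt u (fun x => t * f x) = t * tilt u f.
Proof.
move=> pu sf; rewrite /tilt -RintegralZl//; try exact: integrable_tilt.
by apply: eq_Rintegral => x _; rewrite mulrA.
Qed.

Lemma tiltB u f g : polar_le (2^-1) u -> subexp j f -> subexp j g ->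
  tilt u (fun x => f x - g x) = tilt u f - tilt u g.
Proof.
move=> pu sf sg; rewrite /tilt -RintegralB//; try exact: integrable_tilt.
by apply: eq_Rintegral => x _; rewrite mulrBl.
Qed.

Lemma le_tilt u f g : polar_le (2^-1) u -> subexp j f -> subexp j g ->
  (forall x, f x <= g x) -> tilt u f <= tilt u g.
Proof.
move=> pu sf sg fg; apply: le_Rintegral => //; try exact: integrable_tilt.
by move=> x _; rewrite ler_wpM2r// expR_ge0.
Qed.

(** One constant serves all [u], because all weights dominate [expR (- (2 * j x))]. *)
Lemma quadratic_tilt : exists2 k : R, 0 < k & forall u h s, polar_le (2^-1) u ->
  k * `|h| ^+ 2 <= tilt u (fun x => (dotp x h - s) ^+ 2).
Proof.
have [k k0 hk] := quadratic_lower_bound Hj; exists k => // u h s pu.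
have sq : subexp j (fun x => (dotp x h - s) ^+ 2).
  have s1 : subexp j (fun x => dotp x h - s).
    by apply: (subexpB Hj); [exact: (subexp_dotp Hj)|exact: (subexp_cst Hj)].
  exact: (subexpM s1 s1).
rewrite -lee_fin -EFin_tilt//; apply: (le_trans (hk h s)).
apply: ge0_le_integral => //.
- by move=> x _; rewrite lee_fin mulr_ge0 ?sqr_ge0 ?expR_ge0.
- apply/measurable_EFinP; apply: measurable_funM; first exact: sq.1.
  by under eq_fun do rewrite -mulNr; exact: (measurable_expR_gauge Hj).
- by apply/measurable_EFinP; apply: measurable_funM; [exact: sq.1|exact: measurable_wt].
- by move=> x _; rewrite lee_fin ler_wpM2l ?sqr_ge0// wt_ge.
Qed.

Lemma subexp_dotpB x h : subexp j (fun y => dotp (y - x) h).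
Proof.
have := subexpB Hj (subexp_dotp Hj h) (subexp_cst Hj (dotp x h)).
by under eq_fun do rewrite /= -dotpBl.
Qed.

Definition mass u := tilt u (cst 1).

(** The tangent inequality at [u] of the convex function [expR (- dotp x u) * mass u], the integral
    over [y] of [expR (dotp (y - x) u - j y)], after multiplication by [expR (dotp x u)]. It is the
    integral of [1 + s <= expR s]. *)
Lemma tilt_convex x u v : polar_le (2^-1) u -> polar_le (2^-1) v ->
  mass u + tilt u (fun y => dotp (y - x) (v - u)) <= expR (- dotp x (v - u)) * mass v.
Proof.
move=> pu pv; have s1 := subexp_cst Hj 1; have s2 := subexp_dotpB x (v - u).
rewrite /mass -tiltD// /tilt -RintegralZl//; last exact: integrable_tilt.
apply: le_Rintegral => //.
- by apply: integrable_tilt => //; exact: (subexpD s1 s2).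
- have := integrableZl measurableT (expR (- dotp x (v - u))) (integrable_tilt pv s1).
  by apply: eq_integrable.
move=> y _; rewrite mul1r /wt -expRD.
apply: (@le_trans _ _ (expR (dotp (y - x) (v - u)) * wt u y)).
  by rewrite ler_wpM2r ?expR_ge0// expR_ge1Dx.
rewrite /wt -expRD ler_expR dotpBl !dotpBr; lra.
Qed.

(** Both exponents are at most [- (2^-1 * j x)], so the weights differ by at most [|dotp x (u - v)|]
    times that exponential. *)
Lemma tilt_lip f : subexp j f -> exists2 C : R, 0 < C &
  forall u v, polar_le (2^-1) u -> polar_le (2^-1) v ->
  `|tilt u f - tilt v f| <= C * `|u - v|.
Proof.
move=> sf.
pose g x := `|f x| * (n%:R * a^-1 * j x).
have sg : subexp j g.
  apply: (subexpM (subexp_norm sf)); apply: (subexpZ Hj); exact: (subexp_gauge Hj).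
have ig : lam.-integrable setT (EFin \o (fun x => g x * expR (- (2^-1 * j x)))).
  apply: (integrable_subexp Hj (e := 2^-1)) => //.
    by under eq_fun do rewrite -mulNr; exact: (measurable_expR_gauge Hj).
  by move=> x; rewrite ger0_norm ?expR_ge0.
pose C := \int[lam]_x (g x * expR (- (2^-1 * j x))).
have j0 := gauge_ge0 Hj; have a0 := gauge_lo_gt0 Hj.
have g0 x : 0 <= g x by rewrite mulr_ge0// mulr_ge0// mulr_ge0// invr_ge0 ltW.
have C0 : 0 <= C by apply: Rintegral_ge0 => x _; rewrite mulr_ge0 ?expR_ge0.
exists (C + 1) => [|u v pu pv]; first by rewrite ltr_wpDl.
apply: (@le_trans _ _ (C * `|u - v|)); last by rewrite ler_wpM2r// lerDl.
rewrite /tilt -RintegralB//; try exact: integrable_tilt.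
apply: (le_trans (le_normr_Rintegral _ _)) => //.
  have := integrableB measurableT (integrable_tilt pu sf) (integrable_tilt pv sf).
  by apply: eq_integrable.
rewrite mulrC /C -RintegralZl//.
apply: le_Rintegral => //.
- have := integrable_norm (integrableB measurableT (integrable_tilt pu sf) (integrable_tilt pv sf)).
  by apply.
- exact: (integrableZl measurableT `|u - v| ig).
move=> x _; rewrite -mulrBr normrM /g -mulrA mulrCA ler_wpM2l// mulrA.
apply: le_trans (ler_norm_expRB (M := - (2^-1 * j x)) _ _) _.
- have := pu x; lra.
- have := pv x; lra.
rewrite ler_wpM2r ?expR_ge0//.
have -> : dotp x u - j x - (dotp x v - j x) = dotp x (u - v) by rewrite dotpBr; ring.
by rewrite (le_trans (dotp_le_gauge Hj x (u - v)))// le_eqVlt; apply/orP; left; apply/eqP; ring.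
Qed.

End exponential_family.

(** * The moment map *)

Lemma norm_expR_taylor (R : realType) (s : R) :
  `|expR s - 1 - s| <= s ^+ 2 * expR `|s|.
Proof.
have s0 := expR_ge1Dx s.
rewrite ger0_norm; last by lra.
have h : `|expR s - 1| <= `|s| * expR `|s|.
  have := @ler_norm_expRB R s 0 `|s| (ler_norm s) (normr_ge0 s).
  by rewrite expR0 subr0.
have [sp|/ltW sn] := leP 0 s.
  rewrite (ger0_norm sp) in h *; rewrite ger0_norm in h; last by lra.
  have := expR_tangent 0 s; rewrite sub0r expR0 => h1.
  have : expR s - 1 <= s * expR s by lra.
  move=> /(ler_wpM2l sp); lra.
rewrite (ler0_norm sn) in h *; rewrite ler0_norm in h; last first.
  by rewrite subr_le0 -expR0 ler_expR.
have h2 : 1 - expR s <= - s by lra.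
have e1 : 1 <= expR (- s) by rewrite -expR0 ler_expR oppr_ge0.
apply: (@le_trans _ _ (s ^+ 2 * 1)); last by rewrite ler_wpM2l ?sqr_ge0.
rewrite mulr1.
have := expR_tangent 0 s; rewrite sub0r expR0 => h1.
have e2 : 0 < expR s := expR_gt0 s.
(* For negative [s], after multiplication by the positive [1 - s], the claim follows from
   [(1 - s) * expR s <= 1] and [s ^+ 3 <= 0]. *)
have h3 : (1 - s) * (expR s - 1 - s) <= (1 - s) * s ^+ 2.
  suff : 0 <= (1 - s) * s ^+ 2 - (1 - s) * (expR s - 1 - s) by rewrite subr_ge0.
  have s2 : 0 <= - s * s ^+ 2 by rewrite mulr_ge0 ?oppr_ge0 ?sqr_ge0.
  have -> : (1 - s) * s ^+ 2 - (1 - s) * (expR s - 1 - s) = (1 - (1 - s) * expR s) + - s * s ^+ 2.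
    by ring.
  by rewrite addr_ge0// subr_ge0; lra.
have s1 : 0 < 1 - s by lra.
by rewrite ler_pM2l in h3.
Qed.

Lemma lipschitz_continuous_within (R : realType) n (f : 'rV[R]_n -> R) (A : set 'rV[R]_n) (C : R) :
  0 < C -> (forall x y, A x -> A y -> `|f x - f y| <= C * `|x - y|) ->
  {within A, continuous f}.
Proof.
move=> C0 h; apply/subspace_continuousP => x Ax.
apply/(@cvgrPdist_lt _ R^o _ (within A (nbhs x)) _) => e e0.
rewrite near_withinE; near=> y => Ay; apply: (le_lt_trans (h x y Ax Ay)).
rewrite -ltr_pdivlMl//; near: y.
apply/nbhs_ballP; exists (C^-1 * e); first by rewrite /= mulr_gt0// invr_gt0.
by move=> y; rewrite -ball_normE.
Unshelve. all: by end_near. Qed.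

Section moment_map.
Context {R : realType} {n : nat}.
Variables (K : set 'rV[R]_n) (j : 'rV[R]_n -> R) (a b : R).
Hypothesis Hj : is_gauge K j a b.
Local Notation V := 'rV[R]_n.
Local Notation lam := (@lebesgue_rV R n).
Local Notation tilt := (tilt j).
Local Notation mass := (mass j).
Local Notation polar_le := (polar_le j).
Implicit Types (x y h u v c z k : V) (f g : V -> R).

Lemma mass_gt0 u : polar_le (2^-1) u -> 0 < mass u.
Proof.
move=> pu; have [D [mD lamD Dle]] := @unit_box R n.
have sc := subexp_cst Hj 1.
suff : expR (- b) <= mass u by apply: lt_le_trans; exact: expR_gt0.
rewrite -lee_fin -(EFin_tilt Hj)//.
apply: (@le_trans _ _ (\int[lam]_(x in D) (expR (- b))%:E)%E).
  by rewrite integral_cst// [X in (_ * X)%E]lamD mule1.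
have mw : measurable_fun setT (fun x => (cst 1 x * wt j u x)%:E).
  by apply/measurable_EFinP; apply: measurable_funM => //; exact: measurable_wt Hj u.
apply: (@le_trans _ _ (\int[lam]_(x in D) (cst 1 x * wt j u x)%:E)%E); last first.
  apply: ge0_subset_integral => //.
  by move=> x _; rewrite lee_fin mulr_ge0// expR_ge0.
apply: ge0_le_integral => //.
- exact: measurable_funTS.
move=> x /Dle xle; rewrite lee_fin mul1r (le_trans _ (wt_ge Hj x pu))//.
rewrite ler_expR lerN2; have := gauge_hi Hj x; have := gauge_hi_gt0 Hj => b0.
have : b * `|x| <= b * 2^-1 by rewrite ler_pM2l.
lra.
Qed.

(** The point [u] minimises [expR (- dotp x u) * mass u] over the closed cube, and the conclusion is
    the first-order condition. No derivative is formed: the tangent inequality at a point [v]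
    between [u] and [z] gives the sign of the tilt at [v], and Lipschitz continuity carries it to
    [u]. At an interior minimum the condition will force [mean u = x]. *)
Lemma variational x c (d : R) : 0 < d ->
  (forall u, `|u - c| <= d -> polar_le (2^-1) u) ->
  exists u, `|u - c| <= d /\
    forall z, `|z - c| <= d -> 0 <= tilt u (fun y => dotp (y - x) (z - u)).
Proof.
move=> d0 hd.
pose B : set V := [set u | `|u - c| <= d].
have cN : continuous (fun u : V => `|u - c|).
  apply: (lipschitz_continuous (C := 1)) => // u v.
  by rewrite mul1r (le_trans (ler_dist_dist _ _))// opprB addrA subrK.
have cB : compact B.
  apply: bounded_closed_compact.
    exists (d + `|c|); split; first exact: num_real.
    move=> M hM u /= uB; apply: ltW; apply: le_lt_trans hM.
    by rewrite -[u](subrK c) (le_trans (ler_normD _ _))// lerD2r.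
  rewrite (_ : B = (fun u => `|u - c|) @^-1` [set t | t <= d])//.
  by apply: closed_comp; [move=> u _; exact: cN|exact: closed_le].
have [C C0 lipm] := tilt_lip Hj (subexp_cst Hj 1).
have cmass : {within B, continuous mass}.
  by apply: (lipschitz_continuous_within C0) => u v Bu Bv; apply: lipm; exact: hd.
pose G u := expR (- dotp x u) * mass u.
have cG : {within B, continuous G}.
  have cE : {within B, continuous (fun u => expR (- dotp x u))}.
    apply: continuous_subspaceT => v.
    under eq_fun do rewrite -dotpNl dotpC.
    apply: (@continuous_comp _ _ _ (dotp^~ (- x)) expR); last exact: continuous_expR.
    exact: continuous_dotpl.
  move=> u; exact: (cvgM (cE u) (cmass u)).
have B0 : B !=set0 by exists c; rewrite /B/= subrr normr0 ltW.
have [u /set_mem Bu umin] := compact_EVT_min B0 cB cG.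
exists u; split=> // z Bz.
pose f y := dotp (y - x) (z - u).
have sf : subexp j f := subexp_dotpB Hj x (z - u).
have [Cf Cf0 lipf] := tilt_lip Hj sf.
apply/ler_addgt0Pr => e e0.
(* Makes the Lipschitz error between [u] and [v] at most [e]. *)
pose t := Num.min 1 (e / (Cf * (`|z - u| + 1))).
have D0 : 0 < Cf * (`|z - u| + 1) by rewrite mulr_gt0// ltr_wpDl.
have t0 : 0 < t by rewrite lt_min ltr01 divr_gt0.
have t1 : t <= 1 by rewrite ge_min lexx.
pose v := u + t *: (z - u).
have Bv : B v.
  rewrite /B/= /v (_ : _ - c = (1 - t) *: (u - c) + t *: (z - c)); last first.
    by apply/rowP => i; rewrite !mxE; ring.
  rewrite (le_trans (ler_normD _ _))// !normrZ !ger0_norm ?subr_ge0 ?(ltW t0)//.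
  apply: (@le_trans _ _ ((1 - t) * d + t * d)); last by rewrite -mulrDl subrK mul1r.
  by rewrite lerD// ler_wpM2l// ?subr_ge0// ltW.
have pu := hd u Bu; have pv := hd v Bv.
have fv : 0 <= tilt v f.
  have := tilt_convex Hj x pv pu.
  have -> : tilt v (fun y => dotp (y - x) (u - v)) = - t * tilt v f.
    rewrite -(tiltZ Hj)//; apply: eq_tilt => y.
    by rewrite /f -dotpZr; congr dotp; apply/rowP => i; rewrite !mxE; ring.
  have : expR (- dotp x (u - v)) * mass u <= mass v.
    have := umin v (mem_set Bv); rewrite /G => hG.
    rewrite -(ler_pM2l (expR_gt0 (- dotp x v))) mulrA -expRD.
    by rewrite (_ : - dotp x v - _ = - dotp x u)// dotpBr; ring.
  move=> h1 h2; have : - t * tilt v f <= 0 by lra.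
  by rewrite mulNr oppr_le0 pmulr_rge0.
have := lipf u v pu pv.
have -> : `|u - v| = t * `|z - u|.
  by rewrite /v opprD addrA subrr sub0r normrN normrZ gtr0_norm.
rewrite ler_norml => /andP[+ _].
have : Cf * (t * `|z - u|) <= e.
  apply: (@le_trans _ _ (t * (Cf * (`|z - u| + 1)))).
    by rewrite mulrCA ler_pM2l// ler_pM2l// lerDl.
  by rewrite -ler_pdivlMr// ge_min lexx orbT.
lra.
Qed.

(** Differentiation under the integral with an explicit remainder, since [wt j (c + k) y] is
    [wt j c y] times [expR (dotp y k)]. The constant depends on the dominating [g] and not on [f]:
    in the application [f] varies with [k]. *)
Lemma tilt_taylor c (d : R) g : polar_le (4^-1) c -> 
  (forall k, `|k| <= d -> polar_le (4^-1) k) -> subexp j g -> exists2 C : R, 0 < C &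
  forall k f t, `|k| <= d -> 0 <= t -> subexp j f -> (forall y, `|f y| <= t * g y) ->
   `|tilt (c + k) f - (tilt c f + tilt c (fun y => f y * dotp y k))| <= t * `|k| ^+ 2 * C.
Proof.
move=> pc pk sg.
pose G y := g y * (n%:R * a^-1 * j y) ^+ 2.
have sG : subexp j G.
  apply: (subexpM sg); have s1 := subexpZ Hj (n%:R * a^-1) (subexp_gauge Hj).
  exact: (subexpM s1 s1).
have iG : lam.-integrable setT (EFin \o (fun x => G x * expR (- (2^-1 * j x)))).
  apply: (integrable_subexp Hj (e := 2^-1)) => //.
    by under eq_fun do rewrite -mulNr; exact: (measurable_expR_gauge Hj).
  by move=> x; rewrite ger0_norm ?expR_ge0.
pose C := \int[lam]_x (G x * expR (- (2^-1 * j x))).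
have j0 := gauge_ge0 Hj; have a0 := gauge_lo_gt0 Hj.
exists (`|C| + 1) => [|k f t kd t0 sf fg]; first by rewrite ltr_wpDl.
have pc2 : polar_le (2^-1) c.
  by move=> y; apply: (le_trans (pc y)); rewrite ler_wpM2r ?j0//; lra.
have pck : polar_le (2^-1) (c + k).
  have e : 4^-1 + 4^-1 = 2^-1 :> R by field.
  by rewrite -e; exact: polar_leD pc (pk k kd).
have sk : subexp j (fun y => f y * dotp y k) := subexpM sf (subexp_dotp Hj k).
have s2 := subexpD sf sk.
have i1 := integrable_tilt Hj pck sf; have i2 := integrable_tilt Hj pc2 s2.
rewrite -(tiltD Hj)// /tilt -RintegralB//.
apply: (le_trans (le_normr_Rintegral _ _)) => //.
  by have := integrableB measurableT i1 i2; apply: eq_integrable.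
apply: (@le_trans _ _ (t * `|k| ^+ 2 * C)); last first.
  by rewrite ler_wpM2l ?mulr_ge0 ?sqr_ge0// (le_trans (ler_norm _))// lerDl.
rewrite /C -RintegralZl//; apply: le_Rintegral => //.
- have := integrable_norm (integrableB measurableT i1 i2); by apply.
- exact: (integrableZl measurableT (t * `|k| ^+ 2) iG).
move=> y _; set s := dotp y k.
have s1 : `|s| <= n%:R * a^-1 * j y * `|k|.
  by rewrite (le_trans (dotp_le_gauge Hj y k))// le_eqVlt; apply/orP; left; apply/eqP; ring.
have s4 : `|s| <= 4^-1 * j y := polar_leN Hj y (pk k kd).
have -> : f y * wt j (c + k) y - (f y + f y * s) * wt j c y =
    f y * wt j c y * (expR s - 1 - s).
  have -> : wt j (c + k) y = wt j c y * expR s.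
    by rewrite /wt -expRD dotpDr; congr expR; rewrite /s; ring.
  by ring.
have -> : t * `|k| ^+ 2 * (G y * expR (- (2^-1 * j y))) =
    (t * g y) * (expR (- (2^-1 * j y)) * (n%:R * a^-1 * j y * `|k|) ^+ 2).
  by rewrite /G; ring.
rewrite !normrM -mulrA ler_pM// ?mulr_ge0//.
(* The weight at [c] is at most [expR (- (3 / 4 * j y))]. One quarter of the exponent pays for the
   factor [expR |s|], and the half that remains gives integrability. *)
apply: (@le_trans _ _ (expR (- (2^-1 * j y)) * expR (- (4^-1 * j y)) * (s ^+ 2 * expR `|s|))).
  rewrite ler_pM// ?norm_expR_taylor//.
  rewrite ger0_norm ?expR_ge0// -expRD ler_expR; have := pc y; lra.
rewrite -mulrA ler_wpM2l ?expR_ge0// mulrCA.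
apply: (@le_trans _ _ (s ^+ 2)).
  rewrite -[leRHS]mulr1 ler_wpM2l ?sqr_ge0// -expRD -[leRHS]expR0 ler_expR; lra.
rewrite -(real_normK (num_real s)) ler_pXn2r ?nnegrE//.
by rewrite !mulr_ge0// invr_ge0 ltW.
Qed.

End moment_map.

Section moment_map_image.
Context {R : realType} {n : nat}.
Variables (K : set 'rV[R]_n) (j : 'rV[R]_n -> R) (a b : R).
Hypothesis Hj : is_gauge K j a b.
Local Notation V := 'rV[R]_n.
Local Notation tilt := (tilt j).
Local Notation mass := (mass j).
Local Notation polar_le := (polar_le j).
Implicit Types (x y h u v c z k : V) (f g : V -> R).

Definition mean u : V := \row_i (tilt u (fun y => y ord0 i) / mass u).

Definition covmx u : 'M[R]_n := \matrix_(i, k)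
  (tilt u (fun y => (y - mean u) ord0 i * (y - mean u) ord0 k) / mass u).

Lemma subexp_coord i : subexp j (fun y => y ord0 i).
Proof. by have := subexp_dotp Hj (delta_mx ord0 i); under eq_fun do rewrite dotp_delta. Qed.

Lemma subexp_coordB x i : subexp j (fun y => (y - x) ord0 i).
Proof. by have := subexp_dotpB Hj x (delta_mx ord0 i); under eq_fun do rewrite dotp_delta. Qed.

Lemma subexp_sum I (r : seq I) (f : I -> V -> R) :
  (forall i, subexp j (f i)) -> subexp j (fun y => \sum_(i <- r) f i y).
Proof.
move=> sf; elim: r => [|i r IH].
  by have := subexp_cst Hj 0; under [X in _ -> subexp _ X]eq_fun do rewrite big_nil.
by have := subexpD (sf i) IH; under [X in _ -> subexp _ X]eq_fun do rewrite big_cons.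
Qed.

Lemma tilt_sum u I (r : seq I) (f : I -> V -> R) : polar_le (2^-1) u ->
  (forall i, subexp j (f i)) ->
  tilt u (fun y => \sum_(i <- r) f i y) = \sum_(i <- r) tilt u (f i).
Proof.
move=> pu sf; elim: r => [|i r IH].
  rewrite big_nil -[RHS](mul0r (tilt u (cst 0))) -(tiltZ Hj 0 pu (subexp_cst Hj 0)).
  by apply: eq_tilt => y; rewrite big_nil mul0r.
rewrite big_cons -IH -(tiltD Hj)//; last exact: subexp_sum.
by apply: eq_tilt => y; rewrite big_cons.
Qed.

Lemma dotp_mean u h : polar_le (2^-1) u ->
  dotp (mean u) h * mass u = tilt u (dotp^~ h).
Proof.
move=> pu; rewrite /dotp (tilt_sum _ pu) => [|i]; last first.
  have := subexpZ Hj (h ord0 i) (subexp_coord i).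
  by under eq_fun do rewrite mulrC.
rewrite mulr_suml; apply: eq_bigr => i _; rewrite mxE.
rewrite mulrAC divfK ?gt_eqF ?(mass_gt0 Hj)// mulrC.
rewrite -(tiltZ Hj)//; last exact: subexp_coord.
by apply: eq_tilt => y; rewrite mulrC.
Qed.

Lemma tilt_dotpB x u h : polar_le (2^-1) u ->
  tilt u (fun y => dotp (y - x) h) = dotp (mean u - x) h * mass u.
Proof.
move=> pu; rewrite dotpBl mulrBl dotp_mean//.
transitivity (tilt u (fun y => dotp y h - dotp x h * cst 1 y)).
  by apply: eq_tilt => y; rewrite dotpBl mulr1.
have s1 := subexp_cst Hj 1.
rewrite (tiltB Hj)//; first by rewrite (tiltZ Hj).
- exact: (subexp_dotp Hj).
- exact: (subexpZ Hj).
Qed.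

Lemma dotp_covmx u h k : polar_le (2^-1) u ->
  dotp (h *m covmx u) k * mass u =
  tilt u (fun y => dotp (y - mean u) h * dotp (y - mean u) k).
Proof.
move=> pu.
have s2 i l := subexpM (subexp_coordB (mean u) i) (subexp_coordB (mean u) l).
transitivity (tilt u (fun y => \sum_l \sum_i (h ord0 i * k ord0 l) * ((y - mean u) ord0 i * (y - mean u) ord0 l))); last first.
  apply: eq_tilt => y; rewrite /dotp big_distrlr exchange_big/=.
  by apply: eq_bigr => i _; apply: eq_bigr => l _; ring.
rewrite tilt_sum// => [|l]; last by apply: subexp_sum => i; exact: (subexpZ Hj).
rewrite /dotp mulr_suml; apply: eq_bigr => l _.
rewrite tilt_sum// => [|i]; last exact: (subexpZ Hj).
rewrite mxE !mulr_suml; apply: eq_bigr => i _.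
rewrite mxE (tiltZ Hj)//.
by field; rewrite gt_eqF ?(mass_gt0 Hj).
Qed.

(** Strict monotonicity of the gradient of a strictly convex function. With [w = u - v] and common
    mean [x], the function [f y = dotp (y - x) w] has tilt zero at both points. The weights,
    multiplied by [expR (- dotp x u)] and [expR (- dotp x v)], have exponents that differ by [f], so
    [f] times their difference is at least a positive multiple of [f ^+ 2 * expR (- (2 * j y))],
    whose integral is positive unless [w = 0]. *)
Lemma mean_inj u v : polar_le (2^-1) u -> polar_le (2^-1) v -> mean u = mean v -> u = v.
Proof.
move=> pu pv; have [x xE] : exists x, mean u = x by exists (mean u).
rewrite xE => xE'.
have [w wE] : exists w, u - v = w by exists (u - v).
apply/eqP; rewrite -subr_eq0 wE; apply/negPn/negP => w0.
have [k k0 hk] := quadratic_lower_bound Hj.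
have [f fE] : exists f, forall y, f y = dotp (y - x) w by exists (fun y => dotp (y - x) w).
have sf : subexp j f.
  by rewrite (_ : f = fun y => dotp (y - x) w); [exact: subexp_dotpB Hj x w|exact/funext].
have [e [e0 eu ev]] : exists e : R, [/\ 0 < e, e <= expR (- dotp x u) & e <= expR (- dotp x v)].
  exists (Num.min (expR (- dotp x u)) (expR (- dotp x v))).
  by rewrite lt_min !expR_gt0 !ge_min !lexx orbT.
have iu := integrable_tilt Hj pu sf; have iv := integrable_tilt Hj pv sf.
have tu : tilt u f = 0 by rewrite (eq_tilt _ _ fE) tilt_dotpB// xE subrr dotp0l mul0r.
have tv : tilt v f = 0 by rewrite (eq_tilt _ _ fE) tilt_dotpB// xE' subrr dotp0l mul0r.
have iu' := integrableZl measurableT (expR (- dotp x u)) iu.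
have iv' := integrableZl measurableT (expR (- dotp x v)) iv.
have H0 : \int[lebesgue_rV n]_y (expR (- dotp x u) * (f y * wt j u y) -
    expR (- dotp x v) * (f y * wt j v y)) = 0.
  rewrite RintegralB// !RintegralZl//.
  by rewrite -/(tilt u f) -/(tilt v f) tu tv !mulr0 subrr.
have sq : subexp j (fun y => f y ^+ 2) := subexpM sf sf.
have m2 : measurable_fun setT (fun y => expR (- (2 * j y))).
  by under eq_fun do rewrite -mulNr; exact: (measurable_expR_gauge Hj).
have i2 : (lebesgue_rV n).-integrable setT (EFin \o (fun y => f y ^+ 2 * expR (- (2 * j y)))).
  apply: (integrable_subexp Hj (e := 2)) => //.
  by move=> y; rewrite ger0_norm ?expR_ge0.
have : e * (\int[lebesgue_rV n]_y (f y ^+ 2 * expR (- (2 * j y)))) <= 0.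
  rewrite -RintegralZl// -[leRHS]H0; apply: le_Rintegral => //.
  - exact: (integrableZl measurableT e i2).
  - have := integrableB measurableT iu' iv'; by apply: eq_integrable.
  move=> y _.
  have E u' : expR (- dotp x u') * (f y * wt j u' y) = f y * expR (dotp (y - x) u' - j y).
    rewrite mulrCA; congr (_ * _); rewrite /wt -expRD; congr expR; rewrite dotpBl; ring.
  rewrite !E -mulrBr.
  have fAB : f y = (dotp (y - x) u - j y) - (dotp (y - x) v - j y).
    by rewrite fE -wE dotpBr; ring.
  have lowb u' : polar_le (2^-1) u' -> expR (- dotp x u') * expR (- (2 * j y)) <= expR (dotp (y - x) u' - j y).
    move=> pu'; rewrite (_ : expR (dotp (y - x) u' - j y) = expR (- dotp x u') * wt j u' y).
      by rewrite ler_wpM2l ?expR_ge0// (wt_ge Hj).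
    by rewrite /wt -expRD; congr expR; rewrite dotpBl; ring.
  have low1 := lowb u pu; have low2 := lowb v pv.
  have e1 := le_trans (ler_wpM2r (expR_ge0 (- (2 * j y))) eu) low1.
  have e2 := le_trans (ler_wpM2r (expR_ge0 (- (2 * j y))) ev) low2.
  rewrite mulrCA fAB; move: e1 e2.
  move: (e * _) (dotp (y - x) u - j y) (dotp (y - x) v - j y) => q A B {low1 low2 lowb fAB} e1 e2.
  (* What remains is [(A - B) ^+ 2 * q <= (A - B) * (expR A - expR B)] with [q] below both
     exponentials: the tangent at the smaller exponent. *)
  have [AB|/ltW AB] := leP B A.
    rewrite expr2 -mulrA ler_wpM2l ?subr_ge0//.
    have h1 := expR_tangent A B.
    have h2 : (A - B) * q <= (A - B) * expR B by rewrite ler_wpM2l ?subr_ge0.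
    by apply: (le_trans h2); rewrite lerBrDr [leLHS]addrC -[X in X + _]mul1r -mulrDl.
  have -> : (A - B) ^+ 2 * q = (B - A) * ((B - A) * q) by ring.
  have -> : (A - B) * (expR A - expR B) = (B - A) * (expR B - expR A) by ring.
  rewrite ler_wpM2l ?subr_ge0//.
  have h1 := expR_tangent B A.
  have h2 : (B - A) * q <= (B - A) * expR A by rewrite ler_wpM2l ?subr_ge0.
  by apply: (le_trans h2); rewrite lerBrDr [leLHS]addrC -[X in X + _]mul1r -mulrDl.
have := hk w (dotp x w).
rewrite (_ : (\int[_]_y _)%E = (\int[lebesgue_rV n]_y (f y ^+ 2 * expR (- (2 * j y))))%:E); last first.
  rewrite /Rintegral fineK; last exact: integrable_fin_num i2.
  by apply: eq_integral => y _; rewrite fE dotpBl.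
rewrite lee_fin => hI; rewrite pmulr_rle0// => /(le_trans hI).
by rewrite leNgt mulr_gt0// exprn_gt0// normr_gt0.
Qed.

(* For [x] in the parallelepiped, a minimiser of [exp (- <x, u>) * mass u] over
   the cube of radius [d] around [c] satisfies a variational inequality which, by
   Taylor's formula at [c], keeps it off the boundary. *)
Lemma mean_local_surj c : polar_le (4^-1) c -> exists d : R, [/\ 0 < d,
  forall u, `|u - c| <= d -> polar_le (2^-1) u &
  forall v, `|v| <= d / 2 -> exists u, `|u - c| < d /\ mean u = mean c + v *m covmx c].
Proof.
move=> pc.
have j0 := gauge_ge0 Hj; have a0 := gauge_lo_gt0 Hj.
have pc2 : polar_le (2^-1) c.
  by move=> y; apply: (le_trans (pc y)); rewrite ler_wpM2r ?j0//; lra.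
(* The sup-norm ball of this radius lies in a quarter of the polar body. *)
pose d0 := a / (4 * n.+1%:R).
have d00 : 0 < d0 by rewrite divr_gt0// mulr_gt0.
have pk k : `|k| <= d0 -> polar_le (4^-1) k.
  move=> kd y; rewrite (le_trans (ler_norm _))// (le_trans (dotp_le_gauge Hj y k))// ler_wpM2r//.
  apply: (@le_trans _ _ (n.+1%:R * d0 * a^-1)).
    by rewrite ler_wpM2r ?invr_ge0 ?(ltW a0)// ler_pM// ler_nat.
  by rewrite /d0 le_eqVlt; apply/orP; left; apply/eqP; field; rewrite !gt_eqF.
have e4 : 4^-1 + 4^-1 = 2^-1 :> R by field.
have [m mE] : exists m, mean c = m by exists (mean c).
have [S SE] : exists S, covmx c = S by exists (covmx c).
have [Z ZE] : exists Z, mass c = Z by exists (mass c).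
have Z0 : 0 < Z by rewrite -ZE; exact: mass_gt0 Hj _ pc2.
have covE h k : tilt c (fun y => dotp (y - m) h * dotp (y - m) k) = dotp (h *m S) k * Z.
  by rewrite -SE -ZE -mE dotp_covmx.
have centerE h : tilt c (fun y => dotp (y - m) h) = 0.
  by rewrite tilt_dotpB// mE subrr dotp0l mul0r.
rewrite mE SE.
pose C1 : R := \sum_i \sum_l `|S i l|.
have C10 : 0 <= C1 by rewrite sumr_ge0// => i _; rewrite sumr_ge0.
have covB v h : `|dotp (v *m S) h| <= C1 * (`|v| * `|h|).
  rewrite /dotp (le_trans (ler_norm_sum _ _ _))// /C1 exchange_big/= mulr_suml ler_sum// => l _.
  rewrite mxE normrM mulr_suml (le_trans (ler_wpM2r _ (ler_norm_sum _ _ _)))//.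
  rewrite mulr_suml ler_sum// => i _; rewrite normrM.
  rewrite -mulrA mulrCA ler_wpM2l// ler_pM// coord_le_norm//.
(* Dominates [f / |h|] for the test function [f y = dotp (y - m) h - beta] below, whatever [h] and
   [v] are. *)
pose g y := n%:R * `|y - m| + C1.
have sg : subexp j g.
  have s1 : subexp j (fun y => `|y - m|).
    split.
      apply: continuous_measurable_rV; apply: (lipschitz_continuous (C := 1)) => // u v.
      by rewrite mul1r (le_trans (ler_dist_dist _ _))// opprB addrA subrK.
    move=> e e0; have [_ /(_ e e0)[C hC]] := subexp_gauge Hj.
    have [_ /(_ e e0)[D hD]] := subexp_cst Hj `|m|.
    exists (a^-1 * C + D) => y; rewrite normr_id (le_trans (ler_normB _ _))// mulrDl lerD//.
      rewrite (le_trans (norm_le_gauge Hj y))// -mulrA ler_wpM2l ?invr_ge0 ?(ltW a0)//.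
      exact: le_trans (ler_norm _) (hC y).
    exact: le_trans (ler_norm _) (hD y).
  exact: (subexpD (subexpZ Hj n%:R s1) (subexp_cst Hj C1)).
have [C2 C20 taylor] := tilt_taylor Hj pc pk sg.
have [kap kap0 quad] := quadratic_tilt Hj.
(* The first term comes from [beta * dotp m k], which appears because Taylor's formula involves
   [dotp y k] and not its centred version; [C2] is the remainder. *)
pose C3 := Z * C1 * n%:R * `|m| + C2.
have C30 : 0 < C3 by rewrite ltr_wpDl// !mulr_ge0// ltW.
(* The last bound makes the errors [C3 * d] small against the variance constant [kap], which will
   give [|h| <= d / 4]. *)
pose d := Num.min 1 (Num.min d0 (kap / (4 * C3))).
have d_gt0 : 0 < d by rewrite !lt_min ltr01 d00 divr_gt0// mulr_gt0.
have d1 : d <= 1 by rewrite ge_min lexx.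
have dd0 : d <= d0 by rewrite !ge_min lexx orbT.
have dC : C3 * d <= kap / 4.
  have -> : kap / 4 = C3 * (kap / (4 * C3)) by field; rewrite gt_eqF.
  by rewrite ler_pM2l// !ge_min lexx !orbT.
have hd u : `|u - c| <= d -> polar_le (2^-1) u.
  move=> ud; rewrite -(subrK c u) addrC -e4; apply: polar_leD => //; apply: pk.
  exact: le_trans ud dd0.
exists d; split => // v vd.
have [x xE] : exists x, x = m + v *m S by exists (m + v *m S).
have [u [ud VI]] := variational Hj x d_gt0 hd.
have [k kE] : exists k, u - c = k by exists (u - c).
(* If [mean] were affine with linear part [covmx c], the solution would be [c + v]; [h] is the
   deviation of [u] from it. *)
have [h hE] : exists h, v - k = h by exists (v - k).
have vd' : `|v| <= d by lra.
have kd0 : `|k| <= d0 by rewrite -kE; exact: le_trans ud dd0.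
have zu : (c + v) - u = h by rewrite -hE -kE opprB addrA (addrC v) .
have [f fE0] : exists f, f = fun y => dotp (y - x) h by exists (fun y => dotp (y - x) h).
have sf : subexp j f by rewrite fE0; exact: subexp_dotpB Hj x h.
have [beta betaE] : exists beta, dotp (v *m S) h = beta by exists (dotp (v *m S) h).
have vle1 : `|v| <= 1 by lra.
have beta_le : `|beta| <= C1 * (d * `|h|).
  by rewrite -betaE (le_trans (covB v h))// ler_wpM2l// ler_wpM2r.
have yx y : y - x = (y - m) - v *m S by rewrite xE opprD addrA.
have fE y : f y = dotp (y - m) h - beta.
  by rewrite fE0 yx (dotpBl (y - m)) betaE.
have fg y : `|f y| <= `|h| * g y.
  rewrite fE (le_trans (ler_normB _ _))// /g mulrDr lerD//.
    by rewrite (le_trans (normr_dotp _ _))// mulrA mulrC.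
  by rewrite (le_trans beta_le)// [leRHS]mulrC ler_wpM2l// -[leRHS]mul1r ler_wpM2r.
have tc1 : tilt c f = - beta * Z.
  by rewrite fE0 tilt_dotpB// mE xE opprD addrA subrr sub0r dotpNl betaE ZE.
have tc2 : tilt c (fun y => f y * dotp y k) = (dotp (h *m S) k - beta * dotp m k) * Z.
  have s1 := subexp_dotpB Hj m h; have s2 := subexp_dotpB Hj m k.
  have s12 := subexpM s1 s2.
  transitivity (tilt c (fun y => (dotp (y - m) h * dotp (y - m) k + dotp m k * dotp (y - m) h)
      - (beta * dotp (y - m) k + beta * dotp m k * cst 1 y))).
    apply: eq_tilt => y; rewrite fE /= !dotpBl; ring.
  have s3 := subexpZ Hj (dotp m k) s1; have s4 := subexpZ Hj beta s2.
  have s5 := subexpZ Hj (beta * dotp m k) (subexp_cst Hj 1).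
  rewrite (tiltB Hj pc2 (subexpD s12 s3) (subexpD s4 s5)).
  rewrite (tiltD Hj pc2 s12 s3) (tiltD Hj pc2 s4 s5).
  rewrite (tiltZ Hj _ pc2 s1) (tiltZ Hj _ pc2 s2) (tiltZ Hj _ pc2 (subexp_cst Hj 1)).
  rewrite covE !centerE -/(mass c) ZE; ring.
have covC v' h' : dotp (v' *m S) h' = dotp (h' *m S) v'.
  apply: (@mulIf _ Z); first by rewrite gt_eqF.
  by rewrite -!covE; apply: eq_tilt => y; exact: mulrC.
(* The variational inequality is tested at [z = c + v]. In the expansion at [c] the terms [beta * Z]
   cancel and leave [- dotp (h *m S) h * Z], a negative quadratic form in [h], against errors of
   order [|h| * d ^+ 2]. *)
have hmain : kap * `|h| ^+ 2 <= `|h| * (d ^+ 2 * C3).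
  have VI0 : 0 <= tilt (c + k) f.
    have := VI (c + v); rewrite addrAC subrr add0r => /(_ vd').
    have ck : c + k = u by rewrite -kE addrC subrK.
    by rewrite zu -fE0 ck.
  have := taylor k f `|h| kd0 (normr_ge0 _) sf fg; rewrite tc1 tc2 => T.
  have q1 : kap * `|h| ^+ 2 <= dotp (h *m S) h * Z.
    rewrite -covE; apply: (le_trans (quad c h (dotp m h) pc2)).
    by rewrite le_eqVlt; apply/orP; left; apply/eqP; apply: eq_tilt => y; rewrite dotpBl expr2.
  apply: (le_trans q1).
  have hk : dotp (h *m S) k = dotp (h *m S) v - dotp (h *m S) h.
    by rewrite -dotpBr -hE opprB addrCA subrr addr0.
  have bmk : `|beta * dotp m k| <= C1 * (d * `|h|) * (n%:R * (`|m| * d)).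
    have kd : `|k| <= d by rewrite -kE.
    by rewrite normrM ler_pM// (le_trans (normr_dotp _ _))// ler_wpM2l// ler_wpM2l.
  have T2 : `|h| * `|k| ^+ 2 * C2 <= `|h| * d ^+ 2 * C2.
    by rewrite ler_wpM2r ?(ltW C20)// ler_wpM2l// lerXn2r ?nnegrE ?(ltW d_gt0)// -kE.
  move: T bmk; rewrite !ler_norml => /andP[_ T] /andP[b1 _].
  have bZ : - (C1 * (d * `|h|) * (n%:R * (`|m| * d))) * Z <= beta * dotp m k * Z.
    by rewrite ler_pM2r.
  move: T; rewrite hk -(covC v h) betaE /C3.
  have -> : `|h| * (d ^+ 2 * (Z * C1 * n%:R * `|m| + C2)) =
     `|h| * d ^+ 2 * C2 - (- (C1 * (d * `|h|) * (n%:R * (`|m| * d))) * Z) by ring.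
  have -> : - beta * Z + (beta - dotp (h *m S) h - beta * dotp m k) * Z =
     - (dotp (h *m S) h * Z) - beta * dotp m k * Z by ring.
  lra.
have hd2 : `|h| < d / 2.
  have [->|h0] := eqVneq h 0; first by rewrite normr0 divr_gt0.
  have hp : 0 < `|h| by rewrite normr_gt0.
  have : kap * `|h| <= d * (kap / 4).
    rewrite -(ler_pM2l hp); apply: le_trans (_ : _ <= `|h| * (d ^+ 2 * C3)) _.
      by apply: le_trans hmain; rewrite le_eqVlt; apply/orP; left; apply/eqP; ring.
    rewrite ler_pM2l// expr2 -mulrA ler_pM2l// mulrC; exact: dC.
  rewrite (_ : d * (kap / 4) = kap * (d / 4)); last by field.
  rewrite ler_pM2l//; lra.
have kd : `|u - c| < d.
  have -> : u - c = v - h by rewrite -hE kE opprB addrC subrK.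
  by rewrite (le_lt_trans (ler_normB _ _))//; lra.
exists u; split => //.
have pu := hd u ud.
(* As [u] is interior, steps along each coordinate in both directions are allowed, so all components
   of the gradient vanish. *)
have stat i : 0 <= tilt u (fun y => dotp (y - x) (delta_mx ord0 i)) /\ 0 <= - tilt u (fun y => dotp (y - x) (delta_mx ord0 i)).
  pose e := d - `|u - c|; have e0 : 0 < e by rewrite subr_gt0.
  have key s : `|s| <= e -> 0 <= s * tilt u (fun y => dotp (y - x) (delta_mx ord0 i)).
    move=> se; rewrite -(tiltZ Hj)//; last exact: (subexp_dotpB Hj).
    have := VI (u + s *: delta_mx ord0 i).
    have -> : u + s *: delta_mx ord0 i - u = s *: delta_mx ord0 i by rewrite addrC addKr.
    have -> : tilt u (fun y => dotp (y - x) (s *: delta_mx ord0 i)) =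
       tilt u (fun y => s * dotp (y - x) (delta_mx ord0 i)).
      by apply: eq_tilt => y; rewrite dotpZr.
    apply; rewrite addrAC (le_trans (ler_normD _ _))// normrZ.
    have : `|s| * `|delta_mx ord0 i : V| <= e * 1.
      rewrite ler_pM//; apply/normrV_leP => // l; rewrite mxE eqxx/=.
      by case: (_ == _); rewrite ?normr1 ?normr0.
    rewrite mulr1 /e; lra.
  have := key e; have := key (- e); rewrite normrN (gtr0_norm e0) lexx mulNr -mulrN.
  by rewrite !(pmulr_rge0 _ e0) => h1 h2; split; [exact: h2 isT|exact: h1 isT].
rewrite -xE; apply/eqP; rewrite -subr_eq0; apply/eqP/rowP => i; rewrite [RHS]mxE -(dotp_delta (mean u - x)).
have [s1 s2] := stat i.
have mu0 : mass u != 0 by rewrite gt_eqF// (mass_gt0 Hj).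
apply/eqP; rewrite -(mulIr_eq0 _ (mulIf mu0)) -tilt_dotpB//.
by rewrite eq_le s1 -oppr_ge0 s2.
Qed.

End moment_map_image.

(** * Shifted polar bodies *)

Section shifted_polar.
Context {R : realType} {n : nat}.
Variables (K : set 'rV[R]_n) (j : 'rV[R]_n -> R) (a b : R).
Hypothesis Hj : is_gauge K j a b.
Local Notation V := 'rV[R]_n.
Local Notation lam := (@lebesgue_rV R n).
Local Notation tilt := (tilt j).
Local Notation mass := (mass j).
Local Notation polar_le := (polar_le j).
Local Notation mean := (mean j).
Local Notation covmx := (covmx j).
Implicit Types (x y h u v : V) (f g : V -> R).

(* The polar body of the translate of [polar K] by [- u]: its gauge is
   [j x - dotp x u]. *)
Definition shifted_body u : set V := [set x | j x - dotp x u <= 1].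

Let q u x : R := j x - dotp x u.

Let measurable_q u : measurable_fun setT (q u).
Proof. by apply: measurable_funB; [exact: measurable_gauge Hj|exact: measurable_dotpl]. Qed.

Let q_ge u x : polar_le (2^-1) u -> 2^-1 * j x <= q u x.
Proof. by move=> pu; rewrite /q; have := pu x; lra. Qed.

Let q_le u x : polar_le (2^-1) u -> q u x <= 3 / 2 * j x.
Proof. by move=> pu; rewrite /q; have := polar_leN Hj x pu; rewrite ler_norml => /andP[+ _]; lra. Qed.

Let q_ge0 u x : polar_le (2^-1) u -> 0 <= q u x.
Proof. by move=> pu; rewrite (le_trans _ (q_ge x pu))// mulr_ge0// (gauge_ge0 Hj). Qed.

Let qZ u t x : 0 < t -> q u (t *: x) = t * q u x.
Proof. by move=> t0; rewrite /q (gaugeZ Hj) dotpZl gtr0_norm// mulrBr. Qed.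

Lemma measurable_shifted_body u : measurable (shifted_body u).
Proof. exact: (measurable_sublevel_rV 1 (measurable_q u)). Qed.

(** Here and in the next lemma the radii [2 / 3] and [2] come from
    [2^-1 * j x <= q u x <= 3 / 2 * j x]. *)
Lemma shifted_body_sub u x : polar_le (2^-1) u -> j x <= 2 / 3 -> shifted_body u x.
Proof. by move=> pu jx; rewrite /shifted_body/= -/(q u x) (le_trans (q_le x pu))//; lra. Qed.

Lemma shifted_body_sup u x : polar_le (2^-1) u -> shifted_body u x -> j x <= 2.
Proof. by move=> pu; rewrite /shifted_body/= -/(q u x); have := q_ge x pu; lra. Qed.

Lemma convex_body_shifted u : polar_le (2^-1) u -> convex_body (shifted_body u).
Proof.
move=> pu; have a0 := gauge_lo_gt0 Hj; have b0 := gauge_hi_gt0 Hj; split.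
- apply: bounded_closed_compact.
    exists (2 / a); split; first exact: num_real.
    move=> M hM x /= Tx; apply: ltW; apply: le_lt_trans hM.
    rewrite ler_pdivlMr// mulrC (le_trans (gauge_lo Hj x))//; exact: shifted_body_sup Tx.
  have cq : continuous (q u).
    move=> x; apply: (@continuousB _ _ _ j (dotp^~ u)).
      exact: (continuous_gauge Hj).
    exact: continuous_dotpl.
  rewrite (_ : shifted_body u = q u @^-1` [set t | t <= 1])//.
  by apply: closed_comp; [move=> x _; exact: cq|exact: closed_le].
- apply/convex_setP => x y t; rewrite /shifted_body/= -!/(q u _) => Tx Ty t0 t1.
  apply: (@le_trans _ _ (t * q u x + (1 - t) * q u y)).
    rewrite /q dotpDl !dotpZl !mulrBr addrACA opprD lerD//.
    rewrite (le_trans (gaugeD Hj _ _))// !(gaugeZ Hj) !ger0_norm// subr_ge0//.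
  have h1 : t * q u x <= t * 1 by rewrite ler_wpM2l.
  have h2 : (1 - t) * q u y <= (1 - t) * 1 by rewrite ler_wpM2l ?subr_ge0.
  by rewrite (le_trans (lerD h1 h2))// !mulr1 addrC subrK.
- exists 0; apply/nbhs_ballP; exists (2 / 3 / b); first by rewrite /= !divr_gt0.
  move=> x; rewrite -ball_normE/= sub0r normrN => xb.
  apply: shifted_body_sub => //; rewrite (le_trans (gauge_hi Hj x))//.
  by rewrite mulrC -ler_pdivlMr// ltW.
Qed.

(** On the body the weight is at least [expR (-1)], so integrability against the weight is
    enough. *)
Lemma integrable_shifted_body u f : polar_le (2^-1) u -> subexp j f ->
  lam.-integrable (shifted_body u) (EFin \o f).
Proof.
move=> pu sf; have mT := measurable_shifted_body u.
have h := integrableZl mT (expR 1) (integrableS measurableT mT (@subsetT _ _) (integrable_tilt Hj pu sf)).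
apply: le_integrable h => //.
  by apply/measurable_EFinP; apply: measurable_funTS; exact: sf.1.
move=> x Tx /=; rewrite lee_fin !normrM mulrCA -[leLHS]mulr1 ler_wpM2l//.
rewrite !ger0_norm ?expR_ge0// -expRD -[leLHS]expR0 ler_expR.
by move: Tx; rewrite /shifted_body/=; lra.
Qed.

Lemma Rintegral_shifted_body u k f : polar_le (2^-1) u -> subexp j f ->
  (forall x, 0 <= f x) -> (forall t x, 0 < t -> f (t *: x) = t ^+ k * f x) ->
  \int[lam]_(x in shifted_body u) f x = tilt u f / ((n + k)`!)%:R.
Proof.
move=> pu sf f0 fZ.
have := ge0_integral_homogeneous (measurable_q u) sf.1 (fun x => q_ge0 x pu) f0 (@qZ u) fZ.
have -> : (\int[lam]_x (f x * expR (- q u x))%R%:E = (tilt u f)%:E)%E.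
  rewrite -(EFin_tilt Hj pu sf); apply: eq_integral => x _.
  by rewrite /wt /q opprB.
have fin : (\int[lam]_(x in shifted_body u) (f x)%:E)%E \is a fin_num.
  apply: (@integrable_fin_num _ _ _ _ _ _ (EFin \o f)); first exact: measurable_shifted_body.
  exact: integrable_shifted_body.
rewrite -/(shifted_body u) -(fineK fin) -EFinM => -[->].
by rewrite -/(Rintegral _ _ _) mulrAC divff ?mul1r// pnatr_eq0 -lt0n fact_gt0.
Qed.

(** The formula for homogeneous functions asks for a nonnegative integrand, so the linear form is
    split into its positive and negative parts. *)
Lemma Rintegral_shifted_body_dotp u h : polar_le (2^-1) u ->
  \int[lam]_(x in shifted_body u) dotp x h = tilt u (dotp^~ h) / ((n + 1)`!)%:R.
Proof.
move=> pu; have sd := subexp_dotp Hj h.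
have sn := subexp_norm sd.
have sp := subexpZ Hj (2^-1) (subexpD sn sd).
have sm := subexpZ Hj (2^-1) (subexpB Hj sn sd).
have E x : dotp x h = 2^-1 * (`|dotp x h| + dotp x h) - 2^-1 * (`|dotp x h| - dotp x h).
  by field.
rewrite (eq_tilt _ _ E) (tiltB Hj)// mulrBl.
under eq_Rintegral do rewrite E.
have mT := measurable_shifted_body u.
rewrite RintegralB//; try exact: integrable_shifted_body.
congr (_ - _); apply: Rintegral_shifted_body => //.
- by move=> x; rewrite mulr_ge0// -lerBlDr sub0r -normrN ler_norm.
- by move=> t x t0; rewrite dotpZl normrM gtr0_norm//; ring.
- by move=> x; rewrite mulr_ge0// subr_ge0 ler_norm.
- by move=> t x t0; rewrite dotpZl normrM gtr0_norm//; ring.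
Qed.

Lemma vol_shifted_body u : polar_le (2^-1) u -> vol (shifted_body u) = mass u / (n`!)%:R.
Proof.
move=> pu; have := @Rintegral_shifted_body u 0 (cst 1) pu (subexp_cst Hj 1).
rewrite addn0 => <-//; last by move=> t x _; rewrite expr0 mul1r.
by rewrite Rintegral_cst ?mul1r//; exact: measurable_shifted_body.
Qed.

Lemma barycenter_shifted_body u : polar_le (2^-1) u ->
  barycenter (shifted_body u) = n.+1%:R^-1 *: mean u.
Proof.
move=> pu; apply/rowP => i; rewrite !mxE vol_shifted_body//.
under eq_Rintegral do rewrite -dotp_delta.
rewrite Rintegral_shifted_body_dotp// addn1 factS natrM.
under [in RHS]eq_tilt => y do rewrite -dotp_delta.
have n1 : n.+1%:R != 0 :> R by rewrite pnatr_eq0.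
have nf : n`!%:R != 0 :> R by rewrite pnatr_eq0 -lt0n fact_gt0.
have m0 : mass u != 0 by rewrite gt_eqF// (mass_gt0 Hj).
move: n1 nf m0; move: (n.+1%:R) (n`!%:R) (mass u) (tilt u _) => A B C D A0 B0 C0.
by field; rewrite A0 B0 C0.
Qed.

(** Let [D] and [s] be the variance and mean of [dotp x h] in the exponential family. The normalised
    left side equals [(D + s ^+ 2) / ((n + 1) (n + 2)) - (s / (n + 1)) ^+ 2]; the two terms in [s]
    add up to [- s ^+ 2 / ((n + 1) ^ 2 (n + 2))], which is dropped. *)
Lemma second_moment_shifted_body u h : polar_le (2^-1) u ->
  \int[lam]_(x in shifted_body u) (dotp (x - barycenter (shifted_body u)) h) ^+ 2 <=
  vol (shifted_body u) * dotp (h *m covmx u) h / (n.+1%:R * n.+2%:R).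
Proof.
move=> pu; rewrite barycenter_shifted_body//.
have n1 : n.+1%:R != 0 :> R by rewrite pnatr_eq0.
have n2 : n.+2%:R != 0 :> R by rewrite pnatr_eq0.
have nf : n`!%:R != 0 :> R by rewrite pnatr_eq0 -lt0n fact_gt0.
have [s sE] : exists s, dotp (mean u) h = s by exists (dotp (mean u) h).
have sd := subexp_dotp Hj h; have sq := subexpM sd sd.
have scd := subexpZ Hj (2 * s / n.+1%:R) sd.
have scc := subexp_cst Hj ((s / n.+1%:R) ^+ 2).
have mT := measurable_shifted_body u.
have E x : dotp (x - n.+1%:R^-1 *: mean u) h ^+ 2 =
    dotp x h * dotp x h - (2 * s / n.+1%:R * dotp x h - cst ((s / n.+1%:R) ^+ 2) x).
  rewrite dotpBl dotpZl sE /=; move: n1; move: (n.+1%:R : R) => A A0.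
  by field.
have scB := subexpB Hj scd scc.
have int f : subexp j f -> lam.-integrable (shifted_body u) (EFin \o f).
  exact: integrable_shifted_body.
have -> : \int[lam]_(x in shifted_body u) (dotp (x - n.+1%:R^-1 *: mean u) h ^+ 2) =
  \int[lam]_(x in shifted_body u) (dotp x h * dotp x h - (2 * s / n.+1%:R * dotp x h - cst ((s / n.+1%:R) ^+ 2) x)).
  by apply: eq_Rintegral => x _; exact: E.
rewrite (RintegralB mT (int _ sq) (int _ scB)) (RintegralB mT (int _ scd) (int _ scc)).
rewrite (RintegralZl _ mT (int _ sd)) Rintegral_cst//.
rewrite Rintegral_shifted_body_dotp// -(dotp_mean Hj)// sE -/(vol _).
rewrite (@Rintegral_shifted_body u 2)//; first last.
- by move=> t x t0; rewrite dotpZl; ring.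
- by move=> x; rewrite -expr2 sqr_ge0.
have m0 := mass_gt0 Hj pu.
have -> : tilt u (fun x => dotp x h * dotp x h) = (dotp (h *m covmx u) h + s ^+ 2) * mass u.
  rewrite mulrDl (dotp_covmx Hj)//.
  have sm := subexp_dotpB Hj (mean u) h.
  have s1 := subexpZ Hj (2 * s) sm; have s2 := subexp_cst Hj (s ^+ 2).
  transitivity (tilt u (fun y => dotp (y - mean u) h * dotp (y - mean u) h +
     (2 * s * dotp (y - mean u) h + s ^+ 2 * cst 1 y))).
    by apply: eq_tilt => y; rewrite dotpBl sE /=; ring.
  have s3 := subexpZ Hj (s ^+ 2) (subexp_cst Hj 1).
  rewrite (tiltD Hj pu (subexpM sm sm) (subexpD s1 s3)) (tiltD Hj pu s1 s3).
  rewrite (tiltZ Hj _ pu sm) (tiltZ Hj _ pu (subexp_cst Hj 1)) (tilt_dotpB Hj)//.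
  by rewrite subrr dotp0l mul0r mulr0 add0r.
rewrite vol_shifted_body//.
have -> : (n + 1)`!%:R = n.+1%:R * n`!%:R :> R by rewrite addn1 factS natrM.
have -> : (n + 2)`!%:R = n.+2%:R * (n.+1%:R * n`!%:R) :> R by rewrite addn2 !factS !natrM.
move: (dotp (h *m covmx u) h) (mass u) m0 => D Z Z0.
rewrite -subr_ge0.
have -> : Z / n`!%:R * D / (n.+1%:R * n.+2%:R) - ((D + s ^+ 2) * Z / (n.+2%:R * (n.+1%:R * n`!%:R)) -
   (2 * s / n.+1%:R * (s * Z / (n.+1%:R * n`!%:R)) - (s / n.+1%:R) ^+ 2 * (Z / n`!%:R))) =
   s ^+ 2 * Z / n`!%:R * (n.+2%:R - n.+1%:R) / (n.+1%:R ^+ 2 * n.+2%:R).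
  move: n1 n2 nf; move: (n.+1%:R : R) (n.+2%:R : R) (n`!%:R : R) => A B C A0 B0 C0.
  by field; rewrite A0 B0 C0.
have -> : n.+2%:R - n.+1%:R = 1 :> R by rewrite -natrB// subSnn.
rewrite mulr1; apply: divr_ge0; last by rewrite mulr_ge0 ?sqr_ge0 ?ler0n.
by apply: divr_ge0; rewrite ?ler0n// mulr_ge0 ?sqr_ge0 ?ltW.
Qed.

(** For [y] in the polar body, [dotp x y <= j x <= 2 * q u x]. The expectation of [q u] is [n + 1]
    times its average over the shifted body, where [q u] is at most 1. *)
Lemma gauge_mean u : polar_le (2^-1) u -> j (mean u) <= 2 * n.+1%:R.
Proof.
move=> pu; apply: (gauge_bipolar Hj) => y Py.
have m0 := mass_gt0 Hj pu.
rewrite -(ler_pM2r m0) (dotp_mean Hj)//.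
have sj := subexp_gauge Hj.
have sq : subexp j (q u) := subexpB Hj sj (subexp_dotp Hj u).
apply: (@le_trans _ _ (tilt u (fun x => 2 * q u x))).
  apply: (le_tilt Hj) => //; [exact: (subexp_dotp Hj)|exact: (subexpZ Hj)|].
  by move=> x; rewrite (le_trans (gauge_polar Hj x Py))//; have := q_ge x pu; lra.
rewrite (tiltZ Hj)// -mulrA ler_pM2l//.
have := @Rintegral_shifted_body u 1 (q u) pu sq (fun x => q_ge0 x pu).
have f0 : 0 < ((n + 1)`!)%:R :> R by rewrite ltr0n fact_gt0.
move=> /(_ (fun t x t0 => qZ u x t0)).
move=> /(congr1 (fun z => z * ((n + 1)`!)%:R)); rewrite divfK ?gt_eqF// => <-.
apply: (@le_trans _ _ (vol (shifted_body u) * ((n + 1)`!)%:R)); last first.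
  rewrite vol_shifted_body// addn1 factS natrM le_eqVlt; apply/orP; left; apply/eqP; field.
  by rewrite pnatr_eq0 -lt0n fact_gt0.
rewrite ler_pM2r// -[vol _]mul1r -Rintegral_cst//; last exact: measurable_shifted_body.
apply: le_Rintegral => //; try exact: integrable_shifted_body; first exact: measurable_shifted_body.
exact: integrable_shifted_body (subexp_cst Hj 1).
Qed.

End shifted_polar.

(** * Packing *)

Section measure_rV.
Context {R : realType} {n : nat}.
Local Notation V := 'rV[R]_n.
Local Notation lam := (@lebesgue_rV R n).
Implicit Types (x c m : V) (D : set V).

Let integral_indicE D : measurable D -> (lam D = \int[lam]_x (\1_D x)%:E)%E.
Proof. by move=> mD; rewrite integral_indic// setIT. Qed.

Let measurable_EFin_indic D : measurable D -> measurable_fun setT (fun x : V => (\1_D x : R)%:E).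
Proof. by move=> mD; apply/measurable_EFinP; exact: measurable_indic. Qed.

Lemma measure_scale (t : R) D : 0 < t -> measurable D ->
  (lam D = (t ^+ n)%:E * lam [set x | D (t *: x)])%E.
Proof.
move=> t0 mD.
have mtD : measurable [set x | D (t *: x)].
  rewrite (_ : mkset _ = (fun x => x *m t%:M) @^-1` D).
    by rewrite -[X in measurable X]setTI; exact: measurable_mulmx_rV.
  by apply/seteqP; split=> x /=; rewrite mul_mx_scalar.
rewrite !integral_indicE// (ge0_integral_scale t0)//.
exact: measurable_EFin_indic.
Qed.

Lemma measurable_affine_image (A : 'M[R]_n) m D : A \in unitmx -> measurable D ->
  measurable [set m + v *m A | v in D].
Proof.
move=> Au mD.
rewrite (_ : image _ _ = (fun x => (x - m) *m invmx A) @^-1` D).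
  rewrite -[X in measurable X]setTI.
  exact: (measurableT_comp (measurable_mulmx_rV (invmx A)) (measurable_shift_rV (- m))).
apply/seteqP; split=> [_ [v Dv <-]|x Dx] /=.
  by rewrite addrAC subrr add0r mulmxK.
by exists ((x - m) *m invmx A) => //; rewrite mulmxKV// addrC subrK.
Qed.

Lemma ge0_integral_affine_image (A : 'M[R]_n) m D (f : V -> \bar R) : A \in unitmx ->
  measurable D -> measurable_fun setT f -> (forall x, 0 <= f x)%E ->
  (\int[lam]_(x in [set m + v *m A | v in D]%R) f x =
   `|\det A|%:E * \int[lam]_(v in D) f (m + v *m A)%R)%E.
Proof.
move=> Au mD mf f0; have mI := measurable_affine_image m Au mD.
set I := image _ _ in mI *.
have mfI : measurable_fun setT (f \_ I).
  by apply/(measurable_restrictT _ mI); exact: measurable_funTS.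
have fI0 x : (0 <= (f \_ I) x)%E by rewrite patchE; case: ifP.
rewrite integral_mkcond -(ge0_integral_shift m mfI)//.
rewrite -(ge0_integral_mulmx Au); first last.
- by move=> x; exact: fI0.
- exact: (measurableT_comp mfI (measurable_shift_rV m)).
congr (_ * _)%E; rewrite [RHS]integral_mkcond; apply: eq_integral => x _.
rewrite !patchE.
have -> : (x *m A + m \in I) = (x \in D).
  apply/idP/idP => /set_mem; last by move=> Dx; apply/mem_set; exists x => //; rewrite addrC.
  by move=> [v Dv]; rewrite [m + _]addrC => /addIr /(can_inj (mulmxK Au)) <-; exact/mem_set.
by case: ifP => // _; rewrite addrC.
Qed.

Lemma measure_affine_image (A : 'M[R]_n) m D : A \in unitmx -> measurable D ->
  (lam [set m + v *m A | v in D]%R = `|\det A|%:E * lam D)%E.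
Proof.
move=> Au mD; have mI := measurable_affine_image m Au mD.
have := @ge0_integral_affine_image A m D (cst 1%E) Au mD (measurable_cst _) (fun=> lee01).
by rewrite !integral_cst// !mul1e.
Qed.

Lemma closed_ballE_rV c (r : R) : 0 <= r -> [set x : V | `|c - x| <= r] =
  [set x : V | forall i, c ord0 i - r <= x ord0 i <= c ord0 i + r].
Proof.
move=> r0; apply/seteqP; split=> x /=.
  by move=> /(normrV_leP _ r0) h i; have := h i; rewrite !mxE -ler_distlC.
by move=> h; apply/(normrV_leP _ r0) => i; rewrite !mxE ler_distlC.
Qed.

Lemma measurable_closed_ball_rV c (r : R) : measurable [set x : V | `|c - x| <= r].
Proof.
apply: measurable_sublevel_rV; apply: continuous_measurable_rV.
apply: (lipschitz_continuous (C := 1)) => // u v.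
by rewrite mul1r (le_trans (ler_dist_dist _ _))// opprB [X in `|X|]addrC addrA subrK distrC.
Qed.

Lemma measure_closed_ball_rV c (r : R) : 0 <= r ->
  lam [set x : V | `|c - x| <= r] = ((2 * r) ^+ n)%:E.
Proof.
move=> r0; rewrite closed_ballE_rV//.
rewrite (@lebesgue_rV_box R n (fun i => c ord0 i - r) (fun i => c ord0 i + r)); last first.
  by move=> i; lra.
rewrite (eq_bigr (fun=> 2 * r)) => [|i _]; last by ring.
by rewrite prodr_const card_ord.
Qed.

(** Greedy selection: keep a ball of largest radius, discard the balls that meet it, all contained
    in its threefold enlargement, and continue with the others. *)
Lemma vitali_finite (r : V -> R) (s : seq V) : (forall c, c \in s -> 0 < r c) ->
  exists s' : seq V, [/\ uniq s', {subset s' <= s},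
    (forall c c', c \in s' -> c' \in s' -> c != c' -> ball c (r c) `&` ball c' (r c') = set0) &
    forall c, c \in s -> exists2 c', c' \in s' & ball c (r c) `<=` ball c' (3 * r c')].
Proof.
have [k] := ubnP (size s); elim: k s => // k IH s sk sr.
have [->|/eqP s0] := eqVneq s [::]; first by exists [::]; split.
have [c0 c0s c0max] : exists2 c0, c0 \in s & forall c, c \in s -> r c <= r c0.
  move: s0; clear sk sr; elim: s => // c s IHs _.
  have [->|/eqP/IHs[c0 c0s hc0]] := eqVneq s [::].
    by exists c; [exact: mem_head|move=> c'; rewrite inE => /eqP ->].
  have [rr|/ltW rr] := leP (r c) (r c0).
    exists c0; first by rewrite inE c0s orbT.
    by move=> c'; rewrite inE => /orP[/eqP ->|/hc0].
  exists c; first exact: mem_head.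
  by move=> c'; rewrite inE => /orP[/eqP ->//|/hc0/le_trans]; apply.
have rc0 := sr _ c0s.
pose p c := `[< ball c (r c) `&` ball c0 (r c0) = set0 >].
have pc0 : ~~ p c0.
  apply/negP => /asboolP; rewrite setIid => h.
  have : ball c0 (r c0) c0 by exact: ballxx.
  by rewrite h.
have [|c|s' [us' ss' ds' cs']] := IH [seq c <- s | p c].
- rewrite size_filter -ltnS; apply: leq_trans sk.
  rewrite ltnS -(count_predC p s) -addn1 leq_add2l -has_count.
  by apply/hasP; exists c0.
- by rewrite mem_filter => /andP[_ /sr].
have ps' c : c \in s' -> p c by move=> /ss'; rewrite mem_filter => /andP[].
exists (c0 :: s'); split.
- by rewrite /= us' andbT; apply: contra pc0; exact: ps'.
- by move=> c; rewrite inE => /orP[/eqP ->//|/ss']; rewrite mem_filter => /andP[].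
- move=> c c'; rewrite !inE => /orP[/eqP ->|cs] /orP[/eqP ->|c's']; rewrite ?eqxx//.
  + by move=> _; rewrite setIC; exact/asboolP/ps'.
  + by move=> _; exact/asboolP/ps'.
  + exact: ds'.
move=> c cs; have [pc|npc] := boolP (p c).
  have [|c' c's' sub] := cs' c; first by rewrite mem_filter pc.
  by exists c' => //; rewrite inE c's' orbT.
exists c0; first exact: mem_head.
have /set0P[z [zc zc0]] : ball c (r c) `&` ball c0 (r c0) != set0 by apply/eqP => h; move/asboolP: npc.
move=> y; move: zc zc0; rewrite -!ball_normE/= => zc zc0 yc.
have -> : c0 - y = (c0 - z) - (c - z) + (c - y) by apply/rowP => i; rewrite !mxE; ring.
rewrite (le_lt_trans (ler_normD _ _))// (le_lt_trans (lerD (ler_normB _ _) (lexx _)))//.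
have := c0max c cs; lra.
Qed.

Lemma measure_bigsetU_disjoint (I : eqType) (s : seq I) (B : I -> set V) : uniq s ->
  (forall i, i \in s -> measurable (B i)) ->
  (forall i k, i \in s -> k \in s -> i != k -> B i `&` B k = set0) ->
  (lam (\big[setU/set0]_(i <- s) B i) = \sum_(i <- s) lam (B i))%E.
Proof.
elim: s => [|i s IH]; first by rewrite !big_nil measure0.
rewrite /= => /andP[ns us] mB dB; rewrite !big_cons measureU.
- congr (_ + _)%E; apply: IH => // [k ks|k l ks ls]; first by apply: mB; rewrite inE ks orbT.
  by apply: dB; rewrite inE ?ks ?ls orbT.
- by apply: mB; exact: mem_head.
- rewrite big_seq; apply: bigsetU_measurable => k ks; apply: mB; by rewrite inE ks orbT.
rewrite big_seq big_distrr/= big1// => k ks; apply: dB; rewrite ?mem_head// ?inE ?ks ?orbT//.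
by apply: contraNneq ns => ->.
Qed.

Lemma measure_bigsetU_le (I : eqType) (s : seq I) (B : I -> set V) :
  (forall i, measurable (B i)) ->
  (lam (\big[setU/set0]_(i <- s) B i) <= \sum_(i <- s) lam (B i))%E.
Proof.
move=> mB; elim: s => [|i s IH]; first by rewrite !big_nil measure0.
rewrite !big_cons (le_trans (measureU2 _ _ _))//; last by rewrite leeD2l.
by apply: bigsetU_measurable.
Qed.

End measure_rV.

(** * Comparison of volumes under the moment map *)

Section packing.
Context {R : realType} {n : nat}.
Variables (K : set 'rV[R]_n) (j : 'rV[R]_n -> R) (a b : R).
Hypothesis Hj : is_gauge K j a b.
Hypothesis Kbody : convex_body K.
Hypothesis Ksym : symmetric_set K.
Local Notation V := 'rV[R]_n.
Local Notation lam := (@lebesgue_rV R n).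
Local Notation polar_le := (polar_le j).
Local Notation mean := (mean j).
Local Notation covmx := (covmx j).
Implicit Types (x y h u v c : V).

Lemma polar_leP (t : R) u : 0 < t -> polar_le t u <-> polar K (t^-1 *: u).
Proof.
move=> t0; split=> [pu z /(gaugeP Hj) jz|Pu x].
  rewrite dotpZr ler_pdivrMl// mulr1 (le_trans (pu z))//.
  by rewrite -[leRHS]mulr1 ler_pM2l.
by have := gauge_polar Hj x Pu; rewrite dotpZr ler_pdivrMl.
Qed.

Lemma covmx_sym u : (covmx u)^T = covmx u.
Proof.
apply/matrixP => i k; rewrite !mxE; congr (_ / _).
by apply: eq_tilt => y; rewrite mulrC.
Qed.

Lemma covmx_gt0 u h : polar_le (2^-1) u -> h != 0 -> 0 < dotp (h *m covmx u) h.
Proof.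
move=> pu h0; have m0 := mass_gt0 Hj pu.
have [k k0 hk] := quadratic_tilt Hj.
rewrite -(pmulr_lgt0 _ m0) (dotp_covmx Hj)//.
apply: (@lt_le_trans _ _ (k * `|h| ^+ 2)).
  by rewrite mulr_gt0// exprn_gt0// normr_gt0.
apply: (le_trans (hk u h (dotp (mean u) h) pu)).
by rewrite le_eqVlt; apply/orP; left; apply/eqP; apply: eq_tilt => y; rewrite dotpBl expr2.
Qed.

Lemma covmx_unit u : polar_le (2^-1) u -> covmx u \in unitmx.
Proof.
move=> pu; rewrite unitmxE unitfE; apply/det0P => -[h h0 hS].
by have := covmx_gt0 pu h0; rewrite hS dotp0l ltxx.
Qed.

Lemma polar_le_quarter_half u : polar_le (4^-1) u -> polar_le (2^-1) u.
Proof.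
by move=> pu y; apply: (le_trans (pu y)); rewrite ler_wpM2r ?(gauge_ge0 Hj)//; lra.
Qed.

Lemma measure_body : lam K = (vol K)%:E.
Proof.
rewrite /vol fineK// ge0_fin_numE// (_ : K = [set x | j x <= 1]).
  exact: (measure_gauge_le Hj).
by apply/seteqP; split=> x /(gaugeP Hj).
Qed.

Lemma measure_polar : lam (polar K) = (vol (polar K))%:E.
Proof.
have [B B0 PB] := polar_bounded Kbody Ksym.
rewrite /vol fineK// ge0_fin_numE//.
apply: (@le_lt_trans _ _ (lam [set x | `|0 - x| <= B])); last first.
  by rewrite measure_closed_ball_rV ?ltry// ltW.
apply: le_measure; rewrite ?inE.
- exact: compact_measurable_rV (compact_polar Kbody Ksym).
- exact: measurable_closed_ball_rV.
- by move=> y /PB; rewrite /= sub0r normrN.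
Qed.

Lemma compact_polar_le : compact [set c | polar_le (4^-1) c].
Proof.
rewrite (_ : mkset _ = [set 4^-1 *: y | y in polar K]).
  apply: continuous_compact; last exact: compact_polar Kbody Ksym.
  by apply: continuous_subspaceT => x; exact: scaler_continuous.
apply/seteqP; split=> [c /= pc|_ [y Py <-]] /=.
  exists (4 *: c); last by rewrite scalerA mulVf// scale1r.
  by have /polar_leP := pc; rewrite invrK; apply; rewrite invr_gt0.
by apply/polar_leP; rewrite ?invr_gt0// invrK scalerA mulfV// scale1r.
Qed.

Lemma measure_polar_le :
  (lam (polar K) = (4 ^+ n)%:E * lam [set c | polar_le (4^-1)%R c])%E.
Proof.
rewrite (measure_scale (t := 4))//; last exact: compact_measurable_rV (compact_polar Kbody Ksym).
congr (_ * lam _)%E; apply/seteqP; split=> c /=.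
  by move=> Pc; apply/polar_leP; rewrite ?invr_gt0// invrK.
by move/polar_leP; rewrite invrK; apply; rewrite invr_gt0.
Qed.

Lemma measure_gauge_scale (t : R) : 0 < t -> lam [set x | j x <= t] = (t ^+ n * vol K)%:E.
Proof.
move=> t0; rewrite (measure_scale t0); last exact: measurable_sublevel_rV (measurable_gauge Hj).
rewrite EFinM -measure_body; congr (_ * lam _)%E; apply/seteqP; split=> x /=.
  by rewrite (gaugeZ Hj) gtr0_norm// -[leRHS]mulr1 ler_pM2l// => /(gaugeP Hj).
by move=> /(gaugeP Hj) jx; rewrite (gaugeZ Hj) gtr0_norm// -[leRHS]mulr1 ler_pM2l.
Qed.

(** Otherwise the determinant is large at every [c] of the quarter body. Disjoint cubes of radius
    [d c] have disjoint images because [mean] is injective, and these images fit into [2 (n + 1) K],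
    which bounds the sum of [|det| * d c ^+ n] from above. The threefold cubes cover the quarter
    body, which bounds the sum of [d c ^+ n] from below. The two bounds are incompatible. *)
Lemma exists_small_covariance : exists2 c, polar_le (4^-1) c &
  `|\det (covmx c)| * vol (polar K) <= (48 * n.+1%:R) ^+ n * vol K.
Proof.
apply: contrapT => H.
have Hc c : polar_le (4^-1) c -> (48 * n.+1%:R) ^+ n * vol K < `|\det (covmx c)| * vol (polar K).
  by move=> pc; rewrite ltNge; apply/negP => h; apply: H; exists c.
have /choice[d dP] c : exists d : R, polar_le (4^-1) c -> [/\ 0 < d,
    forall u, `|u - c| <= d -> polar_le (2^-1) u &
    forall v, `|v| <= d / 2 -> exists u, `|u - c| < d /\ mean u = mean c + v *m covmx c].
  (* The radius 0 is a dummy value: all centres used lie in the quarter body. *)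
  have [pc|npc] := pselect (polar_le (4^-1) c); last by exists 0.
  by have [d hd] := mean_local_surj Hj pc; exists d.
pose U := [set c | polar_le (4^-1) c].
have U0 : U 0 by move=> x; rewrite dotp0r mulr_ge0// (gauge_ge0 Hj).
have := compact_polar_le; rewrite compact_cover => /(_ V U (fun c => ball c (d c))).
case.
- by move=> c Uc; apply: ball_open; have [] := dP c Uc.
- by move=> c Uc; exists c => //; apply: ballxx; have [] := dP c Uc.
move=> D DU Ucov.
pose s0 : seq V := finmap.enum_fset D.
have s0U c : c \in s0 -> U c by move=> cD; apply/set_mem; exact: DU.
have [s [us ss ds cs]] := vitali_finite (fun c cs => let: And3 h _ _ := dP c (s0U c cs) in h).
have sU c : c \in s -> U c by move=> /ss/s0U.
(* A parallelepiped inside the image under [mean] of the cube of radius [d c]. The half radius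
   [d c / 2] is the price of local surjectivity and makes its volume [|det| * d c ^+ n]. *)
pose B c : set V := [set mean c + v *m covmx c | v in [set v | `|0 - v| <= d c / 2]].
have mB c : c \in s -> measurable (B c).
  move=> /sU Uc; apply: measurable_affine_image; last exact: measurable_closed_ball_rV.
  exact/covmx_unit/polar_le_quarter_half.
have lB c : c \in s -> lam (B c) = (`|\det (covmx c)| * d c ^+ n)%:E.
  move=> /sU Uc; have [d0 _ _] := dP c Uc.
  rewrite measure_affine_image ?measure_closed_ball_rV ?divr_ge0 ?(ltW d0)//.
  - by rewrite -EFinM; congr (_ * _ ^+ _)%:E; field.
  - exact/covmx_unit/polar_le_quarter_half.
  - exact: measurable_closed_ball_rV.
have surj c x : c \in s -> B c x -> exists u, [/\ ball c (d c) u, polar_le (2^-1) u & mean u = x].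
  move=> /sU Uc [v /= vd <-]; have [d0 hd hs] := dP c Uc.
  rewrite sub0r normrN in vd; have [u [uc mu]] := hs v vd.
  exists u; split=> //; last by apply: hd; exact: ltW.
  by rewrite -ball_normE/= distrC.
have dB c c' : c \in s -> c' \in s -> c != c' -> B c `&` B c' = set0.
  move=> cs1 cs2 cc; apply/seteqP; split=> // x [/(surj _ _ cs1)[u [uc pu <-]]].
  move=> /(surj _ _ cs2)[u' [uc' pu' muu']].
  have uu := mean_inj Hj pu' pu muu'.
  rewrite uu in uc'.
  have : (ball c (d c) `&` ball c' (d c')) u by split.
  by rewrite (ds _ _ cs1 cs2 cc).
have BW : \big[setU/set0]_(c <- s) B c `<=` [set x | j x <= 2 * n.+1%:R].
  rewrite big_seq; elim/big_ind : _ => //.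
    by move=> X Y XW YW x [/XW|/YW].
  move=> c cs1 x /(surj _ _ cs1)[u [_ pu <-]]; by have := gauge_mean Hj pu.
have sumB : \sum_(c <- s) (`|\det (covmx c)| * d c ^+ n) <= (2 * n.+1%:R) ^+ n * vol K.
  rewrite -lee_fin -(measure_gauge_scale (mulr_gt0 (ltr0n _ 2) (ltr0Sn _ n))).
  rewrite -sumEFin; apply: (@le_trans _ _ (lam (\big[setU/set0]_(c <- s) B c))).
    rewrite measure_bigsetU_disjoint// big_seq [leRHS]big_seq.
    by apply: lee_sum => c cs1; rewrite lB.
  apply: le_measure; rewrite ?inE//.
    by rewrite big_seq; apply: bigsetU_measurable => c cs1; exact: mB.
  exact: measurable_sublevel_rV (measurable_gauge Hj).
have Us : U `<=` \big[setU/set0]_(c <- s) [set x | `|c - x| <= 3 * d c].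
  move=> x /Ucov[c cD xc]; have [c' c's sub] := cs c cD.
  rewrite (bigD1_seq c')//=; left.
  by have := sub _ xc; rewrite -ball_normE/= => /ltW.
(* The 24 is 4 for passing from the quarter body to the polar body, times 6 since the enlarged cubes
   have side [6 * d c]. *)
have sumU : vol (polar K) <= 24 ^+ n * \sum_(c <- s) d c ^+ n.
  rewrite -lee_fin -measure_polar measure_polar_le -/U.
  apply: (@le_trans _ _ ((4 ^+ n)%:E * \sum_(c <- s) ((2 * (3 * d c)) ^+ n)%:E)%E).
    apply: lee_wpmul2l; first by rewrite lee_fin exprn_ge0.
    apply: (@le_trans _ _ (lam (\big[setU/set0]_(c <- s) [set x | `|c - x| <= 3 * d c]))).
      apply: le_measure; rewrite ?inE//.
        exact: compact_measurable_rV compact_polar_le.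
      by apply: bigsetU_measurable => c _; exact: measurable_closed_ball_rV.
    apply: (le_trans (measure_bigsetU_le _ _)).
      by move=> c; exact: measurable_closed_ball_rV.
    rewrite big_seq [leRHS]big_seq; apply: lee_sum => c /sU Uc.
    have [d0 _ _] := dP c Uc.
    by rewrite measure_closed_ball_rV// mulr_ge0// ltW.
  rewrite sumEFin -EFinM lee_fin !mulr_sumr ler_sum// => c _.
  rewrite -!exprMn le_eqVlt; apply/orP; left; apply/eqP; congr (_ ^+ _); ring.
have volK0 : 0 <= vol K by rewrite fine_ge0.
have volP0 : 0 <= vol (polar K) by rewrite fine_ge0.
(* The strict inequality between the sums needs at least one cube; one of them covers the origin. *)
have s_neq0 : exists2 c0, c0 \in s & true.
  have [c cD _] := Ucov 0 U0; have [c' c's _] := cs c cD; by exists c'.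
have [c0 c0s _] := s_neq0.
have : 0 < \sum_(c <- s) (`|\det (covmx c)| * vol (polar K) - (48 * n.+1%:R) ^+ n * vol K) * d c ^+ n.
  rewrite (bigD1_seq c0)//=; apply: ltr_wpDr.
    rewrite big_seq_cond sumr_ge0// => c /andP[/sU Uc _]; have [d0 _ _] := dP c Uc.
    by rewrite mulr_ge0 ?exprn_ge0 ?(ltW d0)// subr_ge0 ltW// Hc.
  have Uc := sU _ c0s; have [d0 _ _] := dP c0 Uc.
  by rewrite mulr_gt0 ?exprn_gt0// subr_gt0 Hc.
have -> : \sum_(c <- s) (`|\det (covmx c)| * vol (polar K) - (48 * n.+1%:R) ^+ n * vol K) * d c ^+ n =
  (\sum_(c <- s) `|\det (covmx c)| * d c ^+ n) * vol (polar K) -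
   (48 * n.+1%:R) ^+ n * vol K * \sum_(c <- s) d c ^+ n.
  rewrite mulr_suml mulr_sumr -sumrB; apply: eq_bigr => c _; ring.
have h1 := ler_wpM2r volP0 sumB.
have N0 : 0 <= (2 * n.+1%:R) ^+ n * vol K by rewrite mulr_ge0// exprn_ge0// mulr_ge0.
have h2 := ler_wpM2l N0 sumU.
have -> : (48 * n.+1%:R) ^+ n = 24 ^+ n * (2 * n.+1%:R) ^+ n :> R.
  by rewrite -exprMn; congr (_ ^+ _); ring.
rewrite ltNge subr_le0 (le_trans h1)// (le_trans h2)// le_eqVlt.
apply/orP; left; apply/eqP; ring.
Qed.

End packing.

(** * The isotropic constant *)

(** Completing the square in the first variable, then induction on the Schur complement: [A] is an
    inverse Cholesky factor. *)
Lemma posdef_congruent_id (R : realType) n (S : 'M[R]_n) : S^T = S ->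
  (forall h : 'rV[R]_n, h != 0 -> 0 < (h *m S *m h^T) ord0 ord0) ->
  exists2 A : 'M[R]_n, A \in unitmx & A^T *m S *m A = 1%:M.
Proof.
elim: n S => [|n IH] S SS pd.
  exists 1%:M; first exact: unitmx1.
  by apply/matrixP => -[].
have [s [b [D SE]]] : exists s (b : 'rV[R]_n) (D : 'M[R]_n),
    S = block_mx s%:M b (b^T) D :> 'M[R]_(1 + n).
  exists (S ord0 ord0), (ursubmx (S : 'M[R]_(1 + n))), (drsubmx (S : 'M[R]_(1 + n))).
  rewrite -[LHS](@submxK _ 1 n 1 n); congr block_mx.
    rewrite [LHS]mx11_scalar; congr (_%:M).
    by rewrite !mxE; congr (S _ _); exact/val_inj.
  by rewrite trmx_ursub SS.
have DD : D^T = D.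
  have : (block_mx s%:M b (b^T) D : 'M[R]_(1 + n))^T = block_mx s%:M b (b^T) D by rewrite -SE.
  by move=> /(congr1 (@drsubmx _ 1 n 1 n)); rewrite tr_block_mx !block_mxKdr.
have {}pd (h : 'rV[R]_(1 + n)) : h != 0 ->
    0 < (h *m (block_mx s%:M b (b^T) D : 'M[R]_(1 + n)) *m h^T) ord0 ord0.
  by rewrite -SE; exact: pd.
rewrite SE.
have s0 : 0 < s.
  have h0 : row_mx 1%:M 0 != 0 :> 'rV[R]_(1 + n).
    apply/eqP => /(congr1 (@lsubmx _ 1 1 n)); rewrite row_mxKl.
    by move=> /matrixP/(_ ord0 ord0); rewrite !mxE eqxx => /eqP; rewrite oner_eq0.
  have := pd _ h0; rewrite mul_row_block mul1mx mul0mx addr0.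
  by rewrite tr_row_mx mul_row_col tr_scalar_mx mulmx1 trmx0 mulmx0 addr0 mxE eqxx.
have sn0 : s != 0 by rewrite gt_eqF.
pose W := D - s^-1 *: (b^T *m b).
have WW : W^T = W by rewrite /W linearB linearZ/= trmx_mul trmxK DD.
have [|A Au AW] := IH W WW.
  move=> v v0.
  (* The first coordinate is chosen to minimise the form of [S], whose value at [h] is then that of
     [W] at [v]. *)
  pose h : 'rV[R]_(1 + n) := v *m row_mx (- (s^-1 *: b^T)) 1%:M.
  have hE : h = row_mx (- (s^-1 *: (v *m b^T))) v.
    by rewrite /h mul_mx_row mulmx1 mulmxN -scalemxAr.
  have h0 : h != 0.
    by apply: contra v0 => /eqP h0; rewrite -(row_mxKr (- (s^-1 *: (v *m b^T))) v) -hE h0 linear0.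
  have := pd h h0.
  have -> : h *m (block_mx s%:M b (b^T) D : 'M[R]_(1 + n)) = v *m row_mx 0 W.
    rewrite /h -mulmxA mul_row_block !mul1mx; congr (_ *m row_mx _ _).
      by rewrite mulNmx mul_mx_scalar scalerA mulfV// scale1r addNr.
    by rewrite mulNmx -scalemxAl addrC.
  by rewrite hE mul_mx_row mulmx0 tr_row_mx mul_row_col mul0mx add0r.
pose al := (Num.sqrt s)^-1.
have al0 : al != 0 by rewrite invr_eq0 gt_eqF// sqrtr_gt0.
have als : al * s * al = 1.
  have e : Num.sqrt s * Num.sqrt s = s by rewrite -expr2 sqr_sqrtr// ltW.
  have e0 : Num.sqrt s != 0 by rewrite gt_eqF// sqrtr_gt0.
  by rewrite -{1}e /al; field.
suff [B Bu BE] : exists2 B : 'M[R]_(1 + n), B \in unitmx &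
    B^T *m (block_mx s%:M b (b^T) D : 'M[R]_(1 + n)) *m B = 1%:M by exists B.
exists (block_mx al%:M (- (s^-1 *: (b *m A))) 0 A : 'M[R]_(1 + n)).
  by rewrite unitmxE det_ublock det_scalar1 unitrM unitfE al0 -unitmxE.
rewrite -mulmxA tr_block_mx !mulmx_block trmx0 !mulmx0 !mul0mx !addr0.
have -> : s%:M *m - (s^-1 *: (b *m A)) + b *m A = 0.
  by rewrite mul_scalar_mx scalerN scalerA mulfV// scale1r addNr.
have -> : b^T *m - (s^-1 *: (b *m A)) + D *m A = W *m A.
  by rewrite /W mulmxBl mulmxN -scalemxAr -scalemxAl mulmxA addrC.
rewrite !mulmx0 add0r [A^T *m (W *m A)]mulmxA AW.
rewrite tr_scalar_mx !mul_scalar_mx !mul_mx_scalar !scale_scalar_mx.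
rewrite [RHS](@scalar_mx_block _ 1 n); congr block_mx.
  by rewrite mulrA als.
rewrite linearN linearZ/= trmx_mul mul_mx_scalar -scalemxAr scalerN scalerA.
by rewrite (_ : s * al * s^-1 = al) ?addNr//; field.
Qed.

Section isotropic_bound.
Context {R : realType} {n : nat}.
Local Notation V := 'rV[R]_n.
Local Notation lam := (@lebesgue_rV R n).
Implicit Types (x m : V) (D T : set V).

Lemma linear_image_centered (A : 'M[R]_n) T :
  linear_image A (centered T) = [set - (barycenter T *m A) + v *m A | v in T].
Proof.
apply/seteqP; split=> [_ [_ [v Tv <-] <-]|_ [v Tv <-]].
  by exists v => //; rewrite mulmxBl addrC.
by exists (v - barycenter T); [exists v|rewrite mulmxBl addrC].
Qed.

Lemma isotropic_constant_le T (A : 'M[R]_n) : A \in unitmx ->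
  isotropic_constant T <=
  (Num.sqrt n%:R)^-1 * Num.sqrt (isotropic_functional (linear_image A (centered T))).
Proof.
move=> Au; rewrite ler_wpM2l ?invr_ge0 ?sqrtr_ge0//.
apply: ge_inf; last by exists A.
by exists 0 => _ [B _ <-]; exact: sqrtr_ge0.
Qed.

Lemma measurable_norm2_sqr : measurable_fun setT (fun x : V => norm2 x ^+ 2).
Proof.
rewrite (_ : (fun x => _) = (fun x : V => dotp x x)).
  exact: continuous_measurable_rV continuous_dotp_diag.
by apply/funext => x; rewrite sqr_sqrtr ?dotp_ge0.
Qed.

Lemma isotropic_functional_image T (A : 'M[R]_n) : A \in unitmx -> measurable T ->
  isotropic_functional (linear_image A (centered T)) =
  ((`|\det A| * vol T) `^ (1 + 2 / n%:R))^-1 *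
  (`|\det A| * \int[lam]_(x in T) dotp ((x - barycenter T) *m A) ((x - barycenter T) *m A)).
Proof.
move=> Au mT; rewrite /isotropic_functional linear_image_centered; congr (_^-1 * _).
  congr (_ `^ _); rewrite {1}/vol measure_affine_image//.
  have lT0 : (0 <= lam T)%E by exact: measure_ge0.
  (* An infinite measure is sent to 0 by [fine] on both sides. *)
  rewrite /vol; case: (lam T) lT0 => [r //|_|//].
  by rewrite /= mulr0 gt0_muley// lte_fin normr_gt0 -unitfE -unitmxE.
have E := @ge0_integral_affine_image R n A (- (barycenter T *m A)) T
  (fun x => (norm2 x ^+ 2)%:E) Au mT.
rewrite /Rintegral; transitivity (fine (`|\det A|%:E *
   \int[lam]_(v in T) (norm2 (- (barycenter T *m A) + v *m A)%R ^+ 2)%:E)%E).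
  congr fine; apply: E; last by move=> x; rewrite lee_fin sqr_ge0.
  by apply/measurable_EFinP; exact: measurable_norm2_sqr.
have -> : (\int[lam]_(v in T) (norm2 (- (barycenter T *m A) + v *m A)%R ^+ 2)%:E =
    \int[lam]_(x in T) (dotp ((x - barycenter T) *m A) ((x - barycenter T) *m A))%:E)%E.
  apply: eq_integral => x _; rewrite sqr_sqrtr ?dotp_ge0//.
  by rewrite mulmxBl (addrC (x *m A)).
set J := (\int[_]_(_ in _) _)%E.
have : (0 <= J)%E by apply: integral_ge0 => x _; rewrite lee_fin dotp_ge0.
case: J => [r //|_|//].
by rewrite /= mulr0 gt0_muley// lte_fin normr_gt0 -unitfE -unitmxE.
Qed.

End isotropic_bound.

(** * From a small covariance to the isotropic bound *)

Section assembly.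
Context {R : realType} {n : nat}.
Variables (K : set 'rV[R]_n) (j : 'rV[R]_n -> R) (a b : R).
Hypothesis Hj : is_gauge K j a b.
Local Notation V := 'rV[R]_n.
Local Notation lam := (@lebesgue_rV R n).
Local Notation polar_le := (polar_le j).
Local Notation covmx := (covmx j).
Local Notation shifted_body := (shifted_body j).
Implicit Types (x y h u v c : V).

Lemma Rintegral_sum_shifted_body u I (r : seq I) (f : I -> V -> R) : polar_le (2^-1) u ->
  (forall i, subexp j (f i)) ->
  \int[lam]_(x in shifted_body u) (\sum_(i <- r) f i x) =
  \sum_(i <- r) \int[lam]_(x in shifted_body u) f i x.
Proof.
move=> pu sf; have mT := measurable_shifted_body Hj u.
elim: r => [|i r IH].
  rewrite big_nil; under eq_Rintegral do rewrite big_nil.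
  by rewrite Rintegral_cst// mul0r.
rewrite big_cons -IH -RintegralD//.
- by apply: eq_Rintegral => x _; rewrite big_cons.
- exact: (integrable_shifted_body Hj).
- by apply: (integrable_shifted_body Hj) => //; exact: (subexp_sum Hj).
Qed.

(** The integrand is the sum of the squares of [n] linear forms given by the columns of [A], and
    each of them has variance 1 in the exponential family. *)
Lemma second_moment_isotropic u (A : 'M[R]_n) : polar_le (2^-1) u ->
  A^T *m covmx u *m A = 1%:M ->
  \int[lam]_(x in shifted_body u) dotp ((x - barycenter (shifted_body u)) *m A)
      ((x - barycenter (shifted_body u)) *m A) <=
  vol (shifted_body u) * n%:R / (n.+1%:R * n.+2%:R).
Proof.
move=> pu AS.
have [m mE] : exists m, barycenter (shifted_body u) = m by exists (barycenter (shifted_body u)).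
pose col_ i : V := (col i A)^T.
have colE i y : (y *m A) ord0 i = dotp y (col_ i).
  by rewrite mxE; apply: eq_bigr => k _; rewrite !mxE.
have colS i : dotp (col_ i *m covmx u) (col_ i) = 1.
  transitivity ((A^T *m covmx u *m A) i i); last by rewrite AS mxE eqxx.
  rewrite [RHS]mxE; apply: eq_bigr => k _; rewrite [col_ i ord0 k]mxE [col i A k _]mxE.
  congr (_ * _); rewrite !mxE; apply: eq_bigr => l _; by rewrite !mxE.
rewrite mE.
have sB i : subexp j (fun x => dotp (x - m) (col_ i) ^+ 2).
  exact: (subexpM (subexp_dotpB Hj m (col_ i)) (subexp_dotpB Hj m (col_ i))).
have E x : dotp ((x - m) *m A) ((x - m) *m A) = \sum_i dotp (x - m) (col_ i) ^+ 2.
  by apply: eq_bigr => i _; rewrite colE expr2.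
under eq_Rintegral do rewrite E.
rewrite Rintegral_sum_shifted_body//.
apply: (@le_trans _ _ (\sum_(i < n) vol (shifted_body u) * 1 / (n.+1%:R * n.+2%:R))).
  apply: ler_sum => i _; have := second_moment_shifted_body Hj (col_ i) pu.
  by rewrite mE colS.
by rewrite sumr_const card_ord mulr1 -[leLHS]mulr_natr mulrAC.
Qed.

Lemma vol_polar_gt0 : convex_body K -> symmetric_set K -> 0 < vol (polar K).
Proof.
move=> Kbody Ksym; have [e e0 eP] := polar_ball Kbody.
rewrite -lte_fin -(measure_polar Kbody Ksym).
apply: (@lt_le_trans _ _ (lam [set x | `|0 - x| <= e])).
  by rewrite measure_closed_ball_rV ?(ltW e0)// lte_fin exprn_gt0// mulr_gt0.
apply: le_measure; rewrite ?inE.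
- exact: measurable_closed_ball_rV.
- exact: compact_measurable_rV (compact_polar Kbody Ksym).
- by move=> y /=; rewrite sub0r normrN; exact: eP.
Qed.

Lemma vol_body_gt0 : 0 < vol K.
Proof.
have p0 : polar_le (2^-1) 0.
  by move=> x; rewrite dotp0r mulr_ge0// (gauge_ge0 Hj).
have -> : K = shifted_body 0.
  by apply/seteqP; split=> x; rewrite /shifted_body/= dotp0r subr0 => /(gaugeP Hj).
by rewrite (vol_shifted_body Hj)// divr_gt0 ?(mass_gt0 Hj)// ltr0n fact_gt0.
Qed.

Lemma vol_shifted_body_ge u : polar_le (2^-1) u ->
  (2 / 3) ^+ n * vol K <= vol (shifted_body u).
Proof.
move=> pu; have mT := measurable_shifted_body Hj u.
have fin : lam (shifted_body u) = (vol (shifted_body u))%:E.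
  rewrite /vol fineK// ge0_fin_numE//.
  apply: le_lt_trans (measure_gauge_le Hj 2).
  apply: le_measure; rewrite ?inE//; last by move=> x; exact: shifted_body_sup.
  exact: measurable_sublevel_rV (measurable_gauge Hj).
have p23 : 0 < 2 / 3 :> R by rewrite divr_gt0.
rewrite -lee_fin -fin -(measure_gauge_scale Hj p23).
apply: le_measure; rewrite ?inE//; last by move=> x; exact: (shifted_body_sub Hj).
exact: measurable_sublevel_rV (measurable_gauge Hj).
Qed.

(** Put [W = |det A| * vol T], where [T] is the shifted body. The integral is at most
    [W * n / ((n + 1) (n + 2))], and [W ^+ 2 * |det (covmx c)| = vol T ^+ 2], so the bound on the
    determinant and [vol T >= (2 / 3) ^ n * vol K] bound [W] from below. *)
Lemma isotropic_functional_small c (A : 'M[R]_n) : (0 < n)%N ->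
  convex_body K -> symmetric_set K ->
  polar_le (4^-1) c ->
  `|\det (covmx c)| * vol (polar K) <= (48 * n.+1%:R) ^+ n * vol K ->
  A \in unitmx -> A^T *m covmx c *m A = 1%:M ->
  isotropic_functional (linear_image A (centered (shifted_body c))) <=
  108 / volume_product K `^ (n%:R^-1).
Proof.
move=> n0 Kbody Ksym pc4 hdet Au AS.
have pc := polar_le_quarter_half Hj pc4.
have mT := measurable_shifted_body Hj c.
rewrite isotropic_functional_image//.
have := second_moment_isotropic pc AS.
move: (\int[_]_(_ in _) _) => J hJ.
have vP0 := vol_polar_gt0 Kbody Ksym; have vK0 := vol_body_gt0.
have vT := vol_shifted_body_ge pc.
have pK0 : 0 < (2 / 3) ^+ n * vol K by rewrite mulr_gt0// exprn_gt0// divr_gt0.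
have vT0 : 0 < vol (shifted_body c) := lt_le_trans pK0 vT.
have dA0 : 0 < `|\det A| by rewrite normr_gt0 -unitfE -unitmxE.
have detAS : `|\det A| ^+ 2 * `|\det (covmx c)| = 1.
  have := congr1 determinant AS; rewrite !det_mulmx det_tr det1 => /(congr1 Num.norm).
  by rewrite !normrM normr1 => <-; rewrite expr2 mulrAC.
move: hdet vT vT0 dA0 detAS hJ vP0 vK0; rewrite /volume_product.
move: (vol (shifted_body c)) (vol K) (vol (polar K)) `|\det A| `|\det (covmx c)| => vT vK vP dA dS.
move=> hdet vTle vT0 dA0 detAS hJ vP0 vK0.
have dS0 : 0 < dS by rewrite -(pmulr_rgt0 _ (exprn_gt0 2 dA0)) detAS.
have [W WE] : exists W, dA * vT = W by exists (dA * vT).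
have W0 : 0 < W by rewrite -WE mulr_gt0.
have n0' : 0 < n%:R :> R by rewrite ltr0n.
have n1 : 0 < n.+1%:R :> R by rewrite ltr0n.
have n2 : 0 < n.+2%:R :> R by rewrite ltr0n.
have q0 : 0 < (108 * n.+1%:R)^-1 :> R by rewrite invr_gt0 mulr_gt0.
have s0 : 0 < vK * vP by rewrite mulr_gt0.
(* The [n]-th root of [(108 (n + 1)) ^ (- n) * vol K * vol (polar K) <= W ^+ 2]. *)
have key : (108 * n.+1%:R)^-1 * (vK * vP) `^ n%:R^-1 <= W `^ (2 / n%:R).
  have -> : (108 * n.+1%:R)^-1 = ((108 * n.+1%:R)^-1 ^+ n) `^ n%:R^-1 :> R.
    by rewrite -powR_mulrn ?(ltW q0)// -powRrM mulfV ?gt_eqF// powRr1// ltW.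
  rewrite -powRM ?exprn_ge0 ?(ltW q0) ?(ltW s0)//.
  rewrite powRrM powR_mulrn ?(ltW W0)//.
  apply: ge0_ler_powR; rewrite ?nnegrE ?invr_ge0 ?mulr_ge0 ?exprn_ge0 ?(ltW q0) ?(ltW s0) ?(ltW W0) ?(ltW vK0) ?(ltW vP0)//.
  rewrite -(ler_pM2r dS0).
  apply: (@le_trans _ _ (((2 / 3) ^+ n * vK) ^+ 2)); last first.
    have -> : W ^+ 2 * dS = vT ^+ 2.
      by rewrite -WE exprMn mulrAC detAS mul1r.
    by rewrite lerXn2r// nnegrE ltW// mulr_gt0// exprn_gt0// divr_gt0.
  have h := ler_wpM2l (mulr_ge0 (exprn_ge0 n (ltW q0)) (ltW vK0)) hdet.
  have e1 : (108 * n.+1%:R)^-1 ^+ n * vK * (dS * vP) = (108 * n.+1%:R)^-1 ^+ n * (vK * vP) * dS.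
    by ring.
  rewrite -e1; apply: (le_trans h).
  have e2 : (108 * n.+1%:R)^-1 ^+ n * (48 * n.+1%:R) ^+ n = ((2 / 3) ^+ n) ^+ 2 :> R.
    by rewrite -exprMn exprAC; congr (_ ^+ _); field; rewrite gt_eqF.
  by rewrite [(_ * vK) ^+ 2]exprMn -e2 le_eqVlt; apply/orP; left; apply/eqP; ring.
rewrite WE powRD; last by rewrite gt_eqF ?implybT.
rewrite powRr1 ?(ltW W0)//.
have WW0 : 0 < W `^ (2 / n%:R) by apply: powR_gt0.
have sp0 : 0 < (vK * vP) `^ n%:R^-1 by apply: powR_gt0.
rewrite invfM -mulrA ler_pdivrMl// ler_pdivrMl//.
apply: (@le_trans _ _ (W * n.+1%:R^-1)).
  apply: (@le_trans _ _ (dA * (vT * n%:R / (n.+1%:R * n.+2%:R)))).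
    by rewrite ler_pM2l.
  (* As [n <= n + 2], a factor [1 / (n + 1)] is left, which cancels the [n + 1] of [key]. *)
  rewrite -WE -!mulrA ler_pM2l// ler_pM2l// invfM mulrCA -[leRHS]mulr1 ler_pM2l ?invr_gt0//.
  by rewrite ler_pdivrMr// mul1r ler_nat ltnW// ltnS.
rewrite [leRHS]mulrCA ler_pM2l// mulrA ler_pdivlMr// [leRHS]mulrC.
have -> : n.+1%:R^-1 * (vK * vP) `^ n%:R^-1 = 108 * ((108 * n.+1%:R)^-1 * (vK * vP) `^ n%:R^-1).
  by move: n1; move: (n.+1%:R : R) => N N0; field; rewrite gt_eqF.
by rewrite ler_pM2l.
Qed.

End assembly.

Theorem theorem1p2 (R : realType) :
  exists c2 c3 c4 : R, [/\ 0 < c2, 0 < c3, 0 < c4 &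
    forall (n : nat) (K : set 'rV[R]_n), (1 <= n)%N ->
      convex_body K -> symmetric_set K ->
      exists T : set 'rV[R]_n, [/\ convex_body T,
        dilate c2 K `<=` difference_body T,
        difference_body T `<=` dilate c3 K &
        isotropic_constant T <=
          c4 / Num.sqrt (n%:R * volume_product K `^ (n%:R^-1))]].
Proof.
(* The body contains [2 / 3 K] and the origin, hence so does its difference body; it lies in [2 K],
   hence its difference body in [4 K]. *)
exists (2 / 3), 4, (Num.sqrt 108); split; rewrite ?divr_gt0 ?sqrtr_gt0//.
move=> n K n0 Kbody Ksym.
have [a [b Hj]] := support_is_gauge Kbody Ksym.
move: (support (polar K)) Hj => j Hj.
have [c pc4 hdet] := exists_small_covariance Hj Kbody Ksym.
have pc := polar_le_quarter_half Hj pc4.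
(* This [A] normalises the covariance of the exponential family, not that of the body itself; as one
   competitor in the infimum it is good enough. *)
have [|A Au AS] := posdef_congruent_id (covmx_sym j c).
  move=> h h0; have := covmx_gt0 Hj pc h0; congr (_ < _).
  by rewrite [RHS]mxE; apply: eq_bigr => i _; rewrite [h^T _ _]mxE.
exists (shifted_body j c); split.
- exact: convex_body_shifted Hj _ pc.
- move=> _ [x /(gaugeP Hj) jx <-]; exists (2 / 3 *: x).
    apply: (shifted_body_sub Hj) => //; rewrite (gaugeZ Hj) ger0_norm ?divr_ge0//.
    by rewrite -[leRHS]mulr1 ler_wpM2l// divr_ge0.
  exists 0; last by rewrite subr0.
  by apply: (shifted_body_sub Hj) => //; rewrite -(scale0r 0) (gaugeZ Hj) normr0 mul0r divr_ge0.
- move=> _ [x Tx [y Ty <-]]; exists (4^-1 *: (x - y)).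
    apply/(gaugeP Hj); rewrite (gaugeZ Hj) ger0_norm ?invr_ge0//.
    rewrite ler_pdivrMl// mulr1 (le_trans (gaugeD Hj _ _))// (gaugeN Hj).
    have := shifted_body_sup pc Tx; have := shifted_body_sup pc Ty; lra.
  by rewrite scalerA mulfV// scale1r.
apply: (le_trans (isotropic_constant_le _ Au)).
have small := isotropic_functional_small Hj n0 Kbody Ksym pc4 hdet Au AS.
rewrite (sqrtrM _ (ler0n R n)) invfM mulrCA ler_wpM2l ?invr_ge0 ?sqrtr_ge0//.
rewrite -sqrtrV ?powR_ge0// -(sqrtrM _ (ler0n R 108)).
exact: ler_wsqrtr.
Qed.
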